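(* There is a universal constant $C$ such that, if $0<\alpha<1$ and $(v,p)$ solves the incompressible Euler equations $$\partial_t v+\operatorname{div}(v\otimes v)+\nabla p=0,\qquad \operatorname{div} v=0$$ in the sense of distributions on $I\times\mathbb{T}^n$, with $v\in L_t^\infty C_x^\alpha$, then each Littlewood–Paley projection $P_kv$ ($k\in\mathbb{Z}$) satisfies $$\|(\partial_t+v\cdot\nabla)P_kv\|_{C^0}\le C\,2^{(1-2\alpha)k}\|v\|^2_{C_t\dot C_x^\alpha}.$$
   Context: $\mathbb{T}^n=\mathbb{R}^n/\Gamma$ is a torus ($\Gamma$ a lattice, $n\ge2$), $I\subseteq\mathbb{R}$ an open interval. $v$ is taken equal to its representative that is continuous in $(t,x)$. $\|\cdot\|_{C^0}$ is the supremum over $(t,x)\in I\times\mathbb{T}^n$, and $\|v\|_{C_t\dot C_x^\alpha}=\sup_t\sup_x\sup_{h\in\mathbb{R}^n\setminus\{0\}}\frac{|v(t,x+h)-v(t,x)|}{|h|^\alpha}$. Littlewood–Paley projections: fix once and for all a radially symmetric Schwartz function $\eta:\mathbb{R}^n\to\mathbb{R}$ with $\hat\eta$ supported in the unit ball and $\hat\eta(\xi)=1$ for $|\xi|\le\frac12$; set $\eta_{\le k}(h)=2^{nk}\eta(2^kh)$, $P_{\le k}f(t,x)=\int_{\mathbb{R}^n}f(t,x+h)\eta_{\le k}(h)\,dh$ (functions on $\mathbb{T}^n$ regarded as periodic on $\mathbb{R}^n$) and $P_k=P_{\le k}-P_{\le k-1}$. ''Universal'' means that $C$ depends only on $n$ and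 the choice of $\eta$; in particular it does not depend on the torus. *)

(* Defs.v *)
From HB Require Import structures.
From mathcomp Require Import all_boot all_order all_algebra complex.
From mathcomp Require Import all_classical all_reals all_analysis.

Set Implicit Arguments.
Unset Strict Implicit.
Unset Printing Implicit Defensive.

Import Order.TTheory GRing.Theory Num.Theory.
Import numFieldNormedType.Exports.

Local Open Scope classical_set_scope.
Local Open Scope ring_scope.

(* The library norm on 'rV[R]_n is the sup norm; |.| on R^n is this one. *)
Definition dotp (R : realType) (n : nat) (x y : 'rV[R]_n) : R :=
  \sum_(i < n) x 0 i * y 0 i.

Definition enorm (R : realType) (n : nat) (x : 'rV[R]_n) : R :=
  Num.sqrt (dotp x x).

(* Lebesgue measure on R^n, carried by n.-tuple R (which has the product
   sigma-algebra in the library), as the n-fold product measure. *)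
Definition tcons (R : realType) (n : nat)
    (x : measurableTypeR R * n.-tuple (measurableTypeR R)) :
    n.+1.-tuple (measurableTypeR R) :=
  [tuple of x.1 :: x.2].

Lemma measurable_tcons (R : realType) (n : nat) :
  measurable_fun setT (@tcons R n).
Proof. exact: measurable_cons. Qed.

Definition cons_measure (R : realType) (n : nat)
    (m : {sigma_finite_measure set (n.-tuple (measurableTypeR R)) -> \bar R}) :
    set (n.+1.-tuple (measurableTypeR R)) -> \bar R :=
  pushforward (product_measure1 (@lebesgue_measure R) m) (@tcons R n).

Section cons_measure.
Context (R : realType) (n : nat).
Context (m : {sigma_finite_measure set (n.-tuple (measurableTypeR R)) -> \bar R}).

Let measurable_pre A : measurable A -> measurable (@tcons R n @^-1` A).
Proof. by move=> mA; rewrite -[X in measurable X]setTI; exact: measurable_tcons. Qed.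

Let cons_measure0 : cons_measure m set0 = 0%E.
Proof. by rewrite /cons_measure /pushforward preimage_set0 measure0. Qed.

Let cons_measure_ge0 A : (0 <= cons_measure m A)%E.
Proof. exact: (measure_ge0 (product_measure1 (@lebesgue_measure R) m)). Qed.

Let cons_measure_sigma_additive : semi_sigma_additive (cons_measure m).
Proof.
move=> F mF tF mUF; rewrite /cons_measure /pushforward preimage_bigcup.
apply: measure_semi_sigma_additive.
- by move=> k; exact: measurable_pre.
- apply/trivIsetP => /= i j _ _ ij; rewrite -preimage_setI.
  by move/trivIsetP : tF => /(_ _ _ _ _ ij) ->//; rewrite preimage_set0.
- by rewrite -preimage_bigcup; exact: measurable_pre.
Qed.

HB.instance Definition _ := isMeasure.Build _ _ _ (cons_measure m)
  cons_measure0 cons_measure_ge0 cons_measure_sigma_additive.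

Let cons_measure_sigma_finite : sigma_finite setT (cons_measure m).
Proof.
have /sigma_finiteP[F [FT ndF Foo]] := sigma_finiteT (@lebesgue_measure R).
have /sigma_finiteP[G [GT ndG Goo]] := sigma_finiteT m.
pose g := fun x : n.+1.-tuple (measurableTypeR R) => (thead x, [tuple of behead x]).
have mg : measurable_fun setT g.
  by apply: measurable_fun_pair; [exact: measurable_tnth|exact: measurable_behead].
exists (fun k => g @^-1` (F k `*` G k)).
  apply/esym/seteqP; split=> // x _.
  have [i _ Fi] : (\bigcup_i F i) (g x).1 by rewrite -FT.
  have [j _ Gj] : (\bigcup_i G i) (g x).2 by rewrite -GT.
  exists (maxn i j) => //; split.
    by move: Fi; exact/subsetPset/ndF/leq_maxl.
  by move: Gj; exact/subsetPset/ndG/leq_maxr.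
move=> k; have [mF Fk] := Foo k; have [mG Gk] := Goo k; split.
  by rewrite -[X in measurable X]setTI; apply: mg => //; exact: measurableX.
rewrite /cons_measure /pushforward -comp_preimage.
rewrite (_ : g \o _ = idfun).
  by rewrite preimage_id product_measure1E// lte_mul_pinfty// ge0_fin_numE.
by apply/funext => -[a b]; rewrite /g/= theadE; congr pair; exact/val_inj.
Qed.

HB.instance Definition _ := Measure_isSigmaFinite.Build _ _ _ (cons_measure m)
  cons_measure_sigma_finite.

End cons_measure.

Fixpoint lebesgue_tuple (R : realType) (n : nat) :
    {sigma_finite_measure set (n.-tuple (measurableTypeR R)) -> \bar R} :=
  match n with
  | 0 => \d_([tuple] : 0.-tuple (measurableTypeR R))
  | m.+1 => cons_measure (lebesgue_tuple R m)
  end.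

Definition rV_of_tuple (R : realType) (n : nat)
    (y : n.-tuple (measurableTypeR R)) : 'rV[R]_n :=
  \row_i (tnth y i : R).

Definition integral_Rn (R : realType) (n : nat) (f : 'rV[R]_n -> R) : R :=
  \int[lebesgue_tuple R n]_y f (rV_of_tuple y).

(* The directions of space-time R x R^n: None is time, Some j is x_j. *)
Definition dir (R : realType) (n : nat) (o : option 'I_n) :
    (R * 'rV[R]_n)%type :=
  match o with
  | None => (1, 0)
  | Some j => (0, delta_mx 0 j)
  end.

Definition pd (R : realType) (n : nat) (W : normedModType R) (o : option 'I_n)
    (f : R * 'rV[R]_n -> W) : R * 'rV[R]_n -> W :=
  'D_(dir R o) f.

Definition iterD (R : realType) (V : normedModType R) (s : seq V) (f : V -> R) :
    V -> R :=
  foldr (fun (u : V) (g : V -> R) => 'D_u g : V -> R) f s.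

Definition smooth (R : realType) (V : normedModType R) (f : V -> R) : Prop :=
  forall s : seq V,
    continuous (iterD s f) /\ forall z u, derivable (iterD s f) z u.

Definition schwartz (R : realType) (n : nat) (f : 'rV[R]_n -> R) : Prop :=
  smooth f /\
  forall (N : nat) (s : seq 'rV[R]_n),
    exists M : R, forall x, enorm x ^+ N * `|iterD s f x| <= M.

(* The integral of f(h) exp(-i h.xi), f being real-valued. *)
Definition fourier (R : realType) (n : nat) (f : 'rV[R]_n -> R)
    (xi : 'rV[R]_n) : R[i] :=
  Complex (integral_Rn (fun h => f h * cos (dotp h xi)))
          (- integral_Rn (fun h => f h * sin (dotp h xi))).

Definition LP_cutoff (R : realType) (n : nat) (eta : 'rV[R]_n -> R) : Prop :=
  [/\ schwartz eta,
      forall x y, enorm x = enorm y -> eta x = eta y,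
      forall xi, 1 < enorm xi -> fourier eta xi = 0
    & forall xi, enorm xi <= 2^-1 -> fourier eta xi = 1].

Definition eta_le (R : realType) (n : nat) (eta : 'rV[R]_n -> R) (k : int)
    (h : 'rV[R]_n) : R :=
  (2 : R) ^ (n%:Z * k) * eta ((2 : R) ^ k *: h).

Definition LP_le (R : realType) (n : nat) (eta : 'rV[R]_n -> R) (k : int)
    (v : R * 'rV[R]_n -> 'rV[R]_n) (z : R * 'rV[R]_n) : 'rV[R]_n :=
  \row_i integral_Rn (fun h => v (z.1, z.2 + h) 0 i * eta_le eta k h).

Definition LP (R : realType) (n : nat) (eta : 'rV[R]_n -> R) (k : int)
    (v : R * 'rV[R]_n -> 'rV[R]_n) (z : R * 'rV[R]_n) : 'rV[R]_n :=
  LP_le eta k v z - LP_le eta (k - 1) v z.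

(* The torus is R^n / (Z^n A), the rows of the invertible matrix A being a basis
   of the lattice; functions on it are periodic functions on R^n. *)
Definition lattice (R : realType) (n : nat) (A : 'M[R]_n) : set 'rV[R]_n :=
  [set map_mx intr m *m A | m in [set: 'rV[int]_n]].

Definition fundamental_domain (R : realType) (n : nat) (A : 'M[R]_n) :
    set 'rV[R]_n :=
  [set y *m A | y in [set y : 'rV[R]_n | forall i, 0 <= y 0 i < 1]].

Definition periodic_on (R : realType) (n : nat) (A : 'M[R]_n) (T : Type)
    (I : set R) (f : R * 'rV[R]_n -> T) : Prop :=
  forall t x g, I t -> lattice A g -> f (t, x + g) = f (t, x).

Definition integral_ItimesT (R : realType) (n : nat) (A : 'M[R]_n) (I : set R)
    (F : R * 'rV[R]_n -> R) : R :=
  \int[product_measure1 (@lebesgue_measure R) (lebesgue_tuple R n)]_(z in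
      [set z | I z.1 /\ fundamental_domain A (rV_of_tuple z.2)])
    F (z.1, rV_of_tuple z.2).

(* Test functions on I x T^n are extended by zero to all times; K bounds the time
   support (T^n being compact, only the support in time is constrained). *)
Definition test_fun_in (R : realType) (n : nat) (A : 'M[R]_n) (K : set R)
    (phi : R * 'rV[R]_n -> R) : Prop :=
  [/\ smooth phi, periodic_on A setT phi
    & forall t x, ~ K t -> phi (t, x) = 0].

Definition test_fun (R : realType) (n : nat) (A : 'M[R]_n) (I : set R)
    (phi : R * 'rV[R]_n -> R) : Prop :=
  exists K : set R, [/\ compact K, K `<=` I & test_fun_in A K phi].

(* Continuity of p is stated as a bound by a C^N norm on each compact set. *)
Definition distribution_on (R : realType) (n : nat) (A : 'M[R]_n) (I : set R)
    (p : (R * 'rV[R]_n -> R) -> R) : Prop :=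
  (forall (a : R) phi psi, test_fun A I phi -> test_fun A I psi ->
     p (fun z => a * phi z + psi z) = a * p phi + p psi) /\
  (forall K : set R, compact K -> K `<=` I ->
     exists (C : R) (N : nat), forall phi, test_fun_in A K phi ->
       forall M : R,
         (forall (s : seq (option 'I_n)) z, (size s <= N)%N ->
            `|iterD [seq dir R o | o <- s] phi z| <= M) ->
         `|p phi| <= C * M).

Definition euler_weak (R : realType) (n : nat) (A : 'M[R]_n) (I : set R)
    (v : R * 'rV[R]_n -> 'rV[R]_n) (p : (R * 'rV[R]_n -> R) -> R) : Prop :=
  (forall (i : 'I_n) phi, test_fun A I phi ->
     - integral_ItimesT A I (fun z => v z 0 i * pd None phi z)
     - integral_ItimesT A I
         (fun z => \sum_(j < n) v z 0 i * v z 0 j * pd (Some j) phi z)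
     - p (pd (Some i) phi) = 0) /\
  (forall phi, test_fun A I phi ->
     - integral_ItimesT A I
         (fun z => \sum_(j < n) v z 0 j * pd (Some j) phi z) = 0).

Definition Linfty_Calpha (R : realType) (n : nat) (I : set R) (alpha : R)
    (v : R * 'rV[R]_n -> 'rV[R]_n) : Prop :=
  exists M : R, {ae @lebesgue_measure R, forall t, I t ->
    (forall x, enorm (v (t, x)) <= M) /\
    (forall x h, enorm (v (t, x + h) - v (t, x)) <= M * enorm h `^ alpha)}.

Definition C0_norm (R : realType) (n : nat) (I : set R)
    (w : R * 'rV[R]_n -> 'rV[R]_n) : \bar R :=
  ereal_sup [set (enorm (w z))%:E | z in [set z | I z.1]].

Definition holder_seminorm (R : realType) (n : nat) (I : set R) (alpha : R)
    (v : R * 'rV[R]_n -> 'rV[R]_n) : \bar R :=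
  ereal_sup [set r | exists t x h, [/\ I t, h != 0 &
    r = (enorm (v (t, x + h) - v (t, x)) / enorm h `^ alpha)%:E]].

(* (d_t + v . grad) w *)
Definition advect (R : realType) (n : nat) (v w : R * 'rV[R]_n -> 'rV[R]_n)
    (z : R * 'rV[R]_n) : 'rV[R]_n :=
  pd None w z + \sum_(j < n) v z 0 j *: pd (Some j) w z.

(* Main.v *)
(** The kernel of P_k is a dilation of psi(x) = eta(x) - 2^-n eta(x/2).
    Since eta is radial, psi is the divergence of G(x) = x g(x) with
    g(x) = int_(1/2)^1 s^(n-1) eta(s x) ds, and the Jacobian matrix of G is symmetric.
    Hence the matrix K_lm = delta_lm psi - d_m G_l has divergence-free rows, and div v = 0
    gives P_k v_l(x) = sum_m int v_m(y) K_lm(y - x) dy. Tested against rows of K the Euler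
    equation loses its pressure, so the time derivative of P_k v_l at (t, x) is
    sum_mj int v_m(y) v_j(y) d_j K_lm(y - x) dy, and div v = 0 again turns the advective derivative
    into the commutator form
      sum_mj int (v_m(x + h) - v_m(x)) (v_j(x + h) - v_j(x)) d_j K_lm(h) dh.
    The Hoelder bound on the two increments and scaling give 2^((1-2alpha)k).
    Schwartz functions are turned into test functions on the torus by summing over the
    lattice, and the distributional time derivative is classical because both sides of the
    equation are continuous in time. *)

(* The pressure is only a distribution and no bound on it is at hand, so it has to disappear before
   anything is estimated; only divergence-free test fields achieve that. This forces the correction
   of [psi e_l] by the gradient of [G_l], which makes K the kernel of P_k composed with the Leray
   projection. The usual inverse Laplacian is replaced by an explicit average of [eta] over the
   scales in [1/2, 1]; these stay away from 0, so the average is again Schwartz.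

   The exponent reflects a balance: the single derivative on K costs 2^k, the two increments gain
   2^(-2 alpha k). After rescaling, the constant is a sum of L^1 norms of (1 + |y|^2) d_j K_lm at
   scale 1. The weight dominates |y|^(2 alpha) for every alpha in ]0, 1[, so neither alpha nor the
   lattice enters.

   No derivative of P_k v is given in advance, hence derivability is proved along with the bound.
   Smoothness being expressed by iterated directional derivatives, multivariable calculus is carried
   out along lines, with one-variable theorems. *)
From HB Require Import structures.
Require Import Defs.
From mathcomp Require Import all_boot all_order all_algebra complex.
From mathcomp Require Import all_classical all_reals all_analysis.
From mathcomp Require Import measurable_realfun.
From mathcomp Require Import ring lra.
Import Order.TTheory GRing.Theory Num.Theory.
Import numFieldNormedType.Exports.
Local Open Scope classical_set_scope.
Local Open Scope ring_scope.
Set Implicit Arguments.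
Unset Strict Implicit.
Unset Printing Implicit Defensive.

(** * Lebesgue measure on tuples *)

Section lebesgue_affine.
Variable R : realType.
Implicit Types c a : R.

Definition affR c a (x : measurableTypeR R) : measurableTypeR R := c * x + a.

Lemma measurable_affR c a : measurable_fun setT (affR c a).
Proof. by apply: measurable_funD => //; exact: measurable_funM. Qed.

(** Lebesgue measure is the only measure giving each interval ]u, v] its length. The preimage of ]u,
    v] has length [(v - u) / c], and the factor [c] restores it. *)
Lemma lebesgue_affR c a (A : set (measurableTypeR R)) : 0 < c -> measurable A ->
  (c%:E * pushforward (@lebesgue_measure R) (affR c a) A = lebesgue_measure A)%E.
Proof.
move=> c0 mA.
have maff := measurable_affR c a.
pose m0 : {measure set (measurableTypeR R) -> \bar R} :=
  measure_function_pushforward__canonical__measure_function_Measure lebesgue_measure maff.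
pose nc : {nonneg R} := NngNum (ltW c0).
rewrite [RHS](@lebesgue_measure_unique R (mscale nc m0))//.
move=> X /ocitvP [->|[[u v] /= uv ->]]; first by rewrite !measure0.
rewrite [RHS]/= /mscale /= /pushforward.
rewrite (_ : affR c a @^-1` _ = `](u - a) / c, (v - a) / c]%classic); last first.
  apply/seteqP; split => x /=; rewrite !in_itv/= /affR.
    by rewrite ltr_pdivrMr// ler_pdivlMr// ltrBlDr lerBrDr mulrC.
  by rewrite ltr_pdivrMr// ler_pdivlMr// ltrBlDr lerBrDr mulrC.
rewrite !lebesgue_measure_itv/= !lte_fin uv ltr_pM2r ?invr_gt0// ltrD2r uv.
rewrite -!EFinB -EFinM; congr EFin.
by field; rewrite gt_eqF.
Qed.

End lebesgue_affine.

Section lebesgue_tuple_theory.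
Variable R : realType.
Local Notation T n := (n.-tuple (measurableTypeR R)).
Local Notation leb1 := (@lebesgue_measure R).
Local Notation leb n := (lebesgue_tuple R n).

Lemma ge0_integral_affR (c a : R) (f : measurableTypeR R -> \bar R) : 0 < c ->
  measurable_fun setT f -> (forall x, 0 <= f x)%E ->
  (c%:E * \int[leb1]_x f (affR c a x) = \int[leb1]_x f x)%E.
Proof.
move=> c0 mf f0.
have maff := measurable_affR c a.
pose m0 : {measure set (measurableTypeR R) -> \bar R} :=
  measure_function_pushforward__canonical__measure_function_Measure leb1 maff.
have -> : (\int[leb1]_x f (affR c a x) = \int[m0]_x f x)%E.
  by rewrite ge0_integral_pushforward.
pose nc : {nonneg R} := NngNum (ltW c0).
rewrite -(ge0_integral_mscale m0 measurableT nc mf)//.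
by apply: eq_measure_integral => A mA _; exact: lebesgue_affR.
Qed.

(** Tonelli for the recursively defined product measure; through it, integrals over R^n are reduced
    to dimension one by induction on [n]. *)
Lemma ge0_integral_tupleS n (f : T n.+1 -> \bar R) :
  measurable_fun setT f -> (forall x, 0 <= f x)%E ->
  (\int[leb n.+1]_y f y = \int[leb1]_x \int[leb n]_y f (tcons (x, y)))%E.
Proof.
move=> mf f0.
have mt := @measurable_tcons R n.
have -> : (\int[leb n.+1]_y f y =
   \int[product_measure1 leb1 (leb n)]_z (f \o @tcons R n) z)%E.
  exact: (@ge0_integral_pushforward _ _ _ _ _ _ mt
    (product_measure1 leb1 (leb n)) setT f measurableT mf (fun y _ => f0 y)).
rewrite fubini_tonelli1//; last by move=> z; exact: f0.
exact: measurableT_comp mf mt.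
Qed.

Definition aff_tuple n (c : R) (a : 'I_n -> R) (y : T n) : T n :=
  [tuple affR c (a i) (tnth y i) | i < n].

Lemma measurable_aff_tuple n c (a : 'I_n -> R) : measurable_fun setT (aff_tuple c a).
Proof.
apply/measurable_fun_tnthP => i.
rewrite (_ : _ \o _ = affR c (a i) \o (fun y : T n => tnth y i)); last first.
  by apply/funext => y /=; rewrite tnth_mktuple.
exact: measurableT_comp (measurable_affR _ _) (measurable_tnth i).
Qed.

Lemma aff_tuple_tcons n c (a : 'I_n.+1 -> R) (x : measurableTypeR R) (y : T n) :
  aff_tuple c a (tcons (x, y)) =
  tcons (affR c (a ord0) x, aff_tuple c (fun i => a (lift ord0 i)) y).
Proof.
apply: eq_from_tnth => i; rewrite tnth_mktuple.
have [->|] := eqVneq i ord0; first by rewrite !(tnth_nth 0).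
rewrite -[i != _]/(i \in predC1 ord0) => i0.
have [j ->] : exists j, i = lift ord0 j.
  by case: (unliftP ord0 i) i0 => [j -> _|->]; [exists j|rewrite inE eqxx].
rewrite /tcons /=.
by rewrite !tnthS tnth_mktuple.
Qed.

Lemma ge0_integral_aff n c (a : 'I_n -> R) (f : T n -> \bar R) : 0 < c ->
  measurable_fun setT f -> (forall x, 0 <= f x)%E ->
  ((c ^+ n)%:E * \int[leb n]_y f (aff_tuple c a y) = \int[leb n]_y f y)%E.
Proof.
move=> c0; elim: n => [|n IH] in a f * => mf f0.
  rewrite expr0 mul1e; apply: eq_integral => y _; congr f.
  by apply: eq_from_tnth => -[].
rewrite ge0_integral_tupleS; last by [].
  rewrite ge0_integral_tupleS//.
  have mg : measurable_fun setT (fun z => f (tcons z)).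
    exact: measurableT_comp mf (@measurable_tcons R n).
  rewrite -[RHS](ge0_integral_affR (a ord0) c0); last 2 first.
  - exact: (@measurable_fun_fubini_tonelli_F _ _ _ _ _ (leb n) _ mg (fun z => f0 _)).
  - by move=> x; exact: integral_ge0.
  rewrite exprS EFinM -muleA; congr *%E.
  rewrite -ge0_integralZl//.
  - apply: eq_integral => x _.
    under eq_integral do rewrite aff_tuple_tcons.
    rewrite (IH (fun i => a (lift ord0 i)) (fun y => f (tcons (affR c (a ord0) x, y))))//.
    by apply: measurableT_comp mg _; exact: measurable_pair1.
  - have mg' : measurable_fun setT (fun z => f (aff_tuple c a (tcons z))).
      apply: measurableT_comp mf _.
      exact: measurableT_comp (measurable_aff_tuple _ _) (@measurable_tcons R n).
    have H := @measurable_fun_fubini_tonelli_F _ _ _ _ _ (leb n) _ mg' (fun z => f0 _).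
    exact: H.
  - by move=> x _; exact: integral_ge0.
  - by rewrite lee_fin exprn_ge0 // ltW.
exact: measurableT_comp mf (measurable_aff_tuple _ _).
Qed.

End lebesgue_tuple_theory.

(** * Borel measurability on tuples *)

Section borel.
Variable R : realType.
Local Notation T n := (n.-tuple (measurableTypeR R)).

(** Measures live on tuples, the topology on row vectors; composing with this map turns continuity
    into measurability. *)
Definition spacetime_rV n (z : measurableTypeR R * T n) : R * 'rV[R]_n :=
  (z.1 : R, rV_of_tuple z.2).

Lemma measurable_coord n (i : 'I_n) :
  measurable_fun setT (fun y : T n => (rV_of_tuple y : 'rV[R]_n) 0 i).
Proof.
rewrite (_ : (fun _ => _) = (fun y : T n => tnth y i)); first exact: measurable_tnth.
by apply/funext => y; rewrite mxE.
Qed.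

(** An open set is the countable union of the boxes it contains that have rational centres and radii
    [1 / (k + 1)], and boxes are measurable product sets. Balls of the sup norm are themselves
    boxes. *)
Lemma measurable_preimage_open n (U : set (R * 'rV[R]_n)) : open U ->
  measurable (@spacetime_rV n @^-1` U).
Proof.
move=> oU.
pose box (j : rat * {ffun 'I_n -> rat} * nat) : set (measurableTypeR R * T n) :=
  [set z | `|z.1 - ratr j.1.1| < j.2.+1%:R^-1] `&`
  \bigcap_(i in [set: 'I_n])
    [set z | `|tnth z.2 i - ratr (j.1.2 i)| < j.2.+1%:R^-1].
have mbox j : measurable (box j).
  apply: measurableI.
    rewrite -[X in measurable X]setTI -preimage_true.
    apply: measurable_fun_ltr => //.
    by apply: measurableT_comp => //; apply: measurable_funB.
  apply: fin_bigcap_measurable => // i _.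
  rewrite -[X in measurable X]setTI -preimage_true.
  apply: measurable_fun_ltr => //.
  apply: measurableT_comp => //; apply: measurable_funB => //.
  exact: measurableT_comp (measurable_tnth i) _.
pose F j := if `[< box j `<=` @spacetime_rV n @^-1` U >] then box j else set0.
rewrite (_ : _ @^-1` U = \bigcup_j F j).
  apply: countable_bigcupT_measurable => [|j]; first exact: countableP.
  by rewrite /F; case: ifP.
apply/seteqP; split => [z Uz|z [j _]]; last first.
  by rewrite /F; case: asboolP => // sub; exact: sub.
have /nbhs_ballP[e /= e0 eU] : nbhs (spacetime_rV z) U by apply: open_nbhs_nbhs; split.
(* Two points of one box differ by less than [2 / (k + 1)] in each coordinate. *)
have [k ke] : exists k : nat, 2 * k.+1%:R^-1 < e.
  exists (Num.truncn (2 / e)); rewrite -ltr_pdivlMl// invf_plt ?posrE ?divr_gt0//; last first.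
    by rewrite mulr_gt0// invr_gt0.
  by rewrite invfM invrK mulrC truncnS_gt.
have k0 : 0 < k.+1%:R^-1 :> R by [].
have appr (x : R) : exists q : rat, `|x - ratr q| < k.+1%:R^-1.
  move: k0; move: (_^-1) => d d0.
  have /rat_in_itvoo[q] : x - d < x + d by lra.
  by rewrite in_itv/= => /andP[h1 h2]; exists q; rewrite ltr_distlC; apply/andP; split; lra.
have [q0 hq0] := appr z.1.
have /choice[q hq] := fun i : 'I_n => appr (tnth z.2 i).
pose j := (q0, [ffun i => q i], k).
have zj : box j z.
  by split => //= i _ /=; rewrite ffunE; exact: hq.
exists j => //; rewrite /F; case: asboolP => // -[] w [/= w1 w2].
have tri (a b c : R) : `|a - c| < k.+1%:R^-1 -> `|b - c| < k.+1%:R^-1 -> `|a - b| < e.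
  move: ke; move: (_^-1) => d ke ac bc; apply: le_lt_trans ke.
  rewrite (_ : a - b = (a - c) - (b - c)); last by ring.
  by rewrite (le_trans (ler_normB _ _))//; lra.
apply: eU; split => /=.
  exact: tri hq0 w1.
split => // i l; rewrite ord1 !mxE.
apply: tri (hq l) _.
by have := w2 l I; rewrite /= ffunE.
Qed.

(** The velocity is continuous only at times in [I], hence an open [D] in place of the whole space.
    Inside [D] the preimage of an open ray is open. *)
Lemma measurable_fun_within n (D : set (R * 'rV[R]_n)) (f : R * 'rV[R]_n -> R) :
  open D -> (forall z, D z -> {for z, continuous f}) ->
  measurable_fun (@spacetime_rV n @^-1` D) (f \o @spacetime_rV n).
Proof.
move=> oD cf mD; apply: (measurability _ (RGenOInfty.measurableE R)) => //.
move=> _ [_ [r ->] <-].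
rewrite (_ : _ `&` _ = @spacetime_rV n @^-1` (D `&` [set z | r < f z])); last first.
  by apply/seteqP; split => z /=; rewrite in_itv/= andbT.
apply: measurable_preimage_open; rewrite openE => z [Dz rz].
apply: filterI; first by move: oD; rewrite openE; exact.
have := cf z Dz; rewrite /prop_for/continuous_at => /(@cvgr_gt _ _ _ _ _ _)/(_ _ rz).
exact.
Qed.

Lemma measurable_fun_rV n (f : 'rV[R]_n -> R) :
  continuous f -> measurable_fun setT (fun y : T n => f (rV_of_tuple y)).
Proof.
move=> cf.
have := @measurable_fun_within n setT (fun z => f z.2) openT.
have cfz (z : R * 'rV[R]_n) : [set: R * 'rV[R]_n] z ->
    {for z, continuous (fun z => f z.2)}.
  by move=> _; apply: continuous_comp; [exact: cvg_snd|exact: cf].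
move=> /(_ cfz) mf.
have := measurableT_comp mf (@measurable_pair1 _ _ _ (T n) (0 : measurableTypeR R)).
exact.
Qed.

End borel.

(** * Integration over R^n *)

Section Rn.
Variable R : realType.
Local Notation T n := (n.-tuple (measurableTypeR R)).
Local Notation leb1 := (@lebesgue_measure R).
Local Notation leb n := (lebesgue_tuple R n).

Definition measR n (f : 'rV[R]_n -> R) : Prop :=
  measurable_fun setT (fun y : T n => f (rV_of_tuple y)).

Definition intR n (f : 'rV[R]_n -> R) : Prop :=
  (leb n).-integrable setT (fun y => (f (rV_of_tuple y))%:E).

Lemma rV_aff n (c : R) (a : 'rV[R]_n) (y : T n) :
  rV_of_tuple (aff_tuple c (fun i => a 0 i) y) = c *: rV_of_tuple y + a.
Proof. by apply/rowP => i; rewrite !mxE tnth_mktuple. Qed.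

Lemma measR_aff n (f : 'rV[R]_n -> R) c a : measR f -> measR (fun x => f (c *: x + a)).
Proof.
move=> mf; rewrite /measR.
under eq_fun do rewrite -rV_aff.
exact: measurableT_comp mf (measurable_aff_tuple _ _).
Qed.

Lemma ge0_integral_rV_aff n (f : 'rV[R]_n -> R) c a : 0 < c -> measR f ->
  (forall x, 0 <= f x) ->
  ((c ^+ n)%:E * \int[leb n]_y (f (c *: rV_of_tuple y + a))%:E =
   \int[leb n]_y (f (rV_of_tuple y))%:E)%E.
Proof.
move=> c0 mf f0.
rewrite -[RHS](@ge0_integral_aff R n c (fun i => a 0 i))//.
- by congr *%E; apply: eq_integral => y _; rewrite rV_aff.
- exact/measurable_EFinP.
- by move=> y; rewrite lee_fin.
Qed.

Lemma integral_shift n (f : 'rV[R]_n -> R) a : measR f ->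
  (\int[leb n]_y (f (rV_of_tuple y + a))%:E = \int[leb n]_y (f (rV_of_tuple y))%:E)%E.
Proof.
move=> mf.
have shift0 (g : 'rV[R]_n -> R) : measR g -> (forall x, 0 <= g x) ->
    (\int[leb n]_y (g (rV_of_tuple y + a))%:E =
     \int[leb n]_y (g (rV_of_tuple y))%:E)%E.
  move=> mg g0; rewrite -[RHS](@ge0_integral_rV_aff n g 1 a)// expr1n mul1e.
  by apply: eq_integral => y _; rewrite scale1r.
rewrite integralE [RHS]integralE; congr (_ - _)%E.
- apply: etrans (etrans _ (shift0 (fun x => Num.max (f x) 0) (measurable_funrpos mf) _)) _.
  + by apply: eq_integral => y _; rewrite EFin_max funepos.unlock.
  + by move=> x; rewrite le_max lexx orbT.
  + by apply: eq_integral => y _; rewrite EFin_max funepos.unlock.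
- apply: etrans (etrans _ (shift0 (fun x => Num.max (- f x) 0) (measurable_funrneg mf) _)) _.
  + by apply: eq_integral => y _; rewrite EFin_max EFinN funeneg.unlock.
  + by move=> x; rewrite le_max lexx orbT.
  + by apply: eq_integral => y _; rewrite EFin_max EFinN funeneg.unlock.
Qed.

Lemma integral_Rn_shift n (f : 'rV[R]_n -> R) a : measR f ->
  integral_Rn (fun x => f (x + a)) = integral_Rn f.
Proof. by move=> mf; rewrite /integral_Rn /Rintegral integral_shift. Qed.

Lemma intR_shift n (f : 'rV[R]_n -> R) a : intR f -> intR (fun x => f (x + a)).
Proof.
move=> /integrableP[/measurable_EFinP mf fi]; apply/integrableP; split.
  apply/measurable_EFinP; have := measR_aff 1 a mf.
  by rewrite /measR; under eq_fun do rewrite scale1r.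
rewrite (le_lt_trans _ fi)//.
by rewrite (@integral_shift n (fun x => `|f x|))//; exact: measurableT_comp.
Qed.

Lemma integral_Rn_scale n (f : 'rV[R]_n -> R) c : 0 < c -> measR f ->
  (forall x, 0 <= f x) ->
  c ^+ n * integral_Rn (fun x => f (c *: x)) = integral_Rn f.
Proof.
move=> c0 mf f0; rewrite /integral_Rn /Rintegral.
rewrite -[in RHS](@ge0_integral_rV_aff n f c 0 c0 mf f0).
under [in RHS]eq_integral do rewrite addr0.
have cn0 : 0 < c ^+ n by exact: exprn_gt0.
set J := (\int[_]_ _ _)%E.
have J0 : (0 <= J)%E by apply: integral_ge0 => y _; rewrite lee_fin.
(* If [J] is infinite, so is its product with [c ^+ n], and [fine] sends both to 0. *)
case: J J0 => [r _| |//] //=.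
by rewrite mulr0 gt0_muley.
Qed.

Lemma ge0_integral_tuple_prod n (f : 'I_n -> R -> R) (r : 'I_n -> R) :
  (forall i, measurable_fun setT (f i : measurableTypeR R -> R)) ->
  (forall i x, 0 <= f i x) ->
  (forall i, \int[leb1]_x (f i x)%:E = (r i)%:E)%E ->
  (\int[leb n]_y (\prod_(i < n) f i (rV_of_tuple y 0 i))%:E = (\prod_(i < n) r i)%:E)%E.
Proof.
elim: n => [|n IH] in f r * => mf f0 fr.
  under eq_integral do rewrite big_ord0.
  by rewrite big_ord0 integral_cst//= /dirac indicE mem_set// mule1.
have mp m (g : 'I_m -> R -> R) :
    (forall i, measurable_fun setT (g i : measurableTypeR R -> R)) ->
    measurable_fun setT (fun y : T m => (\prod_(i < m) g i (rV_of_tuple y 0 i))%:E).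
  move=> mg; apply/measurable_EFinP; apply: measurable_prod => i _.
  exact: measurableT_comp (mg i) (measurable_coord _).
rewrite ge0_integral_tupleS; last 2 first.
- exact: (mp n.+1 f mf).
- by move=> y; rewrite lee_fin prodr_ge0.
have -> : (\int[leb1]_x \int[leb n]_y
    (\prod_(i < n.+1) f i (rV_of_tuple (tcons (x, y)) 0 i))%:E =
  \int[leb1]_x ((f ord0 x)%:E * (\prod_(i < n) r (lift ord0 i))%:E))%E.
  apply: eq_integral => x _.
  rewrite -(IH (fun i => f (lift ord0 i)))//.
  rewrite -ge0_integralZl//; last 3 first.
  - exact: (mp n (fun i => f (lift ord0 i)) (fun i => mf _)).
  - by move=> y _; rewrite lee_fin prodr_ge0.
  - by rewrite lee_fin.
  apply: eq_integral => y _; rewrite big_ord_recl EFinM.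
  congr (_%:E * _%:E)%E; first by rewrite mxE.
  by apply: eq_bigr => i _; rewrite !mxE tnthS.
rewrite ge0_integralZr//.
- by rewrite fr big_ord_recl EFinM.
- exact/measurable_EFinP.
- by move=> x _; rewrite lee_fin.
- by rewrite lee_fin prodr_ge0// => i _; rewrite -lee_fin -fr integral_ge0// => x _; rewrite lee_fin.
Qed.

(** Multiples of its inverse serve as dominating functions on R^n. Unlike a radial weight it factors
    over the coordinates, so its inverse has integral [pi ^+ n] by Tonelli. *)
Definition weight n (x : 'rV[R]_n) : R := \prod_(i < n) (1 + x 0 i ^+ 2).

Lemma weight_gt0 n (x : 'rV[R]_n) : 0 < weight x.
Proof. by apply: prodr_gt0 => i _; rewrite ltr_pwDl// sqr_ge0. Qed.

Lemma continuous_weightV n : continuous (fun x : 'rV[R]_n => (weight x)^-1).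
Proof.
have cs (s : seq 'I_n) : continuous (fun x : 'rV[R]_n => \prod_(i <- s) (1 + x 0 i ^+ 2)).
  elim: s => [|i s IH].
    rewrite (_ : (fun _ => _) = cst 1); first exact: cst_continuous.
    by apply/funext => x; rewrite big_nil.
  rewrite (_ : (fun _ => _) = (cst 1 + (fun x : 'rV[R]_n => x 0 i) *
      (fun x : 'rV[R]_n => x 0 i)) * (fun x => \prod_(i <- s) (1 + x 0 i ^+ 2))); last first.
    by apply/funext => x; rewrite big_cons expr2.
  move=> x; apply: continuousM; last exact: IH.
  apply: continuousD; first exact: cst_continuous.
  by apply: continuousM; exact: coord_continuous.
move=> x; apply: (@continuousV _ _ (@weight n)); last exact: cs.
by rewrite gt_eqF ?weight_gt0.
Qed.

Lemma intR_weightV n : @intR n (fun x => (weight x)^-1).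
Proof.
apply/integrableP; split.
  by apply/measurable_EFinP; apply: (@measurable_fun_rV R n) (@continuous_weightV n).
have -> : (\int[leb n]_x `|((weight (rV_of_tuple x))^-1)%:E| = (\prod_(i < n) pi)%:E)%E.
  rewrite -(@ge0_integral_tuple_prod n (fun _ x => (oneDsqr x)^-1) (fun=> pi)).
  - apply: eq_integral => y _; rewrite /= ger0_norm ?invr_ge0 ?(ltW (weight_gt0 _))//.
    by rewrite /weight prodfV.
  - by move=> i; apply: continuous_measurable_fun; exact: continuous_oneDsqrV.
  - by move=> i x; rewrite invr_ge0 (le_trans ler01)// oneDsqr_ge1.
  - move=> _; rewrite ge0_symfun_integralT.
    + rewrite -set_itvcy integral0y_oneDsqr -EFinM.
      by congr EFin; field.
    + by move=> x; rewrite invr_ge0 (le_trans ler01)// oneDsqr_ge1.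
    + exact: continuous_oneDsqrV.
    + by move=> x /=; rewrite /oneDsqr sqrrN.
exact: ltry.
Qed.

Lemma intR_le_weight n (f : 'rV[R]_n -> R) (C : R) : measR f ->
  (forall x, `|f x| <= C / weight x) -> intR f.
Proof.
move=> mf fC; have iC := integrableZl measurableT C (intR_weightV n).
apply: (@le_integrable _ _ _ _ _ measurableT _ _ _ _ iC).
  exact/measurable_EFinP.
move=> y _; rewrite /= lee_fin (le_trans (fC _))//.
exact: ler_norm.
Qed.

(** The [y] with a prescribed integer part fill a unit cube. This is what makes an integral over [y]
    of a function of the integer part a sum over Z^n. *)
Lemma integral_cell n (z : 'rV[R]_n) :
  (\int[leb n]_y (\prod_(i < n) (Num.floor (rV_of_tuple y 0 i) == Num.floor (z 0 i))%:R)%:E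
    = 1%:E :> \bar R)%E.
Proof.
rewrite (@ge0_integral_tuple_prod n
  (fun i (x : R) => (Num.floor x == Num.floor (z 0 i))%:R) (fun=> 1))//.
- by rewrite big1.
- move=> i; set m := Num.floor _.
  rewrite (_ : (fun _ => _) = \1_(`[m%:~R, (m + 1)%:~R[%classic : set R)).
    exact: measurable_indic.
  apply/funext => x; rewrite indicE; congr (nat_of_bool _)%:R.
  by rewrite floor_eq; apply/idP/idP; rewrite inE/= in_itv.
- move=> i; set m := Num.floor _.
  transitivity (\int[leb1]_x (\1_(`[m%:~R, (m + 1)%:~R[%classic : set (measurableTypeR R)) x)%:E)%E.
    apply: eq_integral => x _; rewrite indicE; congr ((nat_of_bool _)%:R)%:E.
    by rewrite floor_eq; apply/idP/idP; rewrite inE/= in_itv.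
  rewrite integral_indic// setIT; apply: (etrans (lebesgue_measure_itv _)).
  rewrite /= lte_fin ltr_int.
  by rewrite ltrDl ltr01 -EFinB intrD addrAC subrr add0r.
Qed.

End Rn.

(** * Directional derivatives, smooth and Schwartz functions *)

Section calculus.
Variable R : realType.
Implicit Types V W : normedModType R.

Lemma continuous_eps V (f : V -> R) x : {for x, continuous f} ->
  forall e, 0 < e -> exists2 d, 0 < d & forall y, `|y - x| < d -> `|f y - f x| < e.
Proof.
move=> cf e e0; have /cvgrPdist_lt/(_ e e0)/nbhs_ballP[d /= d0 dU] := cf.
exists d => // y yx; rewrite distrC; apply: dU.
by rewrite -ball_normE /= distrC.
Qed.

(** The two difference quotients coincide as functions of [h], so the chain rule follows with
    directional derivatives alone. *)
Lemma is_derive_affine V W (f : W -> R) (L : V -> W) (u : V) (w : W) z :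
  (forall h : R, L (h *: u + z) = h *: w + L z) -> derivable f (L z) w ->
  is_derive z u (fun y => f (L y)) ('D_w f (L z)).
Proof.
move=> Lh df.
have E : (fun h : R => h^-1 *: (((fun y => f (L y)) \o shift z) (h *: u) - f (L z))) =
    (fun h : R => h^-1 *: ((f \o shift (L z)) (h *: w) - f (L z))).
  by apply/funext => h /=; rewrite Lh.
by apply: DeriveDef; [rewrite /derivable E|rewrite /derive E].
Qed.

Lemma is_derive_line V (f : V -> R) x u (s : R) : derivable f (x + s *: u) u ->
  is_derive s 1 (fun r : R => f (x + r *: u)) ('D_u f (x + s *: u)).
Proof.
move=> df; apply: (@is_derive_affine R^o V f (fun r : R => x + r *: u) 1 u s) => // h.
by rewrite scalerDl [_%:A]mulr1 addrCA.
Qed.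

Lemma MVT_line V (f : V -> R) x u (h : R) : (forall z, derivable f z u) ->
  exists2 t : R, `|t| <= `|h| & f (x + h *: u) - f x = h * 'D_u f (x + t *: u).
Proof.
move=> df.
have dg (s : R) := @is_derive_line V f x u s (df _).
have cg (a b : R) : {within `[a, b], continuous (fun r : R => f (x + r *: u))}.
  by apply: derivable_within_continuous => r _; exact: ex_derive.
have [h0|h0] := leP 0 h.
  have [c] := MVT_segment h0 (fun s _ => dg s) (@cg 0 h).
  rewrite in_itv/= scale0r addr0 subr0 => /andP[c0 ch] ->.
  by exists c; rewrite ?ger0_norm// mulrC.
have [c] := MVT_segment (ltW h0) (fun s _ => dg s) (@cg h 0).
rewrite in_itv/= scale0r addr0 sub0r => /andP[hc c0] E.
exists c; first by rewrite !ler0_norm ?lerN2// ltW.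
by rewrite -opprB E mulrN opprK mulrC.
Qed.

Lemma derivable_cvg V (f : V -> R) x u : derivable f x u ->
  forall e, 0 < e -> exists2 d, 0 < d & forall h : R, h != 0 -> `|h| < d ->
    `|h^-1 * (f (x + h *: u) - f x) - 'D_u f x| < e.
Proof.
move=> df e e0.
have /cvgrPdist_lt/(_ e e0)/nbhs_ballP[d /= d0 dU] : (fun h : R => h^-1 *:
    ((f \o shift x) (h *: u) - f x)) @ 0^' --> 'D_u f x by exact: df.
exists d => // h h0 hd; rewrite distrC [x + _]addrC; apply: dU => //.
by rewrite -ball_normE /= sub0r normrN.
Qed.

Lemma eq_of_dist_lt (a b : R) : (forall e, 0 < e -> `|a - b| < e) -> a = b.
Proof.
move=> H; apply/eqP; rewrite -subr_eq0 -normr_le0 leNgt.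
by apply/negP => /H; rewrite ltxx.
Qed.

(** [smooth] speaks of one direction at a time, so additivity in the direction has to be proved. A
    step along [h (u + v)] is a step along [h u] followed by one along [h v]; the mean value theorem
    and the continuity of ['D_v f] handle the second. *)
Lemma derive_adddir V (f : V -> R) x u v : (forall z w, derivable f z w) ->
  continuous ('D_v f) -> 'D_(u + v) f x = 'D_u f x + 'D_v f x.
Proof.
move=> df cf; apply: eq_of_dist_lt => e e0.
have e30 : 0 < e / 3 by rewrite divr_gt0.
have [d1 d10 H1] := derivable_cvg (df x (u + v)) e30.
have [d2 d20 H2] := derivable_cvg (df x u) e30.
have [d3 d30 H3] := continuous_eps (cf x) e30.
(* Steps of length at most [h] along [u] and [v] stay within [h * k] of [x]; the summand 1 keeps [k]
   positive when both vectors vanish. *)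
pose k := `|u| + `|v| + 1.
have k0 : 0 < k by rewrite ltr_wpDl// addr_ge0.
pose h := Num.min (Num.min d1 d2) (d3 / k) / 2.
have m0 : 0 < Num.min (Num.min d1 d2) (d3 / k).
  by rewrite !lt_min d10 d20 divr_gt0.
have h0 : 0 < h by rewrite divr_gt0.
have : h < Num.min (Num.min d1 d2) (d3 / k) by rewrite /h; lra.
rewrite !lt_min ltr_pdivlMr// => /andP[/andP[hd1 hd2] hd3].
clearbody h.
have hn : `|h| = h by rewrite gtr0_norm.
have [t th E] := MVT_line (x + h *: u) h (df ^~ v).
have {}H1 := H1 h (lt0r_neq0 h0); rewrite hn in H1; have {}H1 := H1 hd1.
have {}H2 := H2 h (lt0r_neq0 h0); rewrite hn in H2; have {}H2 := H2 hd2.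
have {}H3 : `|'D_v f (x + h *: u + t *: v) - 'D_v f x| < e / 3.
  apply: H3; rewrite -[x + _ + _]addrA addrAC subrr add0r.
  apply: le_lt_trans hd3; rewrite (le_trans (ler_normD _ _))// !normrZ /k !mulrDr.
  rewrite hn in th *.
  by apply: ler_wpDr; rewrite ?mulr1 ?(ltW h0)// lerD// ler_wpM2r.
have -> : 'D_(u + v) f x - ('D_u f x + 'D_v f x) =
   - (h^-1 * (f (x + h *: (u + v)) - f x) - 'D_(u + v) f x) +
   (h^-1 * (f (x + h *: u) - f x) - 'D_u f x) +
   ('D_v f (x + h *: u + t *: v) - 'D_v f x).
  rewrite scalerDr (addrA x).
  have -> : f (x + h *: u + h *: v) = f (x + h *: u) + h * 'D_v f (x + h *: u + t *: v).
    by rewrite -E; ring.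
  by field; rewrite gt_eqF.
rewrite (le_lt_trans (ler_normD _ _))//.
move: H1 H2 H3; move: (_ - 'D_(u + v) f x) (_ - 'D_u f x) => a b aa bb cc.
by have := ler_normD (- a) b; rewrite normrN; lra.
Qed.

Lemma derive_scaledir V (f : V -> R) x u (c : R) : (forall z w, derivable f z w) ->
  'D_(c *: u) f x = c * 'D_u f x.
Proof.
move=> df; have [->|c0] := eqVneq c 0; first by rewrite scale0r derive0 mul0r.
apply: eq_of_dist_lt => e e0.
have e30 : 0 < e / 2 by rewrite divr_gt0.
have e40 : 0 < e / 2 / `|c| by rewrite divr_gt0 ?normr_gt0.
have [d1 d10 H1] := derivable_cvg (df x (c *: u)) e30.
have [d2 d20 H2] := derivable_cvg (df x u) e40.
pose h := Num.min d1 (d2 / `|c|) / 2.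
have m0 : 0 < Num.min d1 (d2 / `|c|) by rewrite !lt_min d10 divr_gt0 ?normr_gt0.
have h0 : 0 < h by rewrite divr_gt0.
have : h < Num.min d1 (d2 / `|c|) by rewrite /h; lra.
rewrite !lt_min ltr_pdivlMr ?normr_gt0// => /andP[hd1 hd2].
clearbody h.
have hn : `|h| = h by rewrite gtr0_norm.
have {}H1 := H1 h (lt0r_neq0 h0); rewrite hn in H1; have {}H1 := H1 hd1.
have hc0 : h * c != 0 by rewrite mulf_neq0// gt_eqF.
have {}H2 := H2 (h * c) hc0; rewrite normrM hn in H2; have {}H2 := H2 hd2.
move: H2; rewrite ltr_pdivlMr ?normr_gt0// -normrM => H2.
have -> : 'D_(c *: u) f x - c * 'D_u f x =
   - (h^-1 * (f (x + h *: (c *: u)) - f x) - 'D_(c *: u) f x) +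
   ((h * c)^-1 * (f (x + (h * c) *: u) - f x) - 'D_u f x) * c.
  by rewrite scalerA; field; rewrite c0 gt_eqF.
rewrite (le_lt_trans (ler_normD _ _))// normrN; lra.
Qed.

(** The second difference of [f] along [h u] and [h v] is symmetric in [u] and [v]. Two applications
    of the mean value theorem express it as [h * h] times either mixed derivative at a point close
    to [x]. *)
Lemma derive_comm V (f : V -> R) u v x :
  (forall z w, derivable f z w) ->
  (forall z w, derivable ('D_u f) z w) -> (forall z w, derivable ('D_v f) z w) ->
  continuous ('D_u ('D_v f)) -> continuous ('D_v ('D_u f)) ->
  'D_u ('D_v f) x = 'D_v ('D_u f) x.
Proof.
move=> df du dv cuv cvu; apply: eq_of_dist_lt => e e0.
have e20 : 0 < e / 2 by rewrite divr_gt0.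
have [d1 d10 H1] := continuous_eps (cuv x) e20.
have [d2 d20 H2] := continuous_eps (cvu x) e20.
pose k := `|u| + `|v| + 1.
have k0 : 0 < k by rewrite ltr_wpDl// addr_ge0.
pose h := Num.min d1 d2 / k / 2.
have m0 : 0 < Num.min d1 d2 by rewrite !lt_min d10 d20.
have h0 : 0 < h by rewrite !divr_gt0.
have : h < Num.min d1 d2 / k by rewrite /h ltr_pdivrMr// ltr_pMr ?divr_gt0// ltr1n.
rewrite ltr_pdivlMr// lt_min => /andP[hd1 hd2].
clearbody h.
have hn : `|h| = h by rewrite gtr0_norm.
have diff2 (a b : V) : (forall z w, derivable ('D_a f) z w) ->
    exists s t : R, [/\ `|s| <= h, `|t| <= h &
      f (x + h *: b + h *: a) - f (x + h *: b) - (f (x + h *: a) - f x) =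
      h * h * 'D_b ('D_a f) (x + s *: a + t *: b)].
  move=> da.
  pose g y := f (y + h *: b) - f y.
  have idg z : is_derive z a g ('D_a f (z + h *: b) - 'D_a f z).
    apply: is_deriveB; last exact/derivableP.
    apply: (@is_derive_affine V V f (fun y => y + h *: b) a a z) => // l.
    by rewrite addrA.
  have [s sh E] := MVT_line x h (fun z => @ex_derive _ _ _ _ _ _ _ (idg z)).
  have [t th E'] := MVT_line (x + s *: a) h (da ^~ b).
  rewrite hn in sh th; exists s, t; split => //.
  rewrite -mulrA -E' -(@derive_val _ _ _ _ _ _ _ (idg _)) -E /g.
  by rewrite (addrAC x); ring.
have [s1 [t1 [s1h t1h E1]]] := diff2 u v du.
have [s2 [t2 [s2h t2h E2]]] := diff2 v u dv.
have bd (a b : V) (s t : R) : `|s| <= h -> `|t| <= h -> `|a| + `|b| + 1 = k ->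
    `|x + s *: a + t *: b - x| <= h * k.
  move=> sh th <-; rewrite -[x + _ + _]addrA addrAC subrr add0r.
  rewrite (le_trans (ler_normD _ _))// !normrZ !mulrDr.
  by apply: ler_wpDr; rewrite ?mulr1 ?(ltW h0)// lerD// ler_wpM2r.
have {}H1 := H1 _ (le_lt_trans (bd v u s2 t2 s2h t2h _) hd1).
have {}H2 := H2 _ (le_lt_trans (bd u v s1 t1 s1h t1h _) hd2).
have E : 'D_u ('D_v f) (x + s2 *: v + t2 *: u) = 'D_v ('D_u f) (x + s1 *: u + t1 *: v).
  have hh : h * h != 0 by rewrite mulf_neq0// gt_eqF.
  apply: (mulfI hh).
  apply: etrans (esym E2) (etrans _ E1).
  by rewrite (addrAC x); ring.
have {}H1 : `|'D_u ('D_v f) (x + s2 *: v + t2 *: u) - 'D_u ('D_v f) x| < e / 2.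
  by apply: H1; rewrite /k (addrC `|v|).
have {}H2 := H2 erefl; rewrite -E in H2.
apply: le_lt_trans (ler_distD ('D_u ('D_v f) (x + s2 *: v + t2 *: u)) _ _) _.
rewrite [ltRHS]splitr; apply: ltrD; last exact: H2.
by rewrite distrC; exact: H1.
Qed.

End calculus.

Local Notation iterD := Defs.iterD.

Section smooth.
Variable R : realType.
Implicit Types V W : normedModType R.

Lemma iterD_rcons V (s : seq V) u (f : V -> R) :
  iterD (rcons s u) f = iterD s ('D_u f).
Proof. by rewrite /iterD -cats1 foldr_cat. Qed.

Lemma smooth_cont V (f : V -> R) : smooth f -> continuous f.
Proof. by move=> /(_ [::])[]. Qed.

Lemma smooth_derivable V (f : V -> R) z u : smooth f -> derivable f z u.
Proof. by move=> /(_ [::])[]. Qed.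

Lemma smooth_D V (f : V -> R) u : smooth f -> smooth ('D_u f).
Proof. by move=> sf s; rewrite -iterD_rcons; exact: sf. Qed.

(* An invariant containing f and stable under all directional derivatives replaces an
   induction on iterated derivatives. *)
Lemma smooth_coind V (P : (V -> R) -> Prop) :
  (forall f, P f -> [/\ continuous f, forall z u, derivable f z u
    & forall u, P ('D_u f)]) ->
  forall f, P f -> smooth f.
Proof.
move=> PP f Pf s; elim/last_ind: s f Pf => [|s u IH] f /PP[cf df PD].
  by split.
by rewrite iterD_rcons; exact: IH.
Qed.

(** Products alone are not stable under differentiation; by the Leibniz rule, finite sums of
    products are. *)
Inductive prods V : (V -> R) -> Prop :=
| Prods_mul f g : smooth f -> smooth g -> prods (f * g)
| Prods_add f g : prods f -> prods g -> prods (f + g).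

Lemma smooth_mul V (f g : V -> R) : smooth f -> smooth g ->
  smooth (fun z => f z * g z).
Proof.
move=> sf sg; apply: (@smooth_coind V (@prods V)); last exact: Prods_mul.
move=> k; elim => {sf sg}f {}g.
  move=> sf sg; split.
  - by move=> z; apply: continuousM; exact: smooth_cont.
  - by move=> z u; apply: derivableM; exact: smooth_derivable.
  - move=> u; rewrite (_ : 'D_u _ = f * 'D_u g + g * 'D_u f).
      apply: Prods_add; apply: Prods_mul; [exact: sf|exact: smooth_D|exact: sg|].
      exact: smooth_D.
    by apply/funext => z; rewrite deriveM//; exact: smooth_derivable.
move=> _ [cf df Df] _ [cg dg Dg]; split.
- by move=> z; apply: continuousD; [exact: cf|exact: cg].
- by move=> z u; apply: derivableD.
- move=> u; rewrite (_ : 'D_u _ = 'D_u f + 'D_u g); first exact: Prods_add.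
  by apply/funext => z; rewrite deriveD.
Qed.

Lemma smooth_affine V W (f : W -> R) (L : V -> W) (L0 : V -> W) :
  (forall (h : R) u z, L (h *: u + z) = h *: L0 u + L z) -> continuous L ->
  smooth f -> smooth (fun z => f (L z)).
Proof.
move=> LL cL sf.
pose P (k : V -> R) := exists2 g, smooth g & exists c : R, k = fun z => c * g (L z).
apply: (@smooth_coind V P); last first.
  by exists f => //; exists 1; apply/funext => z; rewrite mul1r.
move=> _ [g sg [c ->]].
have dg z u : is_derive z u (fun y => g (L y)) ('D_(L0 u) g (L z)).
  by apply: is_derive_affine => //; exact: smooth_derivable.
split.
- move=> z; apply: (@continuousM _ _ (fun=> c) (fun z => g (L z))); first exact: cst_continuous.
  by apply: continuous_comp; [exact: cL|exact: smooth_cont].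
- by move=> z u; apply: (@derivableM _ _ (cst c) (fun z => g (L z)));
    [exact: derivable_cst|exact: ex_derive].
- move=> u; exists ('D_(L0 u) g); first exact: smooth_D.
  exists c; apply/funext => z.
  have dgz : derivable (fun z => g (L z)) z u by exact: ex_derive.
  rewrite -[LHS]/('D_u (cst c * (fun z => g (L z))) z).
  rewrite (deriveM (derivable_cst _ _ _) dgz) derive_cst scaler0 addr0.
  by apply: (congr1 ( *%R c)); exact: (@derive_val _ _ _ _ _ _ _ (dg z u)).
Qed.

End smooth.

(** * Schwartz functions *)

Section schwartz.
Variables (R : realType) (n : nat).
Local Notation V := 'rV[R]_n.
Implicit Types (f g : V -> R).

Definition decays f := forall N : nat, exists M : R, forall x, enorm x ^+ N * `|f x| <= M.

Lemma schwartz_smooth f : schwartz f -> smooth f.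
Proof. by case. Qed.

Lemma schwartz_decays f : schwartz f -> decays f.
Proof. by move=> [_ H] N; exact: (H N [::]). Qed.

Lemma schwartz_D f u : schwartz f -> schwartz ('D_u f).
Proof.
move=> [sf df]; split; first exact: smooth_D.
by move=> N s; rewrite -iterD_rcons; exact: df.
Qed.

(** Inside a family stable under derivatives, only the decay of the members themselves remains to be
    checked. *)
Lemma schwartz_coind (P : (V -> R) -> Prop) :
  (forall f, P f -> [/\ continuous f, forall z u, derivable f z u, decays f
    & forall u, P ('D_u f)]) ->
  forall f, P f -> schwartz f.
Proof.
move=> PP f Pf; split.
  by apply: smooth_coind Pf => g /PP[].
move=> N s; elim/last_ind: s f Pf => [|s u IH] f /PP[cf df dec PD].
  exact: dec.
by rewrite iterD_rcons; exact: IH.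
Qed.

Lemma enorm_ge0 (x : V) : 0 <= enorm x.
Proof. exact: sqrtr_ge0. Qed.

Lemma dotpp_ge0 (x : V) : 0 <= dotp x x.
Proof. by rewrite sumr_ge0// => i _; rewrite -expr2 sqr_ge0. Qed.

Lemma sqr_enorm (x : V) : enorm x ^+ 2 = dotp x x.
Proof. by rewrite sqr_sqrtr// dotpp_ge0. Qed.

Lemma coord_le_enorm (x : V) i : `|x 0 i| <= enorm x.
Proof.
rewrite -sqrtr_sqr ler_sqrt ?dotpp_ge0// /dotp (bigD1 i)//= -expr2 lerDl.
by rewrite sumr_ge0// => j _; rewrite -expr2 sqr_ge0.
Qed.

Lemma enorm_le_sum (x : V) : enorm x <= \sum_i `|x 0 i|.
Proof.
rewrite -(@ler_pXn2r _ 2)//; last 2 first.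
- exact: enorm_ge0.
- by rewrite nnegrE sumr_ge0.
rewrite sqr_enorm expr2 mulr_suml; apply: ler_sum => i _.
rewrite -[leLHS]ger0_norm -?expr2 ?sqr_ge0// expr2 normrM ler_wpM2l//.
by rewrite (bigD1 i)//= lerDl sumr_ge0.
Qed.

Lemma schwartz_eq f g : f =1 g -> schwartz f -> schwartz g.
Proof. by move=> /funext ->. Qed.

Lemma decays_add f g : decays f -> decays g -> decays (fun x => f x + g x).
Proof.
move=> df dg N; have [M HM] := df N; have [M' HM'] := dg N.
exists (M + M') => x; apply: le_trans (lerD (HM x) (HM' x)).
by rewrite -mulrDr ler_wpM2l ?exprn_ge0 ?enorm_ge0// ler_normD.
Qed.

Lemma decays_coord f i : decays f -> decays (fun x => x 0 i * f x).
Proof.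
move=> df N; have [M HM] := df N.+1.
exists M => x; apply: le_trans (HM x).
rewrite normrM mulrA exprSr ler_wpM2r// ler_wpM2l ?exprn_ge0 ?enorm_ge0//.
exact: coord_le_enorm.
Qed.

Lemma schwartz_add f g : schwartz f -> schwartz g -> schwartz (fun x => f x + g x).
Proof.
move=> sf sg.
apply: (@schwartz_coind (fun k => exists f g, [/\ schwartz f, schwartz g & k = f + g]));
  last by exists f, g.
move=> _ [{sf}f [{sg}g [sf sg ->]]]; split.
- by move=> z; apply: continuousD; apply: smooth_cont; exact: schwartz_smooth.
- by move=> z u; apply: derivableD; apply: smooth_derivable; exact: schwartz_smooth.
- by apply: decays_add; exact: schwartz_decays.
- move=> u; exists ('D_u f), ('D_u g); split; [exact: schwartz_D..|].
  by apply/funext => z; rewrite deriveD//; apply: smooth_derivable; exact: schwartz_smooth.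
Qed.

Lemma schwartz_scale c f : schwartz f -> schwartz (fun x => c * f x).
Proof.
move=> sf.
apply: (@schwartz_coind (fun k => exists2 f, schwartz f & k = cst c * f)); last by exists f.
move=> _ [{}f {}sf ->].
have df z u : derivable f z u by apply: smooth_derivable; exact: schwartz_smooth.
split.
- move=> z; apply: continuousM; first exact: cst_continuous.
  by apply: smooth_cont; exact: schwartz_smooth.
- by move=> z u; apply: derivableM; first exact: derivable_cst.
- move=> N; have [M HM] := schwartz_decays sf N.
  exists (`|c| * M) => x; rewrite /= normrM mulrCA ler_wpM2l//.
- move=> u; exists ('D_u f); first exact: schwartz_D.
  apply/funext => z; rewrite deriveM//; first by rewrite derive_cst scaler0 addr0.
Qed.

Lemma schwartz_opp f : schwartz f -> schwartz (fun x => - f x).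
Proof. by move=> /(schwartz_scale (-1)); apply: schwartz_eq => x; rewrite mulN1r. Qed.

Lemma schwartz_sub f g : schwartz f -> schwartz g -> schwartz (fun x => f x - g x).
Proof. by move=> sf /schwartz_opp; exact: schwartz_add. Qed.

Lemma is_derive_coord (x u : V) i : is_derive x u (fun x : V => x 0 i) (u 0 i).
Proof.
have E : (fun h : R => h^-1 *: (((fun x : V => x 0 i) \o shift x) (h *: u) - x 0 i)) @ 0^'
    --> (u 0 i : R).
  apply: cvg_near_cst; near=> h; rewrite /= !mxE addrK scalerA mulVf ?scale1r//.
  by near: h; exact: nbhs_dnbhs_neq.
by apply: DeriveDef; [apply/cvg_ex; exists (u 0 i)|exact/cvg_lim].
Unshelve. all: by end_near. Qed.

(** Differentiating [x_i f] produces the extra term [u_i f], so the stable family consists of the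
    sums [x_i f + g] with [f] and [g] Schwartz; it is entered with [g = 0]. *)
Lemma schwartz_coord f i : schwartz f -> schwartz (fun x => x 0 i * f x).
Proof.
move=> sf.
pose P k := exists2 f, schwartz f & exists2 g, schwartz g &
  k = (fun x : V => x 0 i) * f + g.
apply: (@schwartz_coind P); last first.
  exists f => //; exists (fun x => 0 * f x); first exact: schwartz_scale.
  by apply/funext => x; rewrite !fctE mul0r addr0.
move=> _ [{sf}f sf [g sg ->]].
have df (h : V -> R) z u : schwartz h -> derivable h z u.
  by move=> sh; exact: smooth_derivable (schwartz_smooth sh).
have dc z u : derivable (fun x : V => x 0 i) z u.
  by have dd := is_derive_coord z u i; exact: ex_derive.
split.
- move=> z; apply: continuousD; last by apply: smooth_cont; exact: schwartz_smooth.
  apply: continuousM; first exact: coord_continuous.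
  by apply: smooth_cont; exact: schwartz_smooth.
- move=> z u; apply: derivableD; last exact: df.
  by apply: derivableM; last exact: df.
- apply: (@decays_add (fun x => x 0 i * f x) g); last exact: schwartz_decays.
  by apply: decays_coord; exact: schwartz_decays.
- move=> u; exists ('D_u f); first exact: schwartz_D.
  exists ((fun x => u 0 i * f x) + 'D_u g).
    exact: (schwartz_add (schwartz_scale _ sf) (schwartz_D u sg)).
  apply/funext => z; rewrite deriveD; last 2 first.
  + by apply: derivableM => //; exact: df.
  + exact: df.
  rewrite deriveM//; last exact: df.
  have dd := is_derive_coord z u i; rewrite derive_val.
  by rewrite !fctE -addrA; congr (_ + (_ + _)); rewrite [LHS]mulrC.
Qed.

(** [1 + enorm x] is at most 2 on the unit ball and at most [2 * enorm x] outside it, whence the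
    factor [2 ^+ N]. *)
Lemma decays_add1_enorm f (N : nat) : decays f ->
  exists2 M : R, 0 <= M & forall x, (1 + enorm x) ^+ N * `|f x| <= M.
Proof.
move=> df; have [M0 H0] := df 0%N; have [M1 H1] := df N.
have M00 : 0 <= M0 by apply: le_trans (H0 0); rewrite expr0 mul1r.
have M10 : 0 <= M1 by apply: le_trans (H1 0); rewrite mulr_ge0 ?exprn_ge0 ?enorm_ge0.
exists (2 ^+ N * (M0 + M1)) => [|x]; first by rewrite mulr_ge0 ?exprn_ge0// addr_ge0.
have e0 := enorm_ge0 x.
have [x1|x1] := leP (enorm x) 1.
  rewrite ler_pM ?exprn_ge0 ?addr_ge0//.
    by apply: lerXn2r; rewrite ?nnegrE ?addr_ge0//; lra.
  by have := H0 x; rewrite expr0 mul1r; lra.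
apply: (@le_trans _ _ (2 ^+ N * (enorm x ^+ N * `|f x|))).
  rewrite mulrA ler_wpM2r// -exprMn; apply: lerXn2r; rewrite ?nnegrE ?addr_ge0 ?mulr_ge0//; lra.
by rewrite ler_wpM2l ?exprn_ge0//; have := H1 x; lra.
Qed.

Lemma weight_le (K e : R) (y : V) : 0 <= K -> 0 <= e ->
  (forall i, `|y 0 i| <= K * (1 + e)) -> weight y <= ((1 + K) * (1 + e)) ^+ (n * 2).
Proof.
move=> K0 e0 yz.
rewrite mulnC exprM -[X in _ ^+ X]card_ord -prodr_const; apply: ler_prod => i _.
rewrite addr_ge0 ?sqr_ge0//=.
have := yz i; set b := 1 + e.
have b1 : 1 <= b by rewrite /b; lra.
move=> h; rewrite -[_ 0 i ^+ 2]real_normK ?num_real//.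
have : `|y 0 i| ^+ 2 <= (K * b) ^+ 2 by apply: lerXn2r; rewrite ?nnegrE ?mulr_ge0//; lra.
have Kb : 0 <= K * b by rewrite mulr_ge0//; lra.
rewrite (_ : (1 + K) * b = b + K * b); last by ring.
move: (K * b) Kb => t t0; move: (`|_| ^+ 2) => q qt.
by nra.
Qed.

(** Rapid decay in [z] gives decay in every vector whose coordinates grow at most linearly in
    [enorm z]. Two vectors are treated at once because Fubini in the unfolding argument needs a
    bound integrable in both variables; each weight uses up [n * 2] powers of [1 + enorm z]. *)
Lemma decays_weight_mul f (K : R) : decays f -> 0 <= K ->
  exists2 C : R, 0 <= C &
    forall x y z : V, (forall i, `|x 0 i| <= K * (1 + enorm z)) ->
      (forall i, `|y 0 i| <= K * (1 + enorm z)) -> `|f z| <= C / (weight x * weight y).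
Proof.
move=> df K0; have [M M0 HM] := decays_add1_enorm (n * 2 + n * 2)%N df.
exists ((1 + K) ^+ (n * 2 + n * 2) * M) => [|x y z xz yz].
  by rewrite mulr_ge0 ?exprn_ge0// addr_ge0.
have e0 := enorm_ge0 z.
rewrite ler_pdivlMr ?mulr_gt0 ?weight_gt0// mulrC.
apply: (@le_trans _ _ (((1 + K) * (1 + enorm z)) ^+ (n * 2 + n * 2) * `|f z|)).
  by rewrite ler_wpM2r// exprD ler_pM ?weight_le// ltW// weight_gt0.
by rewrite exprMn -mulrA ler_wpM2l ?exprn_ge0 ?addr_ge0.
Qed.

Lemma weight0 : weight (0 : V) = 1.
Proof. by rewrite /weight big1// => i _; rewrite mxE expr0n addr0. Qed.

Lemma decays_weight f (K : R) : decays f -> 0 <= K ->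
  exists2 C : R, 0 <= C &
    forall y z : V, (forall i, `|y 0 i| <= K * (1 + enorm z)) -> `|f z| <= C / weight y.
Proof.
move=> df K0; have [C C0 HC] := decays_weight_mul df K0.
exists C => // y z yz; rewrite -[weight y]mul1r -weight0; apply: HC => // i.
by rewrite mxE normr0 mulr_ge0// addr_ge0// enorm_ge0.
Qed.

Lemma schwartz_intR f : schwartz f -> intR f.
Proof.
move=> sf; have [C C0 HC] := decays_weight (schwartz_decays sf) ler01.
apply: (@intR_le_weight _ _ _ C).
  by apply: measurable_fun_rV; apply: smooth_cont; exact: schwartz_smooth.
move=> x; apply: HC => i; rewrite mul1r.
by have := coord_le_enorm x i; lra.
Qed.

End schwartz.

(** * Differentiation under the integral sign *)

Section under_integral.
Variable R : realType.
Variables (d : measure_display) (Y : measurableType d) (mu : {measure set Y -> \bar R}).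
Variables (B : set Y) (mB : measurable B).

(** Dominated convergence is about sequences. If continuity fails for some [e], bad points at
    distance less than [1 / (m + 1)] from [x0] form a sequence contradicting the hypothesis. *)
Lemma continuous_seq (V : normedModType R) (F : V -> R) (x0 : V) :
  (forall u : nat -> V, u @ \oo --> x0 -> F (u n) @[n --> \oo] --> F x0) ->
  {for x0, continuous F}.
Proof.
move=> H; apply: contrapT => nF.
have [e e0 He] : exists2 e, 0 < e & forall d, 0 < d ->
    exists x, `|x0 - x| < d /\ e <= `|F x0 - F x|.
  apply: contrapT => nH; apply: nF; apply/cvgrPdist_lt => e e0.
  have : ~ (forall d, 0 < d -> exists x, `|x0 - x| < d /\ e <= `|F x0 - F x|).
    by move=> h; apply: nH; exists e.
  move/existsNP => [r] /not_implyP[r0] /forallNP h.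
  apply/nbhs_ballP; exists r => //= x; rewrite -ball_normE /= => xr.
  by rewrite ltNge; apply/negP => ex; exact: (h x).
have /choice[u hu] : forall n : nat, exists x, `|x0 - x| < n.+1%:R^-1 /\ e <= `|F x0 - F x|.
  by move=> n; apply: He.
have ucv : u @ \oo --> x0.
  apply/cvgrPdist_lt => r r0; near=> m.
  rewrite (lt_trans (hu m).1)// -[ltRHS]invrK ltf_pV2 ?posrE ?invr_gt0//.
  near: m; exists (Num.truncn r^-1) => // s /= rs.
  by rewrite (lt_le_trans (truncnS_gt _))// ler_nat ltnS.
have /cvgrPdist_lt/(_ e e0)[N _ /(_ N (leqnn N))] := H u ucv.
by rewrite ltNge (hu N).2.
Unshelve. all: by end_near. Qed.

Lemma continuous_under_integral (V : normedModType R) (k : V -> Y -> R) (x0 : V)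
    (U : set V) (G : Y -> R) :
  nbhs x0 U ->
  (forall x, U x -> measurable_fun B (k x)) ->
  (forall y, B y -> {for x0, continuous (k ^~ y)}) ->
  mu.-integrable B (EFin \o G) ->
  (forall x y, U x -> B y -> `|k x y| <= G y) ->
  {for x0, continuous (fun x => \int[mu]_(y in B) k x y)}.
Proof.
move=> Ux0 mk ck iG kG; apply: continuous_seq => u ux0.
(* The bounds hold on [U] only, so the terms before the sequence settles in [U] are dropped. *)
have [N _ NU] : \forall n \near \oo, U (u n) by exact: ux0.
rewrite -(cvg_shiftn N); apply: fine_cvg.
have UN m : U (u (m + N)%N) by apply: NU; rewrite /= leq_addl.
have ik x : U x -> mu.-integrable B (EFin \o k x).
  move=> Ux; apply: le_integrable iG => //.
    exact/measurable_EFinP/mk.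
  by move=> y By /=; rewrite lee_fin (le_trans (kG _ _ Ux By))// ler_norm.
have iU0 := ik _ (nbhs_singleton Ux0).
rewrite fineK; last exact: integrable_fin_num.
apply: (@dominated_cvg _ _ _ mu _ mB (fun m y => (k (u (m + N)%N) y)%:E) _ (EFin \o G)) => //=.
- by move=> m; apply/measurable_EFinP; exact: mk.
- move=> y By; apply: cvg_EFin; first exact: nearW.
  rewrite (cvg_shiftn N (fun m => k (u m) y)).
  exact: cvg_comp ux0 (ck y By).
- by move=> m y By; rewrite lee_fin; exact: kG.
Qed.

(** A directional derivative only sees the segment [s *: u + x0] with [|s| < 1]; the one-variable
    theorem on ]-1, 1[ is carried over by [is_derive_affine]. *)
Lemma is_derive_under_integral (V : normedModType R) (k dk : V -> Y -> R) (x0 u : V)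
    (G : Y -> R) :
  (forall s : R, `|s| < 1 -> mu.-integrable B (EFin \o k (s *: u + x0))) ->
  (forall (s : R) y, `|s| < 1 -> B y ->
     is_derive (s *: u + x0) u (k ^~ y) (dk (s *: u + x0) y)) ->
  mu.-integrable B (EFin \o G) ->
  (forall (s : R) y, `|s| < 1 -> B y -> `|dk (s *: u + x0) y| <= G y) ->
  is_derive x0 u (fun x => \int[mu]_(y in B) k x y) (\int[mu]_(y in B) dk x0 y).
Proof.
move=> ik dkk iG dkG.
pose f (s : R) y := k (s *: u + x0) y.
have df (s : R) y : `|s| < 1 -> B y -> is_derive s 1 (f ^~ y) (dk (s *: u + x0) y).
  move=> s1 By; have dd := dkk s y s1 By.
  rewrite -(@derive_val _ _ _ _ _ _ _ dd).
  apply: (@is_derive_affine R R^o V (k ^~ y) (fun s => s *: u + x0) 1 u s).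
    by move=> h; rewrite scalerDl [_%:A]mulr1 addrA.
  exact: ex_derive.
have I0 : `](-1), 1[%classic (0 : R) by rewrite /= in_itv/= ltrN10 ltr01.
have iB (s : R) : `](-1), 1[%classic s -> `|s| < 1.
  by rewrite /= in_itv/= ltr_norml.
have pE (s : R) y : `](-1), 1[%classic s -> B y -> partial1of2 f s y = dk (s *: u + x0) y.
  by move=> /iB s1 By; rewrite partial1of2E; exact: (@derive_val _ _ _ _ _ _ _ (df s y s1 By)).
have G_ub (s : R) y : `](-1), 1[%classic s -> B y -> `|partial1of2 f s y| <= `|G y|.
  move=> Is By; rewrite pE//.
  by rewrite (le_trans _ (ler_norm _))// dkG//; exact: iB.
have intf (s : R) : `](-1), 1[%classic s -> mu.-integrable B (EFin \o f s).
  by move=> /iB; exact: ik.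
have derf (s : R) y : `](-1), 1[%classic s -> B y -> derivable (f ^~ y) s 1.
  by move=> /iB s1 By; have dd := df s y s1 By; exact: ex_derive.
have iG' : mu.-integrable B (EFin \o (fun y => `|G y|)).
  by have := integrable_abse iG; apply: eq_integrable.
have H1 := @derivable_under_integral _ _ _ mu f B mB 0 (-1) 1 I0 intf derf _
  (fun y => normr_ge0 _) iG' G_ub.
have H2 := @differentiation_under_integral _ _ _ mu f B mB 0 (-1) 1 I0 intf derf _
  (fun y => normr_ge0 _) iG' G_ub.
have dF : derivable (fun x => \int[mu]_(y in B) k x y) x0 u by apply/derivable1P.
apply: DeriveDef => //.
have hL (h : R) : (h *: (1 : R^o) + 0) *: u + x0 = h *: u + (0 *: u + x0).
  by rewrite addr0 [_%:A]mulr1 scale0r add0r.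
have dF' : derivable (fun x => \int[mu]_(y in B) k x y) (0 *: u + x0) u.
  by rewrite scale0r add0r.
have E := @derive_val _ _ _ _ _ _ _
  (@is_derive_affine R R^o V _ (fun s => s *: u + x0) 1 u 0 hL dF').
rewrite scale0r add0r in E; rewrite -E.
rewrite -derive1E H2; apply: eq_Rintegral => y; rewrite inE => By.
by rewrite pE// scale0r add0r.
Qed.

End under_integral.

(** * The divergence-free kernel *)

Section kernel.
Variables (R : realType) (n : nat).
Local Notation V := 'rV[R]_n.
Implicit Types (f g eta : V -> R).
Local Notation leb1 := (@lebesgue_measure R).

Lemma schwartz_cont f : schwartz f -> continuous f.
Proof. by move=> sf; apply: smooth_cont; exact: schwartz_smooth. Qed.

Lemma schwartz_derivable f z u : schwartz f -> derivable f z u.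
Proof. by move=> sf; apply: smooth_derivable; exact: schwartz_smooth. Qed.

Lemma derive_sumdir f x (c : 'I_n -> R) (w : 'I_n -> V) (s : seq 'I_n) : smooth f ->
  'D_(\sum_(j <- s) c j *: w j) f x = \sum_(j <- s) c j * 'D_(w j) f x.
Proof.
move=> sf; elim: s => [|j s IH]; first by rewrite !big_nil derive0.
rewrite !big_cons (derive_adddir x (c j *: w j)); last 2 first.
- by move=> z u; exact: smooth_derivable.
- by apply: smooth_cont; exact: smooth_D.
by rewrite IH (derive_scaledir x (w j)) // => z u; exact: smooth_derivable.
Qed.

Lemma derive_coords f x (u : V) : smooth f ->
  'D_u f x = \sum_j u 0 j * 'D_(delta_mx 0 j) f x.
Proof. by move=> sf; rewrite {1}(row_sum_delta u) derive_sumdir. Qed.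

Lemma decays_le f g (K : R) (c : V -> V) : 0 <= K ->
  (forall x, enorm x <= K * (1 + enorm (c x))) ->
  (forall x, `|g x| <= K * `|f (c x)|) -> decays f -> decays g.
Proof.
move=> K0 xc gf df N; have [M M0 HM] := decays_add1_enorm N df.
exists (K ^+ N * K * M) => x.
apply: (@le_trans _ _ ((K * (1 + enorm (c x))) ^+ N * (K * `|f (c x)|))).
  apply: ler_pM => //; first by rewrite exprn_ge0 ?enorm_ge0.
  apply: lerXn2r; rewrite ?nnegrE ?enorm_ge0//.
  by rewrite mulr_ge0// addr_ge0 ?enorm_ge0.
rewrite exprMn mulrACA ler_wpM2l// mulr_ge0// exprn_ge0//.
Qed.

Lemma enormZ (c : R) (x : V) : enorm (c *: x) = `|c| * enorm x.
Proof.
rewrite /enorm -[`|c|]sqrtr_sqr -sqrtrM ?sqr_ge0//; congr Num.sqrt.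
by rewrite /dotp mulr_sumr; apply: eq_bigr => i _; rewrite !mxE expr2 mulrACA.
Qed.

Lemma is_derive_scale_shift f (c : R) (a x u : V) : derivable f (c *: x + a) u ->
  (forall z w, derivable f z w) ->
  is_derive x u (fun y => f (c *: y + a)) (c * 'D_u f (c *: x + a)).
Proof.
move=> df dff; rewrite -(derive_scaledir _ u c dff).
have hL (h : R) : c *: (h *: u + x) + a = h *: (c *: u) + (c *: x + a).
  by rewrite scalerDr !scalerA [h * c]mulrC addrA.
exact: (is_derive_affine hL (dff _ _)).
Qed.

Lemma continuous_scale_shift (c : R) (a : V) : continuous (fun x : V => c *: x + a).
Proof.
by move=> x; apply: continuousD; [apply: scaler_continuous|exact: cst_continuous].
Qed.

Lemma schwartz_affine f (c : R) (a : V) : c != 0 -> schwartz f ->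
  schwartz (fun x => f (c *: x + a)).
Proof.
move=> c0 sf.
pose P (k : V -> R) := exists2 f, schwartz f &
  exists b, k = cst b * (fun x : V => f (c *: x + a)).
apply: (@schwartz_coind _ _ P); last first.
  by exists f => //; exists 1; apply/funext => x; rewrite !fctE mul1r.
move=> _ [{}f {}sf [b ->]].
have dg x u : is_derive x u (fun y => f (c *: y + a)) (c * 'D_u f (c *: x + a)).
  by apply: is_derive_scale_shift => *; exact: schwartz_derivable.
have dg' x u : derivable (fun y => f (c *: y + a)) x u by have dd := dg x u; exact: ex_derive.
split.
- move=> x; apply: continuousM; first exact: cst_continuous.
  by apply: continuous_comp; [exact: continuous_scale_shift|exact: schwartz_cont].
- by move=> x u; apply: derivableM; [exact: derivable_cst|exact: dg'].
(* With [y = c x + a] one has [|c| |x| <= n |y| + sum |a_i|], which gives the first summand of [K];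
   the second absorbs the scalar [b]. *)
- pose K := (`|c|^-1 * (n%:R + \sum_i `|a 0 i|)) + `|b|.
  have K0 : 0 <= \sum_i `|a 0 i| by rewrite sumr_ge0.
  have K1 : 0 <= `|c|^-1 * (n%:R + \sum_i `|a 0 i|).
    by rewrite mulr_ge0 ?invr_ge0// addr_ge0.
  apply: (@decays_le f _ K (fun x => c *: x + a)).
  + by rewrite addr_ge0.
  + move=> x; set y := c *: x + a.
    have e0 := enorm_ge0 y.
    apply: (@le_trans _ _ (`|c|^-1 * (n%:R + \sum_i `|a 0 i|) * (1 + enorm y))); last first.
      by rewrite ler_wpM2r ?lerDl// addr_ge0.
    rewrite -mulrA ler_pdivlMl ?normr_gt0// -enormZ.
    rewrite (le_trans (enorm_le_sum _))//.
    apply: (@le_trans _ _ (\sum_i (enorm y + `|a 0 i|))).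
      apply: ler_sum => i _; rewrite (_ : (c *: x) 0 i = y 0 i - a 0 i).
        by rewrite (le_trans (ler_normB _ _))// lerD2r coord_le_enorm.
      by rewrite !mxE addrK.
    rewrite big_split/= sumr_const card_ord -[enorm y *+ n]mulr_natl.
    have := ler0n R n; move: K0 e0; move: (\sum_i _) (enorm y) (n%:R) => A B D hA hB hD.
    nra.
  + move=> x; rewrite !fctE normrM ler_wpM2r// /K lerDr//.
  + exact: schwartz_decays.
- move=> u; exists ('D_u f); first exact: schwartz_D.
  exists (b * c); apply/funext => x.
  rewrite (deriveM (derivable_cst _ _ _) (dg' x u)) derive_cst scaler0 addr0.
  by rewrite (@derive_val _ _ _ _ _ _ _ (dg x u)) !fctE -mulrA.
Qed.

(** For [m = n - 1] and [f = eta] this is the function g of the overview. The exponent is left free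
    because each derivative in [x] raises it by one. *)
Definition scale_avg (m : nat) f (x : V) : R :=
  \int[leb1]_(s in `[2^-1, 1]) (s ^+ m * f (s *: x)).

Lemma continuous_scale_line f (x : V) : continuous f ->
  continuous (fun s : R => f (s *: x)).
Proof.
by move=> cf s; apply: continuous_comp; [exact: scalel_continuous|exact: cf].
Qed.

Lemma scale_avg_integrand_cont f m (x : V) : continuous f ->
  continuous (fun s : R => s ^+ m * f (s *: x)).
Proof.
move=> cf s; apply: (@continuousM _ _ (fun s : R => s ^+ m) (fun s => f (s *: x))).
  exact: exprn_continuous.
exact: continuous_scale_line.
Qed.

Lemma schwartz_bounded f : schwartz f -> exists2 M, 0 <= M & forall x, `|f x| <= M.
Proof.
move=> /schwartz_decays df; have [M M0 HM] := decays_add1_enorm 0 df.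
by exists M => // x; have := HM x; rewrite expr0 mul1r.
Qed.

Let unit_itv (s : R) : `[2^-1, 1]%classic s -> 0 <= s <= 1 /\ 2^-1 <= s.
Proof. by rewrite /= in_itv/= => /andP[h1 h2]; split => //; apply/andP; split; lra. Qed.

Let integrable_cst_itv (M : R) : leb1.-integrable `[2^-1, 1] (EFin \o cst M).
Proof.
apply: continuous_compact_integrable; first exact: segment_compact.
by apply: continuous_subspaceT; exact: cst_continuous.
Qed.

Let scale_avg_bound f m M (x : V) (s : R) : (forall x, `|f x| <= M) ->
  `[2^-1, 1]%classic s -> `|s ^+ m * f (s *: x)| <= M.
Proof.
move=> fM /unit_itv[/andP[s0 s1] _].
rewrite normrM ger0_norm ?exprn_ge0// -[leRHS]mul1r ler_pM ?exprn_ge0//.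
by rewrite exprn_ile1.
Qed.

Lemma scale_avg_integrable f m x : continuous f ->
  leb1.-integrable `[2^-1, 1] (EFin \o (fun s : R => s ^+ m * f (s *: x))).
Proof.
move=> cf; apply: continuous_compact_integrable; first exact: segment_compact.
by apply: continuous_subspaceT; exact: scale_avg_integrand_cont.
Qed.

Lemma continuous_scale_avg f m : schwartz f -> continuous (scale_avg m f).
Proof.
move=> sf x0; have [M M0 fM] := schwartz_bounded sf.
apply: (@continuous_under_integral R _ _ leb1 `[2^-1, 1]%classic _ V
  (fun x s => s ^+ m * f (s *: x)) x0 setT (cst M)) => //.
- exact: filterT.
- move=> x _; apply: measurable_funTS; apply: continuous_measurable_fun.
  by apply: scale_avg_integrand_cont; exact: schwartz_cont.
- move=> s _; have c1 : {for x0, continuous (cst (s ^+ m) : V -> R)} by exact: cst_continuous.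
  have c2 : {for x0, continuous (fun x : V => f (s *: x))}.
    by apply: continuous_comp; [exact: scaler_continuous|exact: schwartz_cont].
  exact: continuousM c1 c2.
- by move=> x s _; exact: scale_avg_bound.
Qed.

Lemma is_derive_scale_avg f m x u : schwartz f ->
  is_derive x u (scale_avg m f) (scale_avg m.+1 ('D_u f) x).
Proof.
move=> sf; have [M M0 fM] := schwartz_bounded (schwartz_D u sf).
apply: (@is_derive_under_integral R _ _ leb1 `[2^-1, 1]%classic _ V
  (fun x s => s ^+ m * f (s *: x)) (fun x s => s ^+ m.+1 * 'D_u f (s *: x)) x u (cst M)) => //.
- by move=> s _; apply: scale_avg_integrable; exact: schwartz_cont.
- move=> r s _ _.
  have dd : is_derive (r *: u + x) u (fun y => f (s *: y + 0))
      (s * 'D_u f (s *: (r *: u + x) + 0)).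
    by apply: is_derive_scale_shift => *; exact: schwartz_derivable.
  have {}dd : is_derive (r *: u + x) u (fun y => f (s *: y)) (s * 'D_u f (s *: (r *: u + x))).
    by move: dd; under eq_fun do rewrite addr0; rewrite addr0.
  have dd' : derivable (fun y => f (s *: y)) (r *: u + x) u by exact: ex_derive.
  have := is_deriveM (is_derive_cst (s ^+ m) (r *: u + x) u) dd.
  by rewrite scaler0 addr0 exprSr -mulrA.
- by move=> r s _ Bs; exact: (@scale_avg_bound ('D_u f) m.+1 M (r *: u + x) s fM Bs).
Qed.

(** Since [s >= 1/2], [enorm x <= 2 * enorm (s *: x)], so the average inherits the decay of [f] at
    the cost of [2 ^+ N]. Derivatives of averages are averages of derivatives. *)
Lemma schwartz_scale_avg f m : schwartz f -> schwartz (scale_avg m f).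
Proof.
move=> sf; apply: (@schwartz_coind _ _ (fun k => exists m f, schwartz f /\ k = scale_avg m f));
  last by exists m, f.
move=> _ [{}m [{}f [{}sf ->]]]; split.
- exact: continuous_scale_avg.
- by move=> x u; have dd := is_derive_scale_avg m x u sf; exact: ex_derive.
- move=> N; have [M HM] := schwartz_decays sf N.
  exists (2 ^+ N * M) => x.
  have i0 := scale_avg_integrable m x (schwartz_cont sf).
  apply: (@le_trans _ _ (enorm x ^+ N * \int[leb1]_(s in `[2^-1, 1]) `|s ^+ m * f (s *: x)|)).
    by rewrite ler_wpM2l ?exprn_ge0 ?enorm_ge0// le_normr_Rintegral.
  have i1 : leb1.-integrable `[2^-1, 1] (EFin \o (fun s : R => `|s ^+ m * f (s *: x)|)).
    by have := integrable_abse i0; apply: eq_integrable.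
  rewrite -RintegralZl//.
  apply: (@le_trans _ _ (\int[leb1]_(s in `[2^-1, 1]) cst (2 ^+ N * M) s)).
    apply: le_Rintegral => //.
      have mI : measurable (`[(2^-1 : R), 1]%classic : set (measurableTypeR R)) by [].
      have := integrableZl mI (enorm x ^+ N) i1.
      by apply: eq_integrable => // s _; rewrite /= EFinM.
    move=> s hs; have [/andP[s0 s1] s2] := unit_itv hs.
    have xs : enorm x <= 2 * enorm (s *: x).
      rewrite enormZ ger0_norm// mulrA -[leLHS]mul1r ler_wpM2r ?enorm_ge0//; lra.
    apply: (@le_trans _ _ ((2 * enorm (s *: x)) ^+ N * `|f (s *: x)|)).
      apply: ler_pM; rewrite ?exprn_ge0 ?enorm_ge0//.
        by apply: lerXn2r; rewrite ?nnegrE ?mulr_ge0 ?enorm_ge0.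
      rewrite normrM ger0_norm ?exprn_ge0// -[leRHS]mul1r ler_wpM2r//.
      by rewrite exprn_ile1.
    by rewrite exprMn -mulrA ler_wpM2l ?exprn_ge0.
  have M0 : 0 <= M by apply: le_trans (HM 0); rewrite mulr_ge0 ?exprn_ge0 ?enorm_ge0.
  have mE : leb1 `[(2^-1 : R), 1]%classic = (1 - 2^-1)%:E.
    apply: (etrans (lebesgue_measure_itv _)); rewrite /= lte_fin ifT//; lra.
  rewrite Rintegral_cst// -[leRHS]mulr1 ler_wpM2l ?mulr_ge0 ?exprn_ge0//.
  rewrite [X in fine X]mE /=; lra.
- move=> u; exists m.+1, ('D_u f); split; first exact: schwartz_D.
  apply/funext => x; exact: (@derive_val _ _ _ _ _ _ _ (is_derive_scale_avg m x u sf)).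
Qed.

Lemma scale_avg_radial f m : (forall x y, enorm x = enorm y -> f x = f y) ->
  forall x y, enorm x = enorm y -> scale_avg m f x = scale_avg m f y.
Proof.
move=> rf x y xy; apply: eq_Rintegral => s _; congr (_ * _).
by apply: rf; rewrite !enormZ xy.
Qed.

End kernel.

Section divergence_free_kernel.
Variables (R : realType) (n : nat).
Local Notation V := 'rV[R]_n.
Implicit Types (f g eta psi : V -> R).
Local Notation leb1 := (@lebesgue_measure R).
Local Notation e j := (delta_mx 0 j : V).

(* The left-hand side is the divergence of x |-> x * scale_avg n.-1 eta x, and under the
   integral sign it becomes the derivative of s^n eta(s x) in s. *)
Lemma scale_avg_euler eta (x : V) : (0 < n)%N -> schwartz eta ->
  n%:R * scale_avg n.-1 eta x + 'D_x (scale_avg n.-1 eta) x =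
  eta x - 2^-1 ^+ n * eta (2^-1 *: x).
Proof.
move=> n0 se.
rewrite (@derive_val _ _ _ _ _ _ _ (is_derive_scale_avg n.-1 x x se)) prednK//.
have i1 := scale_avg_integrable n.-1 x (schwartz_cont se).
have i2 := scale_avg_integrable n x (schwartz_cont (schwartz_D x se)).
have mI : measurable (`[(2^-1 : R), 1]%classic : set (measurableTypeR R)) by [].
have i1' : leb1.-integrable `[2^-1, 1]%classic
    (EFin \o (fun s : R => n%:R * (s ^+ n.-1 * eta (s *: x)))).
  have := integrableZl mI n%:R i1.
  by apply: eq_integrable => // s _; rewrite /= EFinM.
rewrite /scale_avg -RintegralZl// -RintegralD//.
pose F (s : R) := s ^+ n * eta (s *: x).
pose F' (s : R) := n%:R * (s ^+ n.-1 * eta (s *: x)) + s ^+ n * 'D_x eta (s *: x).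
have dF (s : R) : is_derive s 1 F (F' s).
  have d1 : is_derive s 1 (fun s : R => eta (s *: x)) ('D_x eta (s *: x)).
    have := @is_derive_line R _ eta 0 x s (schwartz_derivable se).
    by rewrite add0r; under eq_fun do rewrite add0r.
  have d2 : is_derive s 1 (fun s : R => s ^+ n) (n%:R * s ^+ n.-1).
    have := @exp_derive _ n s 1; rewrite [_ *: 1]mulr1 => E.
    by apply: DeriveDef; [exact: exprn_derivable|exact: E].
  have := is_deriveM d2 d1.
  rewrite /F' addrC; congr (is_derive _ _ _ (_ + _)).
  by rewrite [_ *: _]mulrC mulrA.
have cF (s : R) : {for s, continuous F}.
  by apply: scale_avg_integrand_cont; exact: schwartz_cont.
have cF' : continuous F'.
  move=> s; have c1 : {for s, continuous (cst (n%:R) : R -> R)} by exact: cst_continuous.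
  have c2 := @scale_avg_integrand_cont _ _ _ n.-1 x (schwartz_cont se) s.
  have c3 := @scale_avg_integrand_cont _ _ _ n x (schwartz_cont (schwartz_D x se)) s.
  exact: continuousD (continuousM c1 c2) c3.
have half1 : 2^-1 < 1 :> R by lra.
have := @continuous_FTC2 _ F' F 2^-1 1 half1.
rewrite /F expr1n mul1r scale1r => H.
rewrite /Rintegral; apply: (etrans (congr1 fine (H _ _ _))); last by [].
- exact: continuous_subspaceT.
- split.
  + by move=> s _; have dd := dF s; exact: ex_derive.
  + exact: cvg_at_right_filter (cF _).
  + exact: cvg_at_left_filter (cF _).
- by move=> s _; rewrite derive1E; exact: (@derive_val _ _ _ _ _ _ _ (dF s)).
Qed.

Definition coordmul g (l : 'I_n) (x : V) : R := x 0 l * g x.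

Lemma derive_coordmul g l (x u : V) : schwartz g ->
  'D_u (coordmul g l) x = x 0 l * 'D_u g x + u 0 l * g x.
Proof.
move=> sg; have d1 := is_derive_coord x u l.
have d2 : is_derive x u g ('D_u g x) by apply: derivableP; exact: schwartz_derivable.
rewrite (@derive_val _ _ _ _ _ _ _ (is_deriveM d1 d2)).
exact: (congr1 (fun z => x 0 l * 'D_u g x + z) (mulrC (g x) (u 0 l))).
Qed.

(* x + h u and x - h u have the same length. *)
Lemma derive_radial g (x u : V) : (forall x y, enorm x = enorm y -> g x = g y) ->
  (forall z w, derivable g z w) -> dotp x u = 0 -> 'D_u g x = 0.
Proof.
move=> rg dg xu.
have E : 'D_(- 1 *: u) g x = 'D_u g x.
  suff E0 : (fun h : R => h^-1 *: ((g \o shift x) (h *: (- 1 *: u)) - g x)) =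
      (fun h : R => h^-1 *: ((g \o shift x) (h *: u) - g x)).
    by rewrite /derive E0.
  apply/funext => h; apply: (congr1 (fun b => h^-1 *: (b - g x))).
  apply: rg; rewrite /enorm; congr Num.sqrt.
  have dE (b : R) : dotp (b *: u + x) (b *: u + x) = b ^+ 2 * dotp u u + dotp x x.
    rewrite -[RHS]addr0 -(mulr0 (2 * b)) -xu /dotp !mulr_sumr -!big_split/=.
    by apply: eq_bigr => i _; rewrite !mxE; ring.
  by rewrite /= scalerA !dE mulrN1 sqrrN.
move: E; rewrite derive_scaledir// mulN1r => /eqP.
by rewrite -subr_eq0 -opprD oppr_eq0 -mulr2n mulrn_eq0/= => /eqP.
Qed.

(** Row [l] is [psi e_l] minus the gradient of [G l]. Divergence-free fields do not see the
    gradient, whose role is to cancel the divergence of [psi e_l]. *)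
Definition kern psi (G : 'I_n -> V -> R) (l m : 'I_n) (x : V) : R :=
  (l == m)%:R * psi x - 'D_(e m) (G l) x.

Lemma schwartz_kern psi G l m : schwartz psi -> schwartz (G l) -> schwartz (kern psi G l m).
Proof.
by move=> sp sG; apply: schwartz_sub; [exact: schwartz_scale|exact: schwartz_D].
Qed.

Lemma derive_kern psi G l m u x : schwartz psi -> schwartz (G l) ->
  'D_u (kern psi G l m) x = (l == m)%:R * 'D_u psi x - 'D_u ('D_(e m) (G l)) x.
Proof.
move=> sp sG.
have d1 : is_derive x u psi ('D_u psi x) by apply: derivableP; exact: schwartz_derivable.
have d2 : is_derive x u ('D_(e m) (G l)) ('D_u ('D_(e m) (G l)) x).
  by apply: derivableP; apply: schwartz_derivable; exact: schwartz_D.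
have d3 := is_deriveM (is_derive_cst ((l == m)%:R : R) x u) d1.
have := is_deriveB d3 d2; rewrite scaler0 addr0 => d4.
exact: (@derive_val _ _ _ _ _ _ _ d4).
Qed.

Lemma schwartz_derive_comm f u v x : schwartz f -> 'D_u ('D_v f) x = 'D_v ('D_u f) x.
Proof.
move=> sf; apply: derive_comm.
- by move=> *; exact: schwartz_derivable.
- by move=> *; apply: schwartz_derivable; exact: schwartz_D.
- by move=> *; apply: schwartz_derivable; exact: schwartz_D.
- by apply: schwartz_cont; apply: schwartz_D; exact: schwartz_D.
- by apply: schwartz_cont; apply: schwartz_D; exact: schwartz_D.
Qed.

(** The divergence of row [l] is [d_l psi] minus the sum over [m] of [d_m d_m G_l]. Symmetry of the
    Jacobian replaces [d_m G_l] by [d_l G_m]; commuting the derivatives then leaves [d_l] of the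
    divergence of G, which is [d_l psi]. *)
Lemma kern_div_free eta psi (g := scale_avg n.-1 eta) (l : 'I_n) x : schwartz eta ->
  (forall x y, enorm x = enorm y -> eta x = eta y) ->
  (forall x, psi x = eta x - 2^-1 ^+ n * eta (2^-1 *: x)) ->
  \sum_m 'D_(e m) (kern psi (coordmul g) l m) x = 0.
Proof.
move=> se re pe.
have n0 : (0 < n)%N by apply: leq_ltn_trans (ltn_ord l).
have sg : schwartz g by exact: schwartz_scale_avg.
have rg : forall x y, enorm x = enorm y -> g x = g y by exact: scale_avg_radial.
have sG i : schwartz (coordmul g i) by exact: schwartz_coord.
have divG : psi = fun y => \sum_m 'D_(e m) (coordmul g m) y.
  apply/funext => y; rewrite pe -scale_avg_euler// -/g.
  rewrite (derive_coords _ _ (schwartz_smooth sg)).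
  under [RHS]eq_bigr do rewrite (derive_coordmul _ _ _ sg).
  rewrite big_split/= addrC; congr (_ + _).
  under eq_bigr do rewrite mxE !eqxx mul1r.
  by rewrite sumr_const card_ord mulr_natl.
have sp : schwartz psi.
  have s1 := schwartz_affine (c := 2^-1) 0 (lt0r_neq0 _) se.
  apply: schwartz_eq (schwartz_sub se (schwartz_scale (2^-1 ^+ n) (s1 _))) => [y|].
    by rewrite pe addr0.
  by rewrite invr_gt0.
(* The antisymmetric part is the derivative of [g] along [y_j e_i - y_i e_j], a vector orthogonal to
   [y]; it vanishes because [g] is radial. *)
have symG i j : 'D_(e i) (coordmul g j) = 'D_(e j) (coordmul g i).
  apply/funext => y; rewrite !derive_coordmul// !mxE !eqxx/= (eq_sym j i).
  suff E : y 0 j * 'D_(e i) g y = y 0 i * 'D_(e j) g y by rewrite E.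
  apply/eqP; rewrite -subr_eq0; apply/eqP.
  have dg z w : derivable g z w by exact: schwartz_derivable.
  have := @derive_radial g y (y 0 j *: e i + (- y 0 i) *: e j) rg dg.
  rewrite (derive_adddir _ _ dg); last first.
    by apply: schwartz_cont; exact: schwartz_D.
  rewrite !(derive_scaledir _ _ _ dg) mulNr; apply.
  rewrite /dotp.
  under eq_bigr do rewrite !mxE !eqxx/= mulrDr.
  have sumd (c : R) (a : 'I_n) : \sum_k y 0 k * (c * (k == a)%:R) = y 0 a * c.
    rewrite (bigD1 a)//= eqxx mulr1 big1 ?addr0// => k /negbTE ->.
    by rewrite !mulr0.
  by rewrite big_split/= !sumd; ring.
under eq_bigr do rewrite derive_kern//.
rewrite big_split/= (bigD1 l)//= eqxx mul1r big1 ?addr0; last first.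
  by move=> m /negbTE ml; rewrite eq_sym ml mul0r.
rewrite sumrN; apply/eqP; rewrite subr_eq0; apply/eqP.
under eq_bigr do rewrite symG (schwartz_derive_comm _ _ _ (sG _)).
have dd (m : 'I_n) : is_derive x (e l) ('D_(e m) (coordmul g m))
    ('D_(e l) ('D_(e m) (coordmul g m)) x).
  by apply: derivableP; apply: schwartz_derivable; exact: schwartz_D.
have := @derive_sum _ _ _ n (fun m => 'D_(e m) (coordmul g m)) x (e l)
  (fun m => @ex_derive _ _ _ _ _ _ _ (dd m)).
rewrite divG => <-; congr ('D_ _ _ _).
by apply/funext => y; rewrite fct_sumE.
Qed.

Definition dilate (c : R) f (x : V) : R := c ^+ n * f (c *: x).

Lemma schwartz_dilate c f : 0 < c -> schwartz f -> schwartz (dilate c f).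
Proof.
move=> c0 sf; apply: schwartz_scale.
apply: schwartz_eq (schwartz_affine 0 (lt0r_neq0 c0) sf) => y.
by rewrite addr0.
Qed.

Lemma derive_dilate c f u x : schwartz f -> 'D_u (dilate c f) x = c * dilate c ('D_u f) x.
Proof.
move=> sf.
have d1 : is_derive x u (fun y => f (c *: y + 0)) (c * 'D_u f (c *: x + 0)).
  by apply: is_derive_scale_shift => *; exact: schwartz_derivable.
have {}d1 : is_derive x u (fun y => f (c *: y)) (c * 'D_u f (c *: x)).
  by move: d1; under eq_fun do rewrite addr0; rewrite addr0.
have := is_deriveM (is_derive_cst (c ^+ n : R) x u) d1.
rewrite scaler0 addr0 => d2; rewrite (@derive_val _ _ _ _ _ _ _ d2).
by rewrite /dilate mulrCA.
Qed.

(** The factor [c^-1] offsets the [c] coming from the derivative of the dilated [G]. Thus the kernel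
    at every scale is a dilation of a single one. *)
Lemma kern_dilate c psi G l m : 0 < c -> (forall i, schwartz (G i)) ->
  kern (dilate c psi) (fun i x => c^-1 * dilate c (G i) x) l m = dilate c (kern psi G l m).
Proof.
move=> c0 sG; apply/funext => x; rewrite /kern.
have d1 : is_derive x (e m) (dilate c (G l)) ('D_(e m) (dilate c (G l)) x).
  by apply: derivableP; apply: schwartz_derivable; exact: schwartz_dilate.
have := is_deriveM (is_derive_cst (c^-1 : R) x (e m)) d1.
rewrite scaler0 addr0 => d2; rewrite (@derive_val _ _ _ _ _ _ _ d2) derive_dilate//.
have E : c^-1 * (c * dilate c ('D_(e m) (G l)) x) = dilate c ('D_(e m) (G l)) x.
  by rewrite mulrA mulVf ?gt_eqF// mul1r.
by rewrite [X in _ - X]E /dilate; ring.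
Qed.

End divergence_free_kernel.

(** * Periodization *)

Section dominated_fubini.
Context (R : realType) (d1 d2 : measure_display) (T1 : measurableType d1) (T2 : measurableType d2).
Variables (m1 : {sigma_finite_measure set T1 -> \bar R}).
Variables (m2 : {sigma_finite_measure set T2 -> \bar R}).
Variables (H : T1 * T2 -> R) (a : T1 -> R) (b : T2 -> R).
Hypotheses (mH : measurable_fun setT H).
Hypotheses (ia : m1.-integrable setT (EFin \o a)) (ib : m2.-integrable setT (EFin \o b)).
Hypotheses (a0 : forall x, 0 <= a x) (b0 : forall y, 0 <= b y).
Hypothesis Hab : forall x y, `|H (x, y)| <= a x * b y.

Let mH1 x : measurable_fun setT (fun y => H (x, y)).
Proof. exact: measurableT_comp mH (measurable_pair1 x). Qed.

Let mH2 y : measurable_fun setT (fun x => H (x, y)).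
Proof. exact: measurableT_comp mH (measurable_pair2 y). Qed.

Lemma dominated_slice1 x : m2.-integrable setT (fun y => (H (x, y))%:E).
Proof.
apply: (@le_integrable _ _ _ m2 _ measurableT _ _ _ _ (integrableZl measurableT (a x) ib)).
  exact/measurable_EFinP/mH1.
move=> y _; rewrite /= lee_fin (le_trans (Hab _ _))//.
by rewrite ger0_norm// mulr_ge0.
Qed.

Lemma dominated_slice2 y : m1.-integrable setT (fun x => (H (x, y))%:E).
Proof.
apply: (@le_integrable _ _ _ m1 _ measurableT _ _ _ _ (integrableZl measurableT (b y) ia)).
  exact/measurable_EFinP/mH2.
move=> x _; rewrite /= lee_fin (le_trans (Hab _ _))// mulrC.
by rewrite ger0_norm// mulr_ge0.
Qed.

Lemma dominated_prod : (product_measure1 m1 m2).-integrable setT (EFin \o H).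
Proof.
apply/integrable12ltyP; first exact/measurable_EFinP.
apply: (@le_lt_trans _ _ (\int[m1]_x ((a x)%:E * \int[m2]_y (b y)%:E))%E).
  apply: ge0_le_integral => //.
  - by move=> x _; exact: integral_ge0.
  - have mh : measurable_fun setT (fun z => (`|(H z)%:E|)%E).
      by apply: measurableT_comp => //; exact/measurable_EFinP.
    have := @measurable_fun_fubini_tonelli_F _ _ _ _ _ m2 _ mh (fun z => abse_ge0 _).
    exact.
  - apply: emeasurable_funM; last exact: measurable_cst.
    exact: measurable_int ia.
  - move=> x _; rewrite -ge0_integralZl//; last 3 first.
    + exact: measurable_int ib.
    + by move=> y _; rewrite lee_fin.
    + by rewrite lee_fin.
    apply: ge0_le_integral => //.
    + apply: measurableT_comp => //; exact/measurable_EFinP/mH1.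
    + apply: emeasurable_funM; first exact: measurable_cst.
      exact: measurable_int ib.
    + by move=> y _; rewrite lee_fin.
have bE : (\int[m2]_y (b y)%:E)%E = (\int[m2]_y b y)%:E.
  by rewrite /Rintegral fineK//; exact: integrable_fin_num.
have aE : (\int[m1]_x (a x)%:E)%E = (\int[m1]_x a x)%:E.
  by rewrite /Rintegral fineK//; exact: integrable_fin_num.
rewrite bE ge0_integralZr//.
- by rewrite aE -EFinM ltry.
- exact: measurable_int ia.
- by move=> x _; rewrite lee_fin.
- by rewrite lee_fin Rintegral_ge0.
Qed.

Lemma dominated_fubini1 :
  \int[product_measure1 m1 m2]_z H z = \int[m1]_x \int[m2]_y H (x, y).
Proof.
rewrite /Rintegral -(integral12_prod_meas1 dominated_prod); apply: congr1.
apply: eq_integral => x _; rewrite fineK//.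
by apply: integrable_fin_num => //; exact: dominated_slice1.
Qed.

Lemma dominated_fubini :
  \int[m1]_x \int[m2]_y H (x, y) = \int[m2]_y \int[m1]_x H (x, y).
Proof.
rewrite -dominated_fubini1 /Rintegral -(integral21_prod_meas1 dominated_prod); apply: congr1.
apply: eq_integral => y _; rewrite fineK//.
by apply: integrable_fin_num => //; exact: dominated_slice2.
Qed.

End dominated_fubini.

Section periodization.
Variables (R : realType) (n : nat).
Local Notation V := 'rV[R]_n.
Local Notation T n := (n.-tuple (measurableTypeR R)).
Local Notation leb n := (lebesgue_tuple R n).
Implicit Types (f w : V -> R).
Variable A : 'M[R]_n.
Hypothesis uA : A \in unitmx.

Definition floor_rV (y : V) : V := map_mx (fun t : R => (Num.floor t)%:~R) y.

(* The sum of f over the translates of x by the lattice, written as an integral so that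
   Fubini and differentiation under the integral sign apply: floor_rV y takes each value in
   Z^n on a set of measure 1. *)
Definition periodize f (x : V) : R := integral_Rn (fun y => f (x + floor_rV y *m A)).

(** Stated for measurable [f] so as to cover the discontinuous [cell] as well. *)
Lemma measurable_floor_rV f : measR f ->
  measurable_fun setT (fun z : T n * T n =>
    f (rV_of_tuple z.1 + floor_rV (rV_of_tuple z.2) *m A)).
Proof.
move=> cf.
pose m (z : T n * T n) : T n :=
  [tuple (tnth z.1 i + \sum_j (Num.floor (tnth z.2 j))%:~R * A j i : measurableTypeR R) | i < n].
have mm : measurable_fun setT m.
  apply/measurable_fun_tnthP => i.
  rewrite (_ : _ \o _ = (fun z => tnth z.1 i + \sum_j (Num.floor (tnth z.2 j))%:~R * A j i)); last first.
    by apply/funext => z; rewrite /= tnth_mktuple.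
  apply: measurable_funD.
    exact: measurableT_comp (measurable_tnth i) measurable_fst.
  apply: measurable_sum => j.
  apply: measurable_funM; last exact: measurable_cst.
  have mfl : measurable_fun setT (fun t : measurableTypeR R => (Num.floor t)%:~R : measurableTypeR R).
    apply: nondecreasing_measurable => // s t st.
    by rewrite ler_int; exact: le_floor.
  apply: (measurableT_comp mfl).
  exact: measurableT_comp (measurable_tnth j) measurable_snd.
rewrite (_ : (fun _ => _) = (fun y => f (rV_of_tuple y)) \o m).
  exact: measurableT_comp cf mm.
apply/funext => z /=; congr f; apply/rowP => i; rewrite !mxE tnth_mktuple.
by congr (_ + _); apply: eq_bigr => j _; rewrite !mxE.
Qed.

(** Inverting [A] expresses the integer part of [y] through the translated point and [x], and [y] is
    within 1 of its integer part. Decay in the translated point therefore becomes decay in [y]. *)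
Lemma floor_rV_bound (r : R) : 0 <= r ->
  exists2 K : R, 0 <= K & forall x y : V, (forall i, `|x 0 i| <= r) ->
    forall i, `|y 0 i| <= K * (1 + enorm (x + floor_rV y *m A)).
Proof.
move=> r0; pose a := \sum_i \sum_j `|invmx A i j|.
have a0 : 0 <= a by rewrite sumr_ge0// => i _; rewrite sumr_ge0.
exists ((1 + r) * a + 1) => [|x y xr i]; first by rewrite addr_ge0 ?mulr_ge0// addr_ge0.
set z := x + _; have z0 := enorm_ge0 z.
have fE : floor_rV y = (z - x) *m invmx A.
  by rewrite /z addrAC subrr add0r mulmxK.
clearbody z.
have f1 : `|floor_rV y 0 i| <= (enorm z + r) * a.
  rewrite fE mxE (le_trans (ler_norm_sum _ _ _))//.
  rewrite /a mulr_sumr; apply: ler_sum => j _.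
  rewrite normrM ler_pM//.
    by rewrite !mxE (le_trans (ler_normB _ _))// lerD// coord_le_enorm.
  by rewrite (bigD1 i)//= lerDl sumr_ge0.
have f2 : `|y 0 i - floor_rV y 0 i| <= 1.
  rewrite mxE ler_norml; have := floor_itv (y 0 i); rewrite intrD.
  move: ((Num.floor _)%:~R) => q /andP[h1 h2].
  have {}h2 : y 0 i < q + 1 := h2.
  apply/andP; split; last by rewrite lerBlDl ltW.
  by apply: (le_trans (lerN10 R)); rewrite subr_ge0.
have -> : y 0 i = (y 0 i - floor_rV y 0 i) + floor_rV y 0 i by rewrite subrK.
apply: (le_trans (ler_normD _ _)); apply: (le_trans (lerD f2 f1)).
have aux (e q b : R) : 0 <= e -> 0 <= q -> 0 <= b ->
    1 + (e + q) * b <= ((1 + q) * b + 1) * (1 + e).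
  move=> e0 q0 b0; have := mulr_ge0 b0 (mulr_ge0 q0 e0); nra.
exact: aux.
Qed.

(** The bound is uniform for [x] in a bounded set, as continuity and differentiation under the
    integral sign require. *)
Lemma periodize_dom f (r : R) : decays f -> 0 <= r ->
  exists2 C : R, 0 <= C & forall x y : V, (forall i, `|x 0 i| <= r) ->
    `|f (x + floor_rV y *m A)| <= C / weight y.
Proof.
move=> df r0; have [K K0 HK] := floor_rV_bound r0.
have [C C0 HC] := decays_weight df K0.
by exists C => // x y xr; apply: HC => i; exact: HK.
Qed.

Lemma measurable_periodize f x : continuous f ->
  measurable_fun setT (fun y : T n => f (x + floor_rV (rV_of_tuple y) *m A)).
Proof.
move=> cf.
pose t : T n := [tuple x 0 i | i < n].
have xt : x = rV_of_tuple t by apply/rowP => i; rewrite mxE tnth_mktuple.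
rewrite xt.
exact: measurableT_comp (measurable_floor_rV (measurable_fun_rV cf)) (measurable_pair1 t).
Qed.

Lemma integrable_weight_cst (C : R) :
  (leb n).-integrable setT (EFin \o (fun y : T n => C / weight (rV_of_tuple y))).
Proof.
have := integrableZl measurableT C (@intR_weightV R n).
by apply: eq_integrable => // y _; rewrite /= EFinM.
Qed.

Lemma integrable_periodize f x : schwartz f ->
  (leb n).-integrable setT (EFin \o (fun y : T n => f (x + floor_rV (rV_of_tuple y) *m A))).
Proof.
move=> sf; have r0 : 0 <= \sum_i `|x 0 i| by rewrite sumr_ge0.
have [C C0 HC] := periodize_dom (schwartz_decays sf) r0.
apply: le_integrable (integrable_weight_cst C) => //.
  by apply/measurable_EFinP; apply: measurable_periodize; exact: schwartz_cont.
move=> y _; rewrite /= lee_fin (le_trans _ (ler_norm _))// HC// => i.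
by rewrite (bigD1 i)//= lerDl sumr_ge0.
Qed.

Lemma nbhs_coord_bound (x0 : V) :
  nbhs x0 [set x : V | forall i, `|x 0 i| <= \sum_i `|x0 0 i| + 1].
Proof.
apply/nbhs_ballP; exists 1 => //= x [_ x0x] i.
have := x0x 0 i; rewrite /ball /= => h.
have h2 : `|x0 0 i| <= \sum_i `|x0 0 i| by rewrite (bigD1 i)//= lerDl sumr_ge0.
rewrite -[x 0 i](subrK (x0 0 i)) (le_trans (ler_normD _ _))// addrC lerD//.
by rewrite distrC ltW.
Qed.

Lemma continuous_periodize f : schwartz f -> continuous (periodize f).
Proof.
move=> sf x0.
have r0 : 0 <= \sum_i `|x0 0 i| + 1 by rewrite addr_ge0// sumr_ge0.
have [C C0 HC] := periodize_dom (schwartz_decays sf) r0.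
apply: (@continuous_under_integral R _ _ (leb n) setT _ V
  (fun x (y : T n) => f (x + floor_rV (rV_of_tuple y) *m A)) x0 _ _
  (nbhs_coord_bound x0) _ _ (integrable_weight_cst C)) => //.
- by move=> x _; apply: measurable_periodize; exact: schwartz_cont.
- move=> y _; apply: (@continuous_comp _ _ _ (fun x : V => x + floor_rV (rV_of_tuple y) *m A) f).
    by apply: continuousD; [exact: cvg_id|exact: cst_continuous].
  exact: schwartz_cont.
- by move=> x y xU _; exact: HC.
Qed.

Lemma is_derive_periodize f x u : schwartz f -> is_derive x u (periodize f) (periodize ('D_u f) x).
Proof.
move=> sf.
have r0 : 0 <= \sum_i `|u 0 i| + \sum_i `|x 0 i| by rewrite addr_ge0// sumr_ge0.
have [C C0 HC] := periodize_dom (schwartz_decays (schwartz_D u sf)) r0.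
apply: (@is_derive_under_integral R _ _ (leb n) setT measurableT V
  (fun x (y : T n) => f (x + floor_rV (rV_of_tuple y) *m A))
  (fun x (y : T n) => 'D_u f (x + floor_rV (rV_of_tuple y) *m A)) x u _ _ _
  (integrable_weight_cst C)).
- by move=> s _; exact: integrable_periodize.
- move=> s y _ _.
  have hL (h : R) : h *: u + (s *: u + x) + floor_rV (rV_of_tuple y) *m A =
      h *: u + (s *: u + x + floor_rV (rV_of_tuple y) *m A) by rewrite -!addrA.
  exact: (is_derive_affine hL (schwartz_derivable sf)).
- move=> s y s1 _; apply: HC => i; rewrite !mxE; apply: (le_trans (ler_normD _ _)).
  apply: lerD; last by rewrite (bigD1 i)//= lerDl sumr_ge0.
  apply: (@le_trans _ _ `|u 0 i|); last by rewrite (bigD1 i)//= lerDl sumr_ge0.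
  by rewrite normrM -[leRHS]mul1r ler_wpM2r// ltW.
Qed.

Lemma derive_periodize f u : schwartz f -> 'D_u (periodize f) = periodize ('D_u f).
Proof.
move=> sf; apply/funext => x.
exact: (@derive_val _ _ _ _ _ _ _ (is_derive_periodize x u sf)).
Qed.

Lemma smooth_periodize f : schwartz f -> smooth (periodize f).
Proof.
move=> sf; apply: (@smooth_coind _ _ (fun k => exists2 f, schwartz f & k = periodize f)); last by exists f.
move=> _ [{}f {}sf ->]; split.
- exact: continuous_periodize.
- by move=> x u; have dd := is_derive_periodize x u sf; exact: ex_derive.
- by move=> u; exists ('D_u f); [exact: schwartz_D|exact: derive_periodize].
Qed.

Lemma floor_rVD (y : V) (m : 'rV[int]_n) :
  floor_rV (y + map_mx intr m) = floor_rV y + map_mx intr m.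
Proof.
by apply/rowP => i; rewrite !mxE floorDrz ?intr_int// intrKfloor intrD.
Qed.

(** A lattice vector is absorbed by translating [y] by an integer vector, which commutes with taking
    integer parts. *)
Lemma periodize_periodic f x g : continuous f -> lattice A g -> periodize f (x + g) = periodize f x.
Proof.
move=> cf [m _ <-]; rewrite /periodize.
rewrite -(@integral_Rn_shift _ _ (fun y => f (x + floor_rV y *m A)) (map_mx intr m)); last first.
  exact: measurable_periodize.
apply: eq_Rintegral => y _; rewrite floor_rVD mulmxDl.
by rewrite -addrA [X in x + X]addrC.
Qed.

End periodization.

Lemma ler_addr1_mul1 (R : realType) (a b : R) : 0 <= a -> 0 <= b -> b <= (a + 1) * (1 + b).
Proof. nra. Qed.

Lemma ler_mul_addr1 (R : realType) (a b : R) : 0 <= a -> 0 <= b ->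
  a * (1 + b) <= (a + 1) * (1 + b).
Proof. nra. Qed.

(** * Unfolding integrals over the torus to R^n *)

Section unfold.
Variables (R : realType) (n : nat).
Local Notation V := 'rV[R]_n.
Local Notation T n := (n.-tuple (measurableTypeR R)).
Local Notation leb n := (lebesgue_tuple R n).
Implicit Types (f w : V -> R).
Variable A : 'M[R]_n.
Hypothesis uA : A \in unitmx.

(* A product of indicators, so that its integrals over R^n factor. *)
Definition cell (x : V) : R := \prod_(i < n) (Num.floor ((x *m invmx A) 0 i) == 0)%:R.

Lemma prodr_natr_bool (b : 'I_n -> bool) : \prod_i (b i)%:R = [forall i, b i]%:R :> R.
Proof.
case: (boolP [forall i, b i]) => [/forallP h|].
  by rewrite big1// => i _; rewrite h.
rewrite negb_forall => /existsP[i /negbTE bi].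
by rewrite (bigD1 i)//= bi mul0r.
Qed.

Lemma cellE x : cell x = (x \in fundamental_domain A)%:R.
Proof.
rewrite /cell prodr_natr_bool; congr (nat_of_bool _)%:R; apply/forallP/idP => [h|].
  rewrite inE; exists (x *m invmx A); last by rewrite mulmxKV.
  by move=> i; have := h i; rewrite floor_eq add0r.
rewrite inE => -[y y01 <-] i; rewrite mulmxK// floor_eq add0r.
exact: y01.
Qed.

(** Every point has exactly one lattice translate in the fundamental domain: the translation is
    fixed by the integer part of [x *m invmx A]. *)
Lemma cell_shift x y :
  cell (x - floor_rV y *m A) =
  \prod_(i < n) (Num.floor (y 0 i) == Num.floor ((x *m invmx A) 0 i))%:R.
Proof.
apply: eq_bigr => i _; congr (nat_of_bool _)%:R.
have -> : ((x - floor_rV y *m A) *m invmx A) 0 i =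
    (x *m invmx A) 0 i + (- Num.floor (y 0 i))%:~R.
  by rewrite mulmxBl mulmxK// [LHS]mxE; congr (_ + _); rewrite !mxE intrN.
by rewrite floorDrz ?intr_int// intrKfloor subr_eq0 eq_sym.
Qed.

Lemma cell_ge0 x : 0 <= cell x.
Proof. by rewrite cellE. Qed.

Lemma cell_le_weight : exists2 C : R, 0 <= C & forall x, cell x <= C / weight x.
Proof.
pose a := \sum_i \sum_j `|A i j|.
have a0 : 0 <= a by rewrite sumr_ge0// => i _; rewrite sumr_ge0.
exists ((1 + a) ^+ (n * 2)) => [|x]; first by rewrite exprn_ge0// addr_ge0.
rewrite ler_pdivlMr ?weight_gt0// cellE.
have [|_] := boolP (x \in _); last by rewrite mul0r exprn_ge0// addr_ge0.
rewrite inE => -[y y01 <-]; rewrite mul1r.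
have := @weight_le R n a 0 (y *m A) a0 (lexx 0); rewrite addr0 !mulr1; apply => i.
rewrite mxE (le_trans (ler_norm_sum _ _ _))//; apply: ler_sum => j _.
have /andP[y0 y1] := y01 j.
rewrite normrM ger0_norm// (bigD1 i)//=.
apply: (@le_trans _ _ `|A j i|); last by rewrite lerDl sumr_ge0.
by rewrite -[leRHS]mul1r ler_wpM2r// ltW.
Qed.

Lemma measurable_cell : measR cell.
Proof.
apply: measurable_prod => i _.
rewrite (_ : (fun _ => _) = \1_(`[0, 1[%classic : set R) \o
    (fun y : T n => (rV_of_tuple y *m invmx A) 0 i)); last first.
  apply/funext => y /=; rewrite indicE; congr (nat_of_bool _)%:R.
  by rewrite floor_eq add0r; apply/idP/idP; rewrite inE/= in_itv.
apply: measurableT_comp; first exact: measurable_indic.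
rewrite (_ : (fun _ => _) =
    (fun y : T n => \sum_j tnth y j * invmx A j i)); last first.
  by apply/funext => y; rewrite mxE; apply: eq_bigr => j _; rewrite mxE.
apply: measurable_sum => j; apply: measurable_funM; last exact: measurable_cst.
exact: measurable_tnth.
Qed.

Lemma integral_cell_shift x :
  integral_Rn (fun y => cell (x - floor_rV y *m A)) = 1.
Proof.
rewrite /integral_Rn /Rintegral.
under eq_integral do rewrite cell_shift.
by rewrite (integral_cell (x *m invmx A)).
Qed.

Lemma floor_lattice y : lattice A (floor_rV y *m A).
Proof.
exists (map_mx Num.floor y) => //; congr (_ *m A).
by apply/rowP => i; rewrite !mxE.
Qed.

(** Fubini puts the sum over translates outside. For each [y], translating [x] by the lattice vector
    moves the cell instead of [f], while periodicity leaves [w] unchanged. After Fubini in the other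
    direction the moved cells add up to 1. The two exchanges concern different integrands and need
    separate domination. *)
Lemma unfold_periodize w f (M : R) : measR w -> (forall x, `|w x| <= M) ->
  (forall x g, lattice A g -> w (x + g) = w x) -> schwartz f ->
  integral_Rn (fun x => cell x * (w x * periodize A f x)) =
  integral_Rn (fun x => w x * f x).
Proof.
move=> mw wM pw sf.
have M0 : 0 <= M by apply: le_trans (wM 0).
have mf : measR f by apply: measurable_fun_rV; exact: schwartz_cont.
have mwf : measR (fun x => w x * f x) by exact: measurable_funM.
pose H (z : T n * T n) := cell (rV_of_tuple z.1) *
  (w (rV_of_tuple z.1) * f (rV_of_tuple z.1 + floor_rV (rV_of_tuple z.2) *m A)).
have mH : measurable_fun setT H.
  apply: measurable_funM.
    exact: measurableT_comp measurable_cell measurable_fst.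
  apply: measurable_funM; last exact: measurable_floor_rV.
  exact: measurableT_comp mw measurable_fst.
have [C C0 HC] := cell_le_weight.
pose r := \sum_i \sum_j `|A i j|.
have r0 : 0 <= r by rewrite sumr_ge0// => i _; rewrite sumr_ge0.
have cell_r x i : cell x != 0 -> `|x 0 i| <= r.
  rewrite cellE; case: (boolP (x \in _)) => [|_]; last by rewrite eqxx.
  rewrite inE => -[y y01 <-] _.
  rewrite mxE (le_trans (ler_norm_sum _ _ _))//; apply: ler_sum => j _.
  have /andP[y0 y1] := y01 j.
  rewrite normrM ger0_norm// (bigD1 i)//=.
  apply: (@le_trans _ _ `|A j i|); last by rewrite lerDl sumr_ge0.
  by rewrite -[leRHS]mul1r ler_wpM2r// ltW.
have [C' C'0 HC'] := periodize_dom uA (schwartz_decays sf) r0.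
have Hdom (x y : T n) : `|H (x, y)| <=
    (C * M) / weight (rV_of_tuple x) * (C' / weight (rV_of_tuple y)).
  rewrite /H /=; have [->|cx] := eqVneq (cell (rV_of_tuple x)) 0.
    by rewrite mul0r normr0 !mulr_ge0 ?invr_ge0 ?(ltW (weight_gt0 _)).
  rewrite !normrM mulrA ler_pM ?mulr_ge0//; last by apply: HC' => i; exact: cell_r.
  rewrite mulrAC ler_pM//.
  by rewrite ger0_norm ?cell_ge0.
have ge0w (c : R) (x : T n) : 0 <= c -> 0 <= c / weight (rV_of_tuple x).
  by move=> c0; rewrite divr_ge0// ltW// weight_gt0.
have := dominated_fubini mH (integrable_weight_cst n (C * M)) (integrable_weight_cst n C')
  (fun x => ge0w _ x (mulr_ge0 C0 M0)) (fun y => ge0w _ y C'0) Hdom.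
rewrite /H /= => E1.
(* The integrand after the translation; writing it with [- A] lets the facts on [floor_rV] be
   reused. *)
pose H2 (z : T n * T n) :=
  cell (rV_of_tuple z.1 + floor_rV (rV_of_tuple z.2) *m (- A)) *
  (w (rV_of_tuple z.1) * f (rV_of_tuple z.1)).
have mH2 : measurable_fun setT H2.
  apply: measurable_funM.
    by apply: measurable_floor_rV; exact: measurable_cell.
  exact: measurableT_comp mwf measurable_fst.
have [K K0 HK] := floor_rV_bound uA r0.
have [C2 C20 HC2] : exists2 C2 : R, 0 <= C2 & forall x y : V,
    cell (x + floor_rV y *m (- A)) != 0 -> `|f x| <= C2 / (weight x * weight y).
  (* Here [f] no longer involves [y], but where the moved cell is nonzero [y] grows at most linearly
     in [x], so the decay of [f] in [x] pays for both weights. The constant [K + 1] covers [y]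
     through [K] and [x] itself through 1. *)
  have [C2 C20 HC2] := decays_weight_mul (schwartz_decays sf) (addr_ge0 K0 ler01).
  exists C2; first exact: C20.
  move=> x y cxy; apply: HC2 => i.
    have e0 := enorm_ge0 x.
    apply: (le_trans (coord_le_enorm x i)).
    exact: ler_addr1_mul1.
  have := HK (x + floor_rV y *m (- A)) y (fun i => cell_r _ i cxy) i.
  rewrite mulmxN subrK => h; apply: (le_trans h).
  have e0 := enorm_ge0 x.
  exact: ler_mul_addr1.
have Hdom2 (x y : T n) : `|H2 (x, y)| <=
    (M * C2) / weight (rV_of_tuple x) * (1 / weight (rV_of_tuple y)).
  rewrite /H2 /=; set cc := cell _; have [->|cx] := eqVneq cc 0.
    by rewrite mul0r normr0 !mulr_ge0 ?invr_ge0 ?(ltW (weight_gt0 _)).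
  have cc1 : `|cc| <= 1 by rewrite /cc cellE; case: (_ \in _); rewrite ?normr1 ?normr0.
  have E : M * C2 / weight (rV_of_tuple x) * (1 / weight (rV_of_tuple y)) =
      1 * (M * (C2 / (weight (rV_of_tuple x) * weight (rV_of_tuple y)))).
    by rewrite invfM; move: (_^-1) (_^-1) => p q; ring.
  rewrite E 2!normrM; apply: ler_pM; [exact: normr_ge0|exact: mulr_ge0|exact: cc1|].
  by apply: ler_pM; [exact: normr_ge0|exact: normr_ge0|exact: wM|exact: (HC2 _ _ cx)].
have := dominated_fubini mH2 (integrable_weight_cst n (M * C2)) (integrable_weight_cst n 1)
  (fun x => ge0w _ x (mulr_ge0 M0 C20)) (fun y => ge0w _ y ler01) Hdom2.
rewrite /H2 /= => E2.
transitivity (\int[leb n]_x \int[leb n]_y (cell (rV_of_tuple x) *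
  (w (rV_of_tuple x) * f (rV_of_tuple x + floor_rV (rV_of_tuple y) *m A)))).
  apply: eq_Rintegral => x _; rewrite /periodize /integral_Rn mulrA.
  rewrite -(RintegralZl _ measurableT (integrable_periodize uA (rV_of_tuple x) sf)).
  by apply: eq_Rintegral => y _; rewrite mulrA.
rewrite E1.
transitivity (\int[leb n]_y \int[leb n]_x
  (cell (rV_of_tuple x + floor_rV (rV_of_tuple y) *m (- A)) *
  (w (rV_of_tuple x) * f (rV_of_tuple x)))).
  apply: eq_Rintegral => y _.
  pose k x := cell (x + floor_rV (rV_of_tuple y) *m (- A)) * (w x * f x).
  have mk : measR k.
    apply: measurable_funM; last exact: mwf.
    have := measR_aff 1 (floor_rV (rV_of_tuple y) *m - A) measurable_cell.
    by rewrite /measR; under eq_fun do rewrite scale1r.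
  rewrite -[RHS](integral_Rn_shift (floor_rV (rV_of_tuple y) *m A) mk).
  apply: eq_Rintegral => x _; rewrite /k mulmxN addrK pw; first by [].
  exact: floor_lattice.
rewrite -E2; apply: eq_Rintegral => x _.
have ci : (leb n).-integrable setT (EFin \o
    (fun y => cell (rV_of_tuple x + floor_rV (rV_of_tuple y) *m (- A)))).
  apply/integrableP; split.
    apply/measurable_EFinP.
    exact: measurableT_comp (measurable_floor_rV (-A) measurable_cell) (measurable_pair1 x).
  rewrite (eq_integral (fun y => (\prod_(i < n) (Num.floor (rV_of_tuple y 0 i) ==
      Num.floor ((rV_of_tuple x *m invmx A) 0 i))%:R)%:E)).
    by rewrite (integral_cell (rV_of_tuple x *m invmx A)) ltry.
  move=> y _; rewrite /= ger0_norm; last exact: cell_ge0.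
  by rewrite mulmxN cell_shift.
rewrite (RintegralZr _ measurableT ci).
apply: etrans (mul1r _); apply: (congr1 (fun z => z * _)).
apply: etrans (integral_cell_shift (rV_of_tuple x)).
by apply: eq_Rintegral => y _; rewrite mulmxN.
Qed.

End unfold.

(** * Weak derivatives on the line *)

Section bumpR.
Variable R : realType.

Lemma is_derive1_dir (f : R -> R) (x u d : R) : is_derive x 1 f d ->
  is_derive x u f (u * d).
Proof.
move=> df; have dd : derivable f x 1 by exact: ex_derive.
have dff : differentiable f x by apply/derivable1_diffP.
apply: DeriveDef; first exact: diff_derivable.
rewrite deriveE// diff1E//= derive1E; congr (_ * _).
exact: (@derive_val _ _ _ _ _ _ _ df).
Qed.

Lemma smooth_coind1 (P : (R -> R) -> Prop) :
  (forall f, P f -> exists d : R -> R, [/\ forall x : R, is_derive x 1 f (d x)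
    & forall c : R, P (fun x => c * d x)]) ->
  forall f, P f -> smooth (V := R^o) f.
Proof.
move=> PP; apply: (@smooth_coind R R^o) => f /PP[d [df Pd]].
have dfu (z u : R) : is_derive (z : R^o) u f (u * d z) by exact: is_derive1_dir.
split.
- move=> z; apply/differentiable_continuous/derivable1_diffP.
  by have dd := df z; exact: ex_derive.
- by move=> z u; have dd := dfu z u; exact: ex_derive.
- move=> u; rewrite (_ : 'D_u f = fun x => u * d x); first exact: Pd.
  by apply/funext => z; exact: (@derive_val _ _ _ _ _ _ _ (dfu z u)).
Qed.

(* These functions and their multiples span a space closed under differentiation. *)
Definition flat (m : nat) (t : R) : R :=
  if 0 < t then t^-1 ^+ m * expR (- t^-1) else 0.

Lemma flat_ge0 m t : 0 <= flat m t.
Proof.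
rewrite /flat; case: ltP => // t0.
by rewrite mulr_ge0 ?expR_ge0// exprn_ge0// invr_ge0 ltW.
Qed.

(** The term of order [m + 2] in the exponential series at [t^-1] bounds the exponential from below.
    Quadratic vanishing at 0 is what makes the derivative there equal to 0. *)
Lemma flat_le m t : flat m t <= (m.+2)`!%:R * t ^+ 2.
Proof.
rewrite /flat; case: ltP => [t0|_]; last by rewrite mulr_ge0// sqr_ge0.
have s0 : 0 < t^-1 by rewrite invr_gt0.
have := @expR_ge1Dxn R t^-1 m.+1 (ltW s0) => h.
have f0 : 0 < (m.+2)`!%:R :> R by rewrite ltr0n fact_gt0.
have {}h : t^-1 ^+ m.+2 <= (m.+2)`!%:R * expR t^-1.
  rewrite mulrC -ler_pdivrMr//; apply: le_trans h.
  by rewrite lerDr.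
have -> : t^-1 ^+ m = t^-1 ^+ m.+2 * t ^+ 2.
  by rewrite -addn2 exprD -mulrA -exprMn mulVf ?gt_eqF// expr1n mulr1.
by rewrite mulrAC ler_wpM2r ?sqr_ge0// expRN ler_pdivrMr ?expR_gt0.
Qed.

Lemma is_derive_flat m (t : R) :
  is_derive t 1 (flat m) (flat m.+2 t - m%:R * flat m.+1 t).
Proof.
have [t0|t0|->] := ltgtP t 0.
- have E : \near t, cst 0 t = flat m t.
    near=> s; rewrite /flat ifF//; apply/negbTE; rewrite -leNgt ltW//.
    by near: s; exact: lt_nbhsl.
  have -> : flat m.+2 t - m%:R * flat m.+1 t = 0.
    by rewrite /flat ltNge (ltW t0)/= mulr0 subrr.
  apply: near_eq_is_derive E _; exact: is_derive_cst.
- have E : \near t, t^-1 ^+ m * expR (- t^-1) = flat m t.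
    near=> s; rewrite /flat ifT//.
    by near: s; exact: lt_nbhsr.
  apply: near_eq_is_derive E _.
  have tn0 : t != 0 by rewrite gt_eqF.
  have d1 : is_derive t 1 (fun s : R => s^-1) (- t ^- 2).
    have := @is_deriveV R id t 1 1 tn0 (is_derive_id _ _).
    by rewrite [_ *: 1]mulr1.
  have d2 : is_derive t 1 (fun s : R => s^-1 ^+ m) (m%:R * t^-1 ^+ m.-1 * - t ^- 2).
    rewrite (_ : (fun _ => _) = (fun s : R => s^-1) ^+ m); first exact: is_deriveX d1.
    by apply/funext => s; rewrite fctE.
  have d3 : is_derive t 1 (fun s : R => expR (- s^-1)) (expR (- t^-1) * t ^- 2).
    have d3 : is_derive t 1 (fun s : R => - s^-1) (t ^- 2).
      by have := is_deriveN d1; rewrite opprK.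
    exact: (@is_derive1_comp _ expR (fun s : R => - s^-1) t _ _ (is_derive_expR (- t^-1)) d3).
  have d4 : is_derive t 1 (fun s : R => s^-1 ^+ m * expR (- s^-1))
      (t^-1 ^+ m * (expR (- t^-1) * t ^- 2) + expR (- t^-1) * (m%:R * t^-1 ^+ m.-1 * - t ^- 2)).
    exact: is_deriveM d2 d3.
  apply: (is_derive_eq d4).
  rewrite /flat t0 -exprVn.
  case: m {d2 d4} => [|m]; first by rewrite !mul0r; ring.
  by rewrite succnK !exprS; ring.
- have z : flat m.+2 0 - m%:R * flat m.+1 0 = 0 by rewrite /flat ltxx mulr0 subrr.
  rewrite z.
  have lim : (fun h : R => h^-1 *: ((flat m \o shift 0) (h *: 1) - flat m 0)) @ 0^' --> (0 : R).
    apply/cvgrPdist_lt => e e0.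
    have f0 : 0 < (m.+2)`!%:R :> R by rewrite ltr0n fact_gt0.
    near=> h.
    have h0 : h != 0 by near: h; exact: nbhs_dnbhs_neq.
    rewrite sub0r normrN /= [h *: 1]mulr1 addr0 {2}/flat ltxx subr0 normrM normfV.
    rewrite ger0_norm ?flat_ge0// mulrC ltr_pdivrMr ?normr_gt0//.
    apply: le_lt_trans (flat_le m h) _.
    rewrite -[h ^+ 2]real_normK ?num_real// expr2 mulrA ltr_pM2r ?normr_gt0//.
    rewrite -ltr_pdivlMl//.
    near: h; apply: dnbhs0_lt; by rewrite mulr_gt0// invr_gt0.
  by apply: DeriveDef; [apply/cvg_ex; exists 0|exact/cvg_lim].
Unshelve. all: by end_near. Qed.

Inductive flats : (R -> R) -> Prop :=
| Flat c m : flats (fun x => c * flat m x)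
| Flats_add f g : flats f -> flats g -> flats (fun x => f x + g x).

Lemma flats_scale c f : flats f -> flats (fun x => c * f x).
Proof.
elim => [b m|{}f g _ ff _ gg].
  rewrite (_ : (fun _ => _) = fun x => (c * b) * flat m x); first exact: Flat.
  by apply/funext => x; rewrite mulrA.
rewrite (_ : (fun _ => _) = fun x => c * f x + c * g x); first exact: Flats_add.
by apply/funext => x; rewrite mulrDr.
Qed.

Lemma smooth_flat m : smooth (V := R^o) (flat m).
Proof.
apply: (@smooth_coind1 flats); last first.
  rewrite (_ : flat m = fun x => 1 * flat m x); first exact: Flat.
  by apply/funext => x; rewrite mul1r.
move=> f; elim => [c k|{}f g _ [d [df Pd]] _ [d' [dg Pd']]].
- exists (fun x => c * flat k.+2 x + (- c * k%:R) * flat k.+1 x); split.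
    move=> x; have dc : is_derive x 1 (fun x : R => c * flat k x)
        (c * (flat k.+2 x - k%:R * flat k.+1 x) + flat k x * 0).
      exact: (is_deriveM (is_derive_cst c x 1) (is_derive_flat k x)).
    by apply: (is_derive_eq dc); ring.
  by move=> b; apply: flats_scale; apply: Flats_add; exact: Flat.
- exists (fun x => d x + d' x); split.
    by move=> x; exact: (is_deriveD (df x) (dg x)).
  move=> c; rewrite (_ : (fun _ => _) = fun x => c * d x + c * d' x); first exact: Flats_add.
  by apply/funext => x; rewrite mulrDr.
Qed.

(** A mollifier supported in [-r, r]. It is not normalised: its mass is carried along as the
    constant [N] of [bumpR_mass]. *)
Definition bumpR (r x : R) : R := flat 0 (r + x) * flat 0 (r - x).

Lemma smooth_bumpR r : smooth (V := R^o) (bumpR r).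
Proof.
apply: smooth_mul.
  apply: (@smooth_affine R R^o R^o (flat 0) (fun x => r + x) id) => //; last exact: smooth_flat.
    by move=> h u z; rewrite addrCA.
  by move=> x; apply: continuousD; [exact: cst_continuous|exact: cvg_id].
apply: (@smooth_affine R R^o R^o (flat 0) (fun x => r - x) -%R) => //; last exact: smooth_flat.
  by move=> h u z; rewrite opprD scalerN addrCA.
by move=> x; apply: continuousB; [exact: cst_continuous|exact: cvg_id].
Qed.

Lemma bumpR_ge0 r x : 0 <= bumpR r x.
Proof. by rewrite mulr_ge0// flat_ge0. Qed.

Lemma bumpR_out r x : r <= `|x| -> bumpR r x = 0.
Proof.
rewrite ler_normr /bumpR /flat => /orP[h|h].
  by rewrite [0 < r - x]ltNge subr_le0 h/= mulr0.
by rewrite [0 < r + x]ltNge -[x]opprK subr_le0 h/= mul0r.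
Qed.

Lemma bumpR_lower_bound r x : 0 < r -> `|x| <= r / 2 -> expR (- (r / 2)^-1) ^+ 2 <= bumpR r x.
Proof.
move=> r0; rewrite ler_norml => /andP[h1 h2].
have r20 : 0 < r / 2 by rewrite divr_gt0.
have lb t : r / 2 <= t -> expR (- (r / 2)^-1) <= flat 0 t.
  move=> rt; have t0 : 0 < t by apply: lt_le_trans rt.
  by rewrite /flat t0 expr0 mul1r ler_expR lerN2 lef_pV2.
by rewrite expr2 /bumpR ler_pM ?expR_ge0 ?lb//; lra.
Qed.

End bumpR.

Section weak_derivative.
Variable R : realType.
Local Notation leb1 := (@lebesgue_measure R).

Lemma continuous_bumpR (r : R) : continuous (bumpR r).
Proof. exact: (smooth_cont (smooth_bumpR r)). Qed.

Lemma measurable_bumpR_shift (r s : R) (D : set (measurableTypeR R)) :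
  measurable_fun D (fun t : measurableTypeR R => bumpR r (t - s)).
Proof.
apply: measurable_funTS; apply: continuous_measurable_fun => t.
apply: (@continuous_comp _ _ _ (fun t : R => t - s) (bumpR r)); last exact: continuous_bumpR.
by apply: continuousB; [exact: cvg_id|exact: cst_continuous].
Qed.

(** The mass does not depend on the centre by translation invariance. It is positive because of the
    lower bound on an interval of length [r], and finite because the bump is bounded with bounded
    support. *)
Lemma bumpR_mass (r : R) : 0 < r ->
  exists2 N : R, 0 < N & forall s : R, (\int[leb1]_t (bumpR r (t - s))%:E)%E = N%:E.
Proof.
move=> r0.
have bm : measurable_fun setT (fun x : measurableTypeR R => (bumpR r x)%:E).
  by apply/measurable_EFinP; apply: continuous_measurable_fun; exact: continuous_bumpR.
have E s : (\int[leb1]_t (bumpR r (t - s))%:E)%E = (\int[leb1]_t (bumpR r t)%:E)%E.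
  rewrite -[RHS](@ge0_integral_affR R 1 (- s))//; last by move=> x; rewrite lee_fin bumpR_ge0.
  by rewrite mul1e; apply: eq_integral => t _; rewrite /affR mul1r.
have mI (a b : R) : measurable (`[a, b]%classic : set (measurableTypeR R)) by [].
have mE (a b : R) : a <= b -> leb1 `[a, b]%classic = (b - a)%:E.
  move=> ab; apply: (etrans (lebesgue_measure_itv _)); rewrite /= lte_fin.
  by case: ltgtP ab => // -> _; rewrite subrr.
pose D1 : set (measurableTypeR R) := `[(- (r / 2)), (r / 2)]%classic.
pose D2 : set (measurableTypeR R) := `[(- r), r]%classic.
have mmD1 : measurable D1 by exact: mI.
have mmD2 : measurable D2 by exact: mI.
have mD1 : leb1 D1 = (r / 2 - - (r / 2))%:E by apply: mE; lra.
have mD2 : leb1 D2 = (r - - r)%:E by apply: mE; lra.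
have cst_int (D : set (measurableTypeR R)) (k l : R) : measurable D -> leb1 D = l%:E ->
    (\int[leb1]_(t in D) (cst k%:E) t = k%:E * l%:E)%E.
  by move=> mD E'; apply: etrans (integral_cst leb1 mD _) _; apply: (congr1 (fun z => k%:E * z)%E).
pose c := expR (- (r / 2)^-1) ^+ 2.
have c0 : 0 < c by rewrite exprn_gt0// expR_gt0.
have lb : ((c * r)%:E <= \int[leb1]_t (bumpR r t)%:E)%E.
  apply: (@le_trans _ _ (\int[leb1]_(t in D1) (bumpR r t)%:E)%E); last first.
    apply: ge0_subset_integral; [exact: mmD1|exact: measurableT|exact: bm| |exact: subsetT].
    by move=> t _; rewrite lee_fin bumpR_ge0.
  apply: (@le_trans _ _ (\int[leb1]_(t in D1) (cst c%:E) t)%E).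
    rewrite (cst_int _ _ _ mmD1 mD1).
    by rewrite -EFinM lee_fin; rewrite opprK -splitr.
  apply: ge0_le_integral => //.
  - by move=> t _; rewrite lee_fin ltW.
  - exact: measurable_funTS.
  - move=> t; rewrite /D1 /= in_itv/= => ht; rewrite lee_fin; apply: bumpR_lower_bound => //.
    by rewrite ler_norml.
have [K K0 bK] : exists2 K : R, 0 <= K & forall x, bumpR r x <= K.
  have rr : - r <= r by lra.
  have cb : {within `[- r, r], continuous (bumpR r)}.
    by apply: continuous_subspaceT; exact: continuous_bumpR.
  have [m _ mK] := EVT_max rr cb.
  exists (bumpR r m) => [|x]; first exact: bumpR_ge0.
  have [xr|rx] := lerP `|x| r; first by apply: mK; rewrite in_itv/= -ler_norml.
  by rewrite bumpR_out ?bumpR_ge0// ltW.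
have ub : (\int[leb1]_t (bumpR r t)%:E < +oo)%E.
  have -> : (\int[leb1]_t (bumpR r t)%:E = \int[leb1]_(t in D2) (bumpR r t)%:E)%E.
    rewrite [RHS]integral_mkcond; apply: eq_integral => t _; rewrite patchE.
    case: ifPn => //; rewrite notin_setE /D2 /= in_itv/= => /negP h.
    rewrite bumpR_out// leNgt; apply/negP => /ltW; rewrite ler_norml => h2.
    by rewrite h2 in h.
  apply: (@le_lt_trans _ _ (\int[leb1]_(t in D2) (cst K%:E) t)%E).
    apply: ge0_le_integral => //.
      - by move=> t _; rewrite lee_fin bumpR_ge0.
    - exact: measurable_funTS.
    - by move=> t _; rewrite lee_fin.
  rewrite (cst_int _ _ _ mmD2 mD2).
  by rewrite -EFinM ltry.
exists (fine (\int[leb1]_t (bumpR r t)%:E)%E).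
  rewrite -lte_fin fineK; last by rewrite ge0_fin_numE// integral_ge0// => t _; rewrite lee_fin bumpR_ge0.
  by apply: lt_le_trans lb; rewrite lte_fin mulr_gt0.
move=> s; rewrite E fineK// ge0_fin_numE// integral_ge0// => t _.
by rewrite lee_fin bumpR_ge0.
Qed.

Lemma bounded_integrable_itv (u v M : R) (g : R -> R) :
  measurable_fun (`]u, v[%classic : set (measurableTypeR R)) g ->
  (forall t, `]u, v[%classic t -> `|g t| <= M) ->
  leb1.-integrable `]u, v[%classic (EFin \o g).
Proof.
move=> mg gM.
have mI : measurable (`]u, v[%classic : set (measurableTypeR R)) by [].
have ic : leb1.-integrable (`]u, v[%classic : set (measurableTypeR R)) (EFin \o cst M).
  apply: (@integrableS _ _ _ leb1 (`[u, v]%classic : set (measurableTypeR R))) => //.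
    by apply: subset_itv; rewrite bnd_simp.
  apply: continuous_compact_integrable; first exact: segment_compact.
  by apply: continuous_subspaceT; exact: cst_continuous.
apply: le_integrable ic => //; first exact/measurable_EFinP.
by move=> t It; rewrite /= lee_fin (le_trans (gM t It))// ler_norm.
Qed.

Lemma deriv_bumpR_bounded (r : R) : exists2 M : R, 0 <= M &
  forall x, `|'D_(1 : R^o) (bumpR r : R^o -> R) x| <= M.
Proof.
pose d := 'D_(1 : R^o) (bumpR r : R^o -> R).
have sd : smooth (V := R^o) d by apply: smooth_D; exact: smooth_bumpR.
have cd : continuous (fun x : R => `|d x|).
  by move=> x; apply: (@continuous_comp _ _ _ d); [exact: (smooth_cont sd)|exact: norm_continuous].
have [r0|r0] := ltP r 0.
  exists 0 => // x; rewrite (_ : (bumpR r : R^o -> R) = cst 0).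
    by rewrite derive_cst normr0.
  by apply/funext => y; rewrite bumpR_out// (le_trans (ltW r0)).
have rr : - r <= r by lra.
have [m _ mK] := EVT_max rr (continuous_subspaceT cd).
exists `|d m|; first exact: normr_ge0.
move=> x.
have [xr|rx] := lerP `|x| r; first by apply: mK; rewrite in_itv/= -ler_norml.
suff -> : 'D_(1 : R^o) (bumpR r : R^o -> R) x = 0 by rewrite normr0.
rewrite -(@derive_cst R R^o R 0 x 1); apply: near_eq_derive.
have /cvgr_gt/(_ r rx) : `|y| @[y --> x] --> `|x| by exact: norm_continuous.
by apply: filterS => y ry; rewrite bumpR_out// ltW.
Qed.

Section average.
Variables (t0 q : R).
Hypothesis q0 : 0 < q.
(** Bumps of radius at most [q] centred within [q] of [t0] live within [2 * q] of [t0]; the radius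
    [3 * q] leaves a margin. *)
Let J := `](t0 - 3 * q), (t0 + 3 * q)[%classic : set (measurableTypeR R).
Variables (g : R -> R) (M : R).
Hypotheses (mg : measurable_fun J g) (gM : forall t, J t -> `|g t| <= M).

Lemma mem_ball3 t : `|t - t0| < 3 * q -> J t.
Proof. by rewrite ltr_norml /J/= in_itv/= => /andP[h1 h2]; apply/andP; split; lra. Qed.

Lemma integrable_bumpR_mul (r s : R) : 0 < r ->
  leb1.-integrable J (EFin \o (fun t => bumpR r (t - s) * g t)).
Proof.
move=> r0.
have [K bK] : exists K : R, forall x, bumpR r x <= K.
  have rr : - r <= r by lra.
  have [m _ mK] := EVT_max rr (continuous_subspaceT (@continuous_bumpR r)).
  exists (bumpR r m) => x.
  have [xr|rx] := lerP `|x| r; first by apply: mK; rewrite in_itv/= -ler_norml.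
  by rewrite bumpR_out ?bumpR_ge0// ltW.
apply: (@bounded_integrable_itv _ _ (K * M)).
  by apply: measurable_funM => //; exact: measurable_bumpR_shift.
by move=> t Jt; rewrite normrM ler_pM// ?gM// ger0_norm ?bumpR_ge0.
Qed.

(** The bump puts total weight [N] on values of [g] that differ from [c] by at most [w], and its
    support lies inside [J]. *)
Lemma average_approx (r s c w N : R) : 0 < r -> r <= q -> `|s - t0| < q ->
  (\int[leb1]_t (bumpR r (t - s))%:E)%E = N%:E ->
  (forall t, `|t - s| < r -> `|g t - c| <= w) ->
  `|\int[leb1]_(t in J) (bumpR r (t - s) * g t) - N * c| <= N * w.
Proof.
move=> r0 rq sq NE gc.
have out t : ~ J t -> bumpR r (t - s) = 0.
  move=> nJ; apply: bumpR_out; rewrite leNgt; apply/negP => tr; apply: nJ.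
  apply: mem_ball3; apply: (le_lt_trans (ler_distD s _ _)).
  have h3 : 3 * q = q + q + q by ring.
  by rewrite h3 ltrD// ?(lt_le_trans tr rq)//; move: (lt_le_trans tr rq) sq q0; lra.
have mJ : measurable J by exact: measurable_itv.
have ib : leb1.-integrable J (EFin \o (fun t => bumpR r (t - s))).
  have iT : leb1.-integrable setT (EFin \o (fun t : measurableTypeR R => bumpR r (t - s))).
    apply/integrableP; split; first by apply/measurable_EFinP; exact: measurable_bumpR_shift.
    apply: (@le_lt_trans _ _ (\int[leb1]_t (bumpR r (t - s))%:E)%E); last by rewrite NE ltry.
    rewrite le_eqVlt; apply/orP; left; apply/eqP; apply: eq_integral => t _.
    by rewrite /= ger0_norm// bumpR_ge0.
  exact: integrableS iT.
have NJ : \int[leb1]_(t in J) bumpR r (t - s) = N.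
  rewrite -[RHS]/(fine N%:E) -NE /Rintegral integral_mkcond; apply: (congr1 fine).
  apply: eq_integral => t _; rewrite patchE; case: ifPn => // h.
  by rewrite out//; move: h; rewrite notin_setE.
have ibc : leb1.-integrable J (EFin \o (fun t => bumpR r (t - s) * c)).
  have := integrableZl mJ c ib; apply: eq_integrable => // t _.
  by rewrite /= mulrC EFinM.
have ibw : leb1.-integrable J (EFin \o (fun t => bumpR r (t - s) * w)).
  have := integrableZl mJ w ib; apply: eq_integrable => // t _.
  by rewrite /= mulrC EFinM.
have ig := integrable_bumpR_mul s r0.
rewrite -NJ -!(RintegralZr _ mJ ib) -(RintegralB mJ ig ibc).
have iB : leb1.-integrable J (EFin \o (fun t => bumpR r (t - s) * g t - bumpR r (t - s) * c)).
  have := integrableB mJ ig ibc; apply: eq_integrable => // t _.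
apply: (le_trans (le_normr_Rintegral mJ iB)).
apply: (le_Rintegral mJ _ ibw).
  by have := integrable_abse iB; apply: eq_integrable.
move=> t Jt; rewrite -mulrBr normrM ger0_norm; last exact: bumpR_ge0.
have [tr|tr] := ltrP `|t - s| r; first by apply: ler_wpM2l; [exact: bumpR_ge0|exact: gc].
by rewrite (bumpR_out tr) !mul0r.
Qed.

End average.
End weak_derivative.

Section weak_derive.
Variable R : realType.
Local Notation leb1 := (@lebesgue_measure R).
Local Notation D1 f := ('D_(1 : R^o) (f : R^o -> R)).

Lemma Rintegral_support (I J : set (measurableTypeR R)) (f : R -> R) : J `<=` I ->
  (forall t, ~ J t -> f t = 0) -> \int[leb1]_(t in I) f t = \int[leb1]_(t in J) f t.
Proof.
move=> JI f0; rewrite Rintegral_mkcond [RHS]Rintegral_mkcond.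
apply: eq_Rintegral => t _; rewrite !patchE.
case: ifPn => tI; case: ifPn => tJ //.
  by rewrite f0//; move: tJ; rewrite notin_setE.
by move: tI; rewrite notin_setE => nI; case: nI; apply: JI; rewrite inE in tJ.
Qed.

Lemma is_derive_bump_shift (r s t : R) :
  is_derive (t : R^o) 1 (fun t : R => bumpR r (t - s)) (D1 (bumpR r) (t - s)).
Proof.
apply: (@is_derive_affine R R^o R^o (bumpR r) (fun t => t - s) 1 1 t) => [h|].
  by rewrite addrA.
by apply: smooth_derivable; exact: smooth_bumpR.
Qed.

Lemma is_derive_bump_reflect (r s t : R) :
  is_derive (s : R^o) 1 (fun s : R => bumpR r (t - s)) (- D1 (bumpR r) (t - s)).
Proof.
have d1 : is_derive (s : R^o) 1 (fun s : R => t - s) (-1).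
  have := is_deriveB (is_derive_cst t (s : R^o) 1) (is_derive_id (s : R^o) 1).
  by rewrite sub0r.
have d2 : is_derive (t - s) 1 (bumpR r) (D1 (bumpR r) (t - s)).
  by apply: derivableP; apply: smooth_derivable; exact: smooth_bumpR.
by have := @is_derive1_comp R (bumpR r) (fun s : R => t - s) s _ _ d2 d1; rewrite mulrN1.
Qed.

Lemma smooth_bump_shift (r s : R) : smooth (V := R^o) (fun t : R => bumpR r (t - s)).
Proof.
apply: (@smooth_affine R R^o R^o (bumpR r) (fun t => t - s) id).
- by move=> h u z; rewrite addrA.
- by move=> x; apply: continuousB; [exact: cvg_id|exact: cst_continuous].
- exact: smooth_bumpR.
Qed.

Lemma measurable_open_cont (J : set (measurableTypeR R)) (g : R -> R) :
  open (J : set R) -> (forall t, J t -> {for t, continuous g}) -> measurable_fun J g.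
Proof.
move=> oJ cg; apply: open_continuous_measurable_fun => // t.
by rewrite inE; exact: cg.
Qed.

Section local.
Variables (I : set R) (a b : R -> R).
Hypothesis weak : forall chi : R -> R, smooth (V := R^o) chi ->
  (exists K : set R, [/\ compact K, K `<=` I & forall t, ~ K t -> chi t = 0]) ->
  \int[leb1]_(t in I) (D1 chi t * a t) = - \int[leb1]_(t in I) (chi t * b t).
Variables (t0 q e : R).
Hypotheses (q0 : 0 < q) (e0 : 0 < e).
Hypothesis qI : forall t, `|t - t0| < 3 * q -> I t.
Hypothesis ca : forall t, `|t - t0| < 3 * q -> {for t, continuous a}.
Hypothesis cb : forall t, `|t - t0| < 3 * q -> {for t, continuous b}.
Hypothesis a1 : forall t, `|t - t0| < 3 * q -> `|a t - a t0| <= 1.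
Hypothesis be : forall t, `|t - t0| < 3 * q -> `|b t - b t0| <= e.

Let J := `](t0 - 3 * q), (t0 + 3 * q)[%classic : set (measurableTypeR R).

Let JE t : J t -> `|t - t0| < 3 * q.
Proof. by rewrite /J/= in_itv/= ltr_norml => /andP[h1 h2]; apply/andP; split; lra. Qed.

Let oJ : open (J : set R). Proof. exact: itv_open. Qed.

Let ma : measurable_fun J a.
Proof. by apply: measurable_open_cont => // t /JE; exact: ca. Qed.

Let mb : measurable_fun J b.
Proof. by apply: measurable_open_cont => // t /JE; exact: cb. Qed.

Let aM t : J t -> `|a t| <= `|a t0| + 1.
Proof.
move=> /JE /a1 h; rewrite -[a t](subrK (a t0)) (le_trans (ler_normD _ _))//.
by rewrite addrC lerD2l.
Qed.

Let bM t : J t -> `|b t| <= `|b t0| + e.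
Proof.
move=> /JE /be h; rewrite -[b t](subrK (b t0)) (le_trans (ler_normD _ _))//.
by rewrite addrC lerD2l.
Qed.

Let outJ (r s t : R) : r <= q -> `|s - t0| < q -> ~ J t -> r <= `|t - s|.
Proof.
move=> rq sq nJ; rewrite leNgt; apply/negP => tr; apply: nJ; apply: mem_ball3.
apply: (le_lt_trans (ler_distD s _ _)).
have h3 : 3 * q = q + q + q by ring.
by rewrite h3; move: (lt_le_trans tr rq) sq q0; lra.
Qed.

Let D1_out (r x : R) : r < `|x| -> D1 (bumpR r) x = 0.
Proof.
move=> rx; rewrite -(@derive_cst R R^o R 0 x 1); apply: near_eq_derive.
have /cvgr_gt/(_ r rx) : `|y| @[y --> x] --> `|x| by exact: norm_continuous.
by apply: filterS => y ry; rewrite bumpR_out// ltW.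
Qed.

(** Differentiating in the centre [s] gives minus the derivative of the bump in [t]. The bump is an
    admissible test function, so the weak identity moves this derivative onto [a] and produces
    [b]. *)
Lemma is_derive_average (r s : R) : 0 < r -> r < q -> `|s - t0| < q ->
  is_derive (s : R^o) 1 (fun s : R => \int[leb1]_(t in J) (bumpR r (t - s) * a t))
    (\int[leb1]_(t in J) (bumpR r (t - s) * b t)).
Proof.
move=> r0 rq sq.
have [M M0 HM] := deriv_bumpR_bounded r.
have mJ : measurable J by exact: measurable_itv.
have JI : J `<=` I by move=> t /JE; exact: qI.
have cont_D : continuous (fun x : R => D1 (bumpR r) x).
  by apply: smooth_cont; apply: smooth_D; exact: smooth_bumpR.
have E : \int[leb1]_(t in J) (bumpR r (t - s) * b t) =
    \int[leb1]_(t in J) (- D1 (bumpR r) (t - s) * a t).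
  have W := weak (smooth_bump_shift r s).
  have K : exists K : set R, [/\ compact K, K `<=` I & forall t, ~ K t -> bumpR r (t - s) = 0].
    exists `[s - r, s + r]%classic; split; first exact: segment_compact.
      move=> t; rewrite /= in_itv/= => /andP[h1 h2]; apply: qI.
      apply: (le_lt_trans (ler_distD s _ _)).
      have h3 : 3 * q = q + q + q by ring.
      have h4 : `|t - s| <= r by rewrite ler_norml; apply/andP; split; lra.
      by rewrite h3; move: h4 rq sq q0; lra.
    move=> t nK; apply: bumpR_out; rewrite leNgt; apply/negP => h; apply: nK.
    move: h; rewrite ltr_norml /= in_itv/= => /andP[h1 h2]; apply/andP; split; lra.
  have {}W := W K.
  rewrite -(Rintegral_support JI); last first.
    by move=> t nJ; rewrite bumpR_out ?mul0r//; apply: outJ => //; exact: ltW.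
  rewrite -[LHS]opprK -W.
  rewrite (Rintegral_support JI); last first.
    move=> t nJ; rewrite (@derive_val _ _ _ _ _ _ _ (is_derive_bump_shift r s t)).
    rewrite D1_out ?mul0r//; apply: (lt_le_trans rq); exact: (outJ (lexx q) sq).
  rewrite -mulN1r -RintegralZl//.
    apply: eq_Rintegral => t _.
    by rewrite (@derive_val _ _ _ _ _ _ _ (is_derive_bump_shift r s t)) mulN1r mulNr.
  rewrite (_ : EFin \o _ = EFin \o (fun t => D1 (bumpR r) (t - s) * a t)); last first.
    apply/funext => t /=.
    by rewrite (@derive_val _ _ _ _ _ _ _ (is_derive_bump_shift r s t)).
  apply: (@bounded_integrable_itv _ _ _ (M * (`|a t0| + 1))).
    apply: measurable_funM; last exact: ma.
    apply: measurable_funTS; apply: continuous_measurable_fun => t.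
    apply: (@continuous_comp _ _ _ (fun t : R => t - s) (fun x => D1 (bumpR r) x)); last exact: cont_D.
    by apply: continuousB; [exact: cvg_id|exact: cst_continuous].
  by move=> t Jt; rewrite normrM; apply: ler_pM => //; exact: aM.
rewrite E.
apply: (@is_derive_under_integral R _ _ leb1 J mJ R^o
  (fun s t => bumpR r (t - s) * a t) (fun s t => - D1 (bumpR r) (t - s) * a t) s 1
  (cst (M * (`|a t0| + 1)))).
- by move=> h _; exact: (@integrable_bumpR_mul _ t0 q a _ ma aM).
- move=> h t _ Jt.
  have d1 := is_derive_bump_reflect r (h *: (1 : R^o) + s) t.
  have d2 : is_derive (h *: (1 : R^o) + s : R^o) 1 (fun s : R => bumpR r (t - s) * a t)
      (bumpR r (t - (h *: (1 : R^o) + s)) * 0 + a t * - D1 (bumpR r) (t - (h *: (1 : R^o) + s))).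
    exact: is_deriveM d1 (is_derive_cst (a t) _ _).
  by apply: (is_derive_eq d2); rewrite mulr0 add0r mulrC.
- apply: (@bounded_integrable_itv _ _ _ `|M * (`|a t0| + 1)|); first exact: measurable_cst.
  by move=> t _; exact: lexx.
- by move=> h t _ Jt; rewrite normrM normrN; apply: ler_pM => //; exact: aM.
Qed.

(* The mollification s |-> int bumpR r (t - s) a t dt has derivative
   int bumpR r (t - s) b t dt in s, so the mean value theorem bounds its increments
   uniformly in r, and r tends to 0. *)
Lemma local_increment (h : R) : `|h| < q -> `|a (t0 + h) - a t0 - h * b t0| <= e * `|h|.
Proof.
move=> hq; apply/ler_addgt0Pr => w w0.
have w20 : 0 < w / 2 by rewrite divr_gt0.
have in0 : `|t0 - t0| < q by rewrite subrr normr0.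
have inh : `|t0 + h - t0| < q by rewrite addrAC subrr add0r.
have lt3 (x : R) : x < q -> x < 3 * q by move: q0; lra.
have [d1 d10 H1] := continuous_eps (ca (lt3 _ in0)) w20.
have [d2 d20 H2] := continuous_eps (ca (lt3 _ inh)) w20.
(* The radius is chosen after [w]: at both ends [t0] and [t0 + h] the mollified value is then within
   [N * (w / 2)] of [N] times the true one. *)
pose r := Num.min (Num.min d1 d2) q / 2.
have m0 : 0 < Num.min (Num.min d1 d2) q by rewrite !lt_min d10 d20.
have r0 : 0 < r by rewrite divr_gt0.
have : r < Num.min (Num.min d1 d2) q by rewrite /r; lra.
rewrite !lt_min => /andP[/andP[rd1 rd2] rq].
clearbody r.
have [N N0 HN] := bumpR_mass r0.
pose A s := \int[leb1]_(t in J) (bumpR r (t - s) * a t).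
pose B s := \int[leb1]_(t in J) (bumpR r (t - s) * b t).
have A0 : `|A t0 - N * a t0| <= N * (w / 2).
  apply: (@average_approx _ t0 q q0 a _ ma aM) => //; first exact: ltW.
  by move=> t tr; apply: ltW; apply: H1; exact: lt_trans rd1.
have Ah : `|A (t0 + h) - N * a (t0 + h)| <= N * (w / 2).
  apply: (@average_approx _ t0 q q0 a _ ma aM) => //; first exact: ltW.
  by move=> t tr; apply: ltW; apply: H2; exact: lt_trans rd2.
have HB s : `|s - t0| < q -> `|B s - N * b t0| <= N * e.
  move=> sq; apply: (@average_approx _ t0 q q0 b _ mb bM) => //; first exact: ltW.
  move=> t tr; apply: be; apply: (le_lt_trans (ler_distD s _ _)).
  have h3 : 3 * q = q + q + q by ring.
  by rewrite h3; move: tr rq sq q0; lra.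
have dA s : `|s - t0| < q -> is_derive (s : R^o) 1 A (B s) by exact: is_derive_average.
have cA u v : (forall s, u <= s <= v -> `|s - t0| < q) -> {within `[u, v], continuous A}.
  move=> uv; apply: derivable_within_continuous => s; rewrite in_itv/= => /uv sq.
  by have dd := dA s sq; exact: ex_derive.
have [c cq Ec] : exists2 c, `|c - t0| < q & A (t0 + h) - A t0 = B c * h.
  have [h0|h0] := leP 0 h.
    have le : t0 <= t0 + h by rewrite lerDl.
    have inn s : t0 <= s <= t0 + h -> `|s - t0| < q.
      move=> /andP[s1 s2]; rewrite ger0_norm ?subr_ge0//; move: hq; rewrite ger0_norm//; lra.
    have [|c] := @MVT_segment R A B t0 (t0 + h) le _ (cA _ _ inn).
      by move=> s; rewrite in_itv/= => /andP[s1 s2]; apply: dA; apply: inn; rewrite !ltW.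
    rewrite in_itv/= => /inn cq ->; exists c => //.
    by rewrite addrAC subrr add0r.
  have le : t0 + h <= t0 by rewrite gerDl ltW.
  have inn s : t0 + h <= s <= t0 -> `|s - t0| < q.
    move=> /andP[s1 s2]; rewrite ler0_norm ?subr_le0//; move: hq; rewrite ltr0_norm//; lra.
  have [|c] := @MVT_segment R A B (t0 + h) t0 le _ (cA _ _ inn).
    by move=> s; rewrite in_itv/= => /andP[s1 s2]; apply: dA; apply: inn; rewrite !ltW.
  rewrite in_itv/= => /inn cq E; exists c => //.
  by rewrite -opprB E opprD addrA subrr sub0r mulrN opprK.
have HBc := HB c cq.
rewrite -(ler_pM2l N0) -{1}(gtr0_norm N0) -normrM.
have -> : N * (a (t0 + h) - a t0 - h * b t0) =
   - (A (t0 + h) - N * a (t0 + h)) + (A t0 - N * a t0) + (B c - N * b t0) * h.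
  have -> : A (t0 + h) = A t0 + B c * h by rewrite -Ec; ring.
  ring.
apply: (le_trans (ler_normD _ _)); rewrite [leRHS]mulrDr addrC lerD//.
  by rewrite normrM mulrA ler_wpM2r.
apply: (le_trans (ler_normD _ _)); rewrite normrN.
by rewrite [w in leRHS]splitr mulrDr lerD.
Qed.

End local.

(** Near [t0] the continuous function [b] differs from [b t0] by at most [e]. The resulting
    increment bound [e * |h|], for every [e], is exactly differentiability with derivative
    [b t0]. *)
Lemma weak_derive (I : set R) (a b : R -> R) : open I ->
  (forall t, I t -> {for t, continuous a}) -> (forall t, I t -> {for t, continuous b}) ->
  (forall chi : R -> R, smooth (V := R^o) chi ->
    (exists K : set R, [/\ compact K, K `<=` I & forall t, ~ K t -> chi t = 0]) ->
    \int[leb1]_(t in I) (D1 chi t * a t) = - \int[leb1]_(t in I) (chi t * b t)) ->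
  forall t, I t -> is_derive (t : R^o) 1 a (b t).
Proof.
move=> oI ca cb weak t0 It0.
have key e : 0 < e -> exists2 q, 0 < q & forall h, `|h| < q ->
    `|a (t0 + h) - a t0 - h * b t0| <= e * `|h|.
  move=> e0.
  have /nbhs_ballP[d1 /= d10 H1] : nbhs t0 I by apply: open_nbhs_nbhs; split.
  have [d2 d20 H2] := continuous_eps (ca _ It0) ltr01.
  have [d3 d30 H3] := continuous_eps (cb _ It0) e0.
  pose q := Num.min (Num.min d1 d2) d3 / 3.
  have m0 : 0 < Num.min (Num.min d1 d2) d3 by rewrite !lt_min d10 d20.
  have q0 : 0 < q by rewrite divr_gt0.
  have : 3 * q <= Num.min (Num.min d1 d2) d3 by rewrite /q; lra.
  rewrite !le_min => /andP[/andP[qd1 qd2] qd3].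
  have qI t : `|t - t0| < 3 * q -> I t.
    by move=> h; apply: H1; rewrite -ball_normE /= distrC; exact: lt_le_trans qd1.
  exists q => // h hq; apply: (@local_increment I a b weak t0 q e) => //.
  - by move=> t /qI; exact: ca.
  - by move=> t /qI; exact: cb.
  - by move=> t ht; apply: ltW; apply: H2; exact: lt_le_trans qd2.
  - by move=> t ht; apply: ltW; apply: H3; exact: lt_le_trans qd3.
have lim : (fun h : R => h^-1 *: ((a \o shift t0) (h *: (1 : R^o)) - a t0)) @ 0^' --> b t0.
  apply/cvgrPdist_le => e e0; have [q q0 Hq] := key e e0.
  near=> h.
  have h0 : h != 0 by near: h; exact: nbhs_dnbhs_neq.
  have hq : `|h| < q by near: h; exact: dnbhs0_lt.
  have := Hq h hq; rewrite /= [h *: _]mulr1 [h + t0]addrC => H.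
  rewrite distrC -(ler_pM2r (x := `|h|)) ?normr_gt0// -normrM.
  rewrite (_ : (_ - _) * h = a (t0 + h) - a t0 - h * b t0)//.
  rewrite mulrBl [_ *: _]mulrC mulfVK//; ring.
by apply: DeriveDef; [apply/cvg_ex; exists (b t0)|exact/cvg_lim].
Unshelve. all: by end_near. Qed.

End weak_derive.

(** * The Euler equation tested against Schwartz functions *)

Lemma RintegralSum (R : realType) d (T : measurableType d) (mu : {measure set T -> \bar R})
    (D : set T) (J : Type) (s : seq J) (f : J -> T -> R) : measurable D ->
  (forall i, mu.-integrable D (EFin \o f i)) ->
  \int[mu]_(x in D) (\sum_(i <- s) f i x) = \sum_(i <- s) \int[mu]_(x in D) f i x.
Proof.
move=> mD fi; elim: s => [|i s IH].
  rewrite big_nil -[RHS](mul0r (fine (mu D))) -Rintegral_cst//.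
  by apply: eq_Rintegral => x _; rewrite big_nil.
rewrite big_cons -IH -RintegralD//.
  by apply: eq_Rintegral => x _; rewrite big_cons.
have := @integrable_sum _ _ _ mu D mD _ s xpredT (fun i x => (f i x)%:E) (fun i _ => fi i).
by apply: eq_integrable => // x _ /=; rewrite sumEFin.
Qed.

Section spacetime.
Variables (R : realType) (n : nat).
Local Notation V := 'rV[R]_n.
Local Notation T n := (n.-tuple (measurableTypeR R)).
Local Notation leb1 := (@lebesgue_measure R).
Local Notation leb n := (lebesgue_tuple R n).
Variables (A : 'M[R]_n) (I : set R).
Hypotheses (uA : A \in unitmx) (oI : open I).

(** The class shared by the components of [v] and by their pairwise products, the two kinds of
    functions paired with Schwartz functions. *)
Definition admissible (M : R) (w : R * V -> R) : Prop :=
  [/\ forall z, I z.1 -> {for z, continuous w},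
      forall z, I z.1 -> `|w z| <= M & periodic_on A I w].

Lemma open_slab : open [set z : R * V | I z.1].
Proof.
rewrite openE => z Iz; apply: (@cvg_fst _ _ (nbhs z.1) (nbhs z.2)).
by move: oI; rewrite openE; exact.
Qed.

(** Nothing is known about [v] at times outside [I]; extension by zero gives a function measurable
    on the whole product space, to which Fubini applies. *)
Definition extend0 (w : R * V -> R) : R * V -> R := w \_ [set z | I z.1].

Lemma extend0E w z : I z.1 -> extend0 w z = w z.
Proof. by move=> Iz; rewrite /extend0 patchE mem_set. Qed.

Lemma extend0_out w z : ~ I z.1 -> extend0 w z = 0.
Proof. by move=> nI; rewrite /extend0 patchE memNset. Qed.

Lemma measurable_extend0 M w : admissible M w ->
  measurable_fun setT (fun z : measurableTypeR R * T n => extend0 w (spacetime_rV z)).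
Proof.
move=> [cw _ _].
have mI : measurable (@spacetime_rV R n @^-1` [set z | I z.1]).
  by apply: measurable_preimage_open; exact: open_slab.
have := measurable_fun_within open_slab cw.
move/(measurable_restrictT _ mI); congr (measurable_fun _ _).
Qed.

Lemma measR_slice M w t : admissible M w -> I t -> measR (fun x => w (t, x)).
Proof.
move=> aw It; rewrite (_ : (fun x => _) = (fun x => extend0 w (t, x))).
  exact: measurableT_comp (measurable_extend0 aw) (measurable_pair1 (t : measurableTypeR R)).
by apply/funext => x; rewrite extend0E.
Qed.

Lemma intR_slice M w t f : admissible M w -> I t -> schwartz f ->
  intR (fun x => w (t, x) * f x).
Proof.
move=> aw It sf; have [cw wM pw] := aw.
have M0 : 0 <= M by apply: le_trans (wM (t, 0) It).
have [C C0 HC] := decays_weight (schwartz_decays sf) ler01.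
apply: (@intR_le_weight _ _ _ (M * C)).
  apply: measurable_funM; first exact: measR_slice aw It.
  by apply: measurable_fun_rV; exact: schwartz_cont.
move=> x; rewrite normrM -mulrA; apply: ler_pM => //; first exact: wM.
by apply: HC => i; rewrite mul1r (le_trans (coord_le_enorm x i))// lerDr.
Qed.

(** The dominating function [M * C / weight] does not depend on time. This continuity is what later
    upgrades weak time derivatives to classical ones. *)
Lemma continuous_pairing M w f : admissible M w -> schwartz f ->
  forall t, I t -> {for t, continuous (fun t => integral_Rn (fun x => w (t, x) * f x))}.
Proof.
move=> aw sf t It; have [cw wM pw] := aw.
have M0 : 0 <= M by apply: le_trans (wM (t, 0) It).
have [C C0 HC] := decays_weight (schwartz_decays sf) ler01.
apply: (@continuous_under_integral R _ _ (leb n) setT measurableT R^o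
  (fun t (x : T n) => w (t, rV_of_tuple x) * f (rV_of_tuple x)) t I
  (fun x : T n => M * C / weight (rV_of_tuple x))).
- by apply: open_nbhs_nbhs; split.
- move=> s Is; apply: measurable_funM; first exact: measR_slice aw Is.
  by apply: measurable_fun_rV; exact: schwartz_cont.
- move=> x _.
  have c1 : {for t, continuous (fun t : R => w (t, rV_of_tuple x))}.
    apply: (@continuous_comp _ _ _ (fun t : R => (t, rV_of_tuple x)) w); last exact: cw.
    move=> B [[B1 B2] /= [B1t B2x] sub]; rewrite /nbhs /=.
    apply: filterS B1t => s B1s; apply: sub; split => //=.
    exact: nbhs_singleton B2x.
  have c2 : {for t, continuous (fun _ : R => f (rV_of_tuple x))} by exact: cst_continuous.
  exact: continuousM c1 c2.
- exact: integrable_weight_cst.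
- move=> s x Is _; rewrite normrM -mulrA; apply: ler_pM => //; first exact: wM.
  by apply: HC => i; rewrite mul1r (le_trans (coord_le_enorm _ i))// lerDr.
Qed.

Definition time_cutoff (chi : R -> R) : Prop := smooth (V := R^o) chi /\
  exists K : set R, [/\ compact K, K `<=` I & forall t, ~ K t -> chi t = 0].

Lemma integrable_cutoff (chi : R -> R) : continuous chi ->
  (exists K : set R, [/\ compact K, K `<=` I & forall t, ~ K t -> chi t = 0]) ->
  leb1.-integrable setT (EFin \o (fun t => `|chi t|)).
Proof.
move=> cc [K [cK KI chi0]].
have mK : measurable (K : set (measurableTypeR R)) by exact: compact_measurable.
have iK : leb1.-integrable (K : set (measurableTypeR R)) (EFin \o (fun t => `|chi t|)).
  apply: continuous_compact_integrable => //; apply: continuous_subspaceT => t.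
  by apply: (@continuous_comp _ _ _ chi); [exact: cc|exact: norm_continuous].
move: iK; rewrite (integrable_mkcond _ mK).
apply: eq_integrable => // t _; rewrite patchE; case: ifPn => //.
by rewrite notin_setE => /chi0 /= ->; rewrite normr0.
Qed.

Lemma periodize_bounded f : schwartz f -> exists2 C : R, 0 <= C &
  forall x, cell A x != 0 -> `|periodize A f x| <= C.
Proof.
move=> sf.
pose r := \sum_i \sum_j `|A i j|.
have r0 : 0 <= r by rewrite sumr_ge0// => i _; rewrite sumr_ge0.
have [C C0 HC] := periodize_dom uA (schwartz_decays sf) r0.
exists (\int[leb n]_y (C / weight (rV_of_tuple y))).
  by apply: Rintegral_ge0 => y _; rewrite divr_ge0// ltW// weight_gt0.
move=> x cx; rewrite /periodize /integral_Rn.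
have ip := integrable_periodize uA x sf.
apply: (le_trans (le_normr_Rintegral measurableT ip)).
apply: (le_Rintegral measurableT _ (integrable_weight_cst n C)).
  by have := integrable_abse ip; apply: eq_integrable.
move=> y _; apply: HC => i; move: cx; rewrite (cellE uA).
case: (boolP (x \in _)) => [|_]; last by rewrite eqxx.
rewrite inE => -[u u01 <-] _.
rewrite mxE (le_trans (ler_norm_sum _ _ _))//; apply: ler_sum => j _.
have /andP[u0 u1] := u01 j.
rewrite normrM ger0_norm// (bigD1 i)//=.
apply: (@le_trans _ _ `|A j i|); last by rewrite lerDl sumr_ge0.
by rewrite -[leRHS]mul1r ler_wpM2r// ltW.
Qed.

Section tested.
Variables (M : R) (w : R * V -> R) (chi : R -> R) (f : V -> R).
Hypotheses (aw : admissible M w) (cchi : continuous chi) (sf : schwartz f).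
Hypothesis Kchi : exists K : set R, [/\ compact K, K `<=` I & forall t, ~ K t -> chi t = 0].

Let D := [set z : measurableTypeR R * T n | I z.1 /\ fundamental_domain A (rV_of_tuple z.2)].

Let F (z : measurableTypeR R * T n) : R :=
  w (z.1, rV_of_tuple z.2) * (chi z.1 * periodize A f (rV_of_tuple z.2)).

Let H (z : measurableTypeR R * T n) : R :=
  cell A (rV_of_tuple z.2) * (chi z.1 * extend0 w (spacetime_rV z) * periodize A f (rV_of_tuple z.2)).

Let HF : H = F \_ D.
Proof.
apply/funext => z; rewrite /H patchE (cellE uA).
have [Iz|nI] := pselect (I z.1); last first.
  by rewrite extend0_out// mulr0 mul0r mulr0 memNset// => -[].
rewrite extend0E//; case: (boolP (rV_of_tuple z.2 \in _)).
  rewrite inE => zD; have Dz : z \in D by apply/mem_set; split.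
  by rewrite Dz mul1r /F /spacetime_rV; ring.
by rewrite notin_setE => zD; rewrite mul0r memNset// => -[].
Qed.

Let mH : measurable_fun setT H.
Proof.
apply: measurable_funM.
  exact: measurableT_comp (measurable_cell A) measurable_snd.
apply: measurable_funM; last first.
  exact: measurableT_comp (measurable_fun_rV (continuous_periodize uA sf)) measurable_snd.
apply: measurable_funM; last exact: measurable_extend0 aw.
exact: measurableT_comp (continuous_measurable_fun cchi) measurable_fst.
Qed.

Let Hdom : exists2 C : R, 0 <= C &
  forall t x, `|H (t, x)| <= `|chi t| * (C / weight (rV_of_tuple x)).
Proof.
have [cw wM pw] := aw.
have [C C0 HC] := periodize_bounded sf.
have [C' C'0 HC'] := cell_le_weight uA.
have [[t0 It0]|nI] := pselect (exists t, I t); last first.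
  exists 0 => // t x; rewrite /H extend0_out ?mulr0 ?mul0r ?mulr0 ?normr0//.
  by move=> It; apply: nI; exists t.
have M0 : 0 <= M by apply: le_trans (wM (t0, 0) It0).
exists (C' * (M * C)); first by rewrite !mulr_ge0.
move=> t x; rewrite /H /=; set y := rV_of_tuple x.
have w0 : 0 < weight y by exact: weight_gt0.
have [cz|cx] := eqVneq (cell A y) 0.
  by rewrite cz mul0r normr0 mulr_ge0// divr_ge0 ?(ltW w0)// !mulr_ge0.
have tM : `|extend0 w (spacetime_rV (t, x))| <= M.
  have [It|nI] := pselect (I t); first by rewrite extend0E//; exact: wM.
  by rewrite extend0_out// normr0.
have -> : `|chi t| * (C' * (M * C) / weight y) = (C' / weight y) * (`|chi t| * M * C).
  by move: (_^-1) => u; ring.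
rewrite !normrM; apply: ler_pM => //.
- by rewrite ger0_norm ?cell_ge0//; exact: HC'.
- by apply: ler_pM => //; [apply: ler_wpM2l|exact: HC].
Qed.

Lemma integrable_tested :
  (product_measure1 leb1 (leb n)).-integrable setT (EFin \o F \_ D).
Proof.
rewrite -HF; have [C C0 HC] := Hdom.
apply: (dominated_prod mH (integrable_cutoff cchi Kchi) (integrable_weight_cst n C)) => //.
by move=> y; rewrite divr_ge0// ltW// weight_gt0.
Qed.

(** Fubini separates time from space; at each fixed time the unfolding lemma exchanges the
    fundamental domain and the periodised [f] for R^n and [f] itself. *)
Lemma integral_tested : integral_ItimesT A I (fun z => w z * (chi z.1 * periodize A f z.2)) =
  \int[leb1]_(t in I) (chi t * integral_Rn (fun x => w (t, x) * f x)).
Proof.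
have [cw wM pw] := aw.
rewrite /integral_ItimesT Rintegral_mkcond -/D -/F -HF.
have [C C0 HC] := Hdom.
rewrite (dominated_fubini1 mH (integrable_cutoff cchi Kchi) (integrable_weight_cst n C)) //; last first.
  by move=> y; rewrite divr_ge0// ltW// weight_gt0.
rewrite [RHS]Rintegral_mkcond; apply: eq_Rintegral => t _; rewrite patchE.
case: ifPn => [|]; rewrite ?inE ?notin_setE => It.
  rewrite -(RintegralZl _ measurableT (intR_slice aw It sf)).
  have := @unfold_periodize R n A uA (fun x => chi t * w (t, x)) f (`|chi t| * M).
  rewrite /integral_Rn => U.
  transitivity (\int[leb n]_y (chi t * w (t, rV_of_tuple y) * f (rV_of_tuple y))).
    rewrite -U.
    - by apply: eq_Rintegral => y _; rewrite /H /= extend0E.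
    - by apply: measurable_funM => //; exact: measR_slice aw It.
    - by move=> x; rewrite normrM ler_wpM2l//; exact: wM.
    - by move=> x g lg; rewrite pw.
    - exact: sf.
  by apply: eq_Rintegral => y _; rewrite mulrA.
transitivity (\int[leb n]_y (cst 0 y : R)); last by rewrite Rintegral_cst// mul0r.
by apply: eq_Rintegral => y _; rewrite /H extend0_out// mulr0 mul0r mulr0.
Qed.

End tested.
End spacetime.

Lemma schwartz0 (R : realType) (n : nat) : schwartz (fun _ : 'rV[R]_n => 0 : R).
Proof.
apply: (@schwartz_coind R n (fun k => k = cst 0)) => // _ ->; split.
- exact: cst_continuous.
- by move=> z u; exact: derivable_cst.
- by move=> N; exists 0 => x; rewrite normr0 mulr0.
- by move=> u; apply/funext => z; rewrite derive_cst.
Qed.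

Lemma schwartz_sum (R : realType) (n : nat) (J : Type) (s : seq J) (f : J -> 'rV[R]_n -> R) :
  (forall j, schwartz (f j)) -> schwartz (fun x => \sum_(j <- s) f j x).
Proof.
move=> sf; elim: s => [|j s IH].
  by apply: schwartz_eq (schwartz0 R n) => x; rewrite big_nil.
by apply: schwartz_eq (schwartz_add (sf j) IH) => x; rewrite big_cons.
Qed.

Lemma continuous_for_sum (R : realType) (J : Type) (s : seq J) (g : J -> R -> R) (t : R) :
  (forall j, {for t, continuous (g j)}) -> {for t, continuous (fun t => \sum_(j <- s) g j t)}.
Proof.
move=> cg; elim: s => [|j s IH].
  rewrite (_ : (fun _ => _) = cst 0); first exact: cst_continuous.
  by apply/funext => x; rewrite big_nil.
rewrite (_ : (fun _ => _) = g j + (fun t => \sum_(j <- s) g j t)).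
  exact: continuousD (cg j) IH.
by apply/funext => x; rewrite big_cons.
Qed.

(** * Consequences of the weak equations at each fixed time *)

Section euler.
Variables (R : realType) (n : nat).
Local Notation V := 'rV[R]_n.
Local Notation leb1 := (@lebesgue_measure R).
Local Notation leb n := (lebesgue_tuple R n).
Local Notation D1 f := ('D_(1 : R^o) (f : R^o -> R)).
Local Notation e j := (delta_mx 0 j : V).
Variables (A : 'M[R]_n) (I : set R).
Hypotheses (uA : A \in unitmx) (oI : open I).

Definition tensor (chi : R -> R) (f : V -> R) (z : R * V) : R := chi z.1 * periodize A f z.2.

Lemma smooth_fst (chi : R -> R) : smooth (V := R^o) chi ->
  smooth (fun z : R * V => chi z.1).
Proof.
move=> sc; apply: (@smooth_affine R (R * V)%type R^o chi fst fst) => //.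
by move=> z; exact: cvg_fst.
Qed.

Lemma smooth_snd (f : V -> R) : smooth f -> smooth (fun z : R * V => f z.2).
Proof.
move=> sf; apply: (@smooth_affine R (R * V)%type V f snd snd) => //.
by move=> z; exact: cvg_snd.
Qed.

Lemma test_fun_tensor chi f : time_cutoff I chi -> schwartz f ->
  test_fun A I (tensor chi f).
Proof.
move=> [sc [K [cK KI chi0]]] sf; exists K; split => //; split.
- apply: smooth_mul; first exact: smooth_fst.
  exact: smooth_snd (smooth_periodize uA sf).
- move=> t x g _ lg; rewrite /tensor /=; congr (_ * _).
  by apply: periodize_periodic => //; exact: schwartz_cont.
- by move=> t x nK; rewrite /tensor /= chi0// mul0r.
Qed.

Lemma pd_tensor chi f (o : option 'I_n) z : time_cutoff I chi -> schwartz f ->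
  pd o (tensor chi f) z =
  if o is Some j then tensor chi ('D_(e j) f) z else D1 chi z.1 * periodize A f z.2.
Proof.
move=> [sc _] sf.
have dchi (u : R * V) : is_derive z u (fun z : R * V => chi z.1) ('D_(u.1 : R^o) (chi : R^o -> R) z.1).
  apply: (@is_derive_affine R (R * V)%type R^o chi fst u u.1 z) => //.
  exact: smooth_derivable.
have dper (u : R * V) : is_derive z u (fun z : R * V => periodize A f z.2) (periodize A ('D_(u.2) f) z.2).
  have <- := derive_periodize uA u.2 sf.
  apply: (@is_derive_affine R (R * V)%type V (periodize A f) snd u u.2 z) => //.
  exact: smooth_derivable (smooth_periodize uA sf).
have dt (u : R * V) : 'D_u (tensor chi f) z =
    chi z.1 * periodize A ('D_(u.2) f) z.2 + periodize A f z.2 * 'D_(u.1 : R^o) (chi : R^o -> R) z.1.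
  exact: (@derive_val _ _ _ _ _ _ _ (is_deriveM (dchi u) (dper u))).
rewrite /pd dt; case: o => [j|] /=.
  by rewrite derive0 mulr0 addr0.
rewrite (_ : periodize A ('D_0 f) z.2 = 0) ?mulr0 ?add0r 1?mulrC//.
rewrite /periodize /integral_Rn.
transitivity (\int[leb n]_y (cst 0 y : R)); last by rewrite Rintegral_cst// mul0r.
by apply: eq_Rintegral => y _; rewrite derive0.
Qed.

Lemma time_cutoffD chi : time_cutoff I chi -> time_cutoff I (D1 chi).
Proof.
move=> [sc [K [cK KI chi0]]]; split; first exact: smooth_D.
exists K; split => // t nK.
have oK : open (~` K) by apply: closed_openC; exact: compact_closed (@Rhausdorff R) cK.
rewrite -(@derive_cst R R^o R 0 t 1); apply: near_eq_derive.
have : nbhs t (~` K) by apply: open_nbhs_nbhs; split.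
by apply: filterS => s nKs; rewrite chi0.
Qed.

Lemma integrable_pairing M (w : R * V -> R) chi f : admissible A I M w ->
  time_cutoff I chi -> schwartz f ->
  leb1.-integrable I (EFin \o (fun t => chi t * integral_Rn (fun x => w (t, x) * f x))).
Proof.
move=> aw [sc Kc] sf; have [cw wM pw] := aw.
have cchi : continuous chi by exact: smooth_cont sc.
have mI : measurable (I : set (measurableTypeR R)) by exact: open_measurable.
have [C C0 HC] := decays_weight (schwartz_decays sf) ler01.
pose B := \int[leb n]_x (M * C / weight (rV_of_tuple x)).
have iB : leb1.-integrable (I : set (measurableTypeR R)) (EFin \o (fun t => B * `|chi t|)).
  have ic := integrable_cutoff cchi Kc.
  have icI : leb1.-integrable (I : set (measurableTypeR R)) (EFin \o (fun t => `|chi t|)).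
    exact: (integrableS measurableT mI (@subsetT _ _) ic).
  have := integrableZl mI B icI.
  by apply: eq_integrable => // t _; rewrite /= EFinM.
apply: (le_integrable mI _ _ iB).
  apply/measurable_EFinP; apply: measurable_funM.
    by apply: measurable_funTS; exact: continuous_measurable_fun.
  apply: measurable_open_cont => // t It.
  exact: (continuous_pairing oI aw sf It).
move=> t It; rewrite /= lee_fin; apply: (le_trans _ (ler_norm _)).
rewrite normrM mulrC ler_wpM2r//.
have iw := intR_slice oI aw It sf.
apply: (le_trans (le_normr_Rintegral measurableT iw)).
apply: (le_Rintegral measurableT _ (integrable_weight_cst n (M * C))).
  by have := integrable_abse iw; apply: eq_integrable.
move=> x _; rewrite normrM -mulrA; apply: ler_pM => //; first exact: wM.
by apply: HC => i; rewrite mul1r (le_trans (coord_le_enorm _ i))// lerDr.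
Qed.

Lemma integral_tested_sum (J : Type) (s : seq J) M (w : J -> R * V -> R) chi
    (f : J -> V -> R) : (forall j, admissible A I M (w j)) ->
  time_cutoff I chi -> (forall j, schwartz (f j)) ->
  integral_ItimesT A I (fun z => \sum_(j <- s) w j z * tensor chi (f j) z) =
  \int[leb1]_(t in I) (chi t * \sum_(j <- s) integral_Rn (fun x => w j (t, x) * f j x)).
Proof.
move=> aw tc sf; have [sc Kc] := tc.
have cchi : continuous chi by exact: smooth_cont sc.
have mI : measurable (I : set (measurableTypeR R)) by exact: open_measurable.
transitivity (\sum_(j <- s) integral_ItimesT A I (fun z => w j z * tensor chi (f j) z)).
  rewrite /integral_ItimesT.
  under [RHS]eq_bigr do rewrite Rintegral_mkcond.
  rewrite Rintegral_mkcond -RintegralSum//.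
    apply: eq_Rintegral => z _; rewrite patchE; case: ifPn => h.
      by apply: eq_bigr => j _; rewrite patchE h.
    by rewrite big1// => j _; rewrite patchE (negbTE h).
  move=> j; have := integrable_tested uA oI (aw j) cchi (sf j) Kc.
  by [].
under eq_bigr do rewrite (integral_tested uA oI (aw _) cchi (sf _) Kc).
rewrite -RintegralSum//; last by move=> j; exact: integrable_pairing (aw j) tc (sf j).
by apply: eq_Rintegral => t _; rewrite mulr_sumr.
Qed.

Variables (v : R * V -> V) (p : (R * V -> R) -> R) (M : R).
Hypotheses (dp : distribution_on A I p) (ev : euler_weak A I v p).
Hypothesis av : forall i, admissible A I M (fun z => v z 0 i).

(** The weak equation only says that the pairing [b] vanishes after integration against cutoffs in
    time, that is, [b] is a weak derivative of the function 0. Since [b] is continuous,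
    [weak_derive] makes it the classical derivative of 0. *)
Lemma div_free_slice f t : schwartz f -> I t ->
  \sum_j integral_Rn (fun x => v (t, x) 0 j * 'D_(e j) f x) = 0.
Proof.
move=> sf It; have [_ ed] := ev.
pose b (t : R) := \sum_j integral_Rn (fun x => v (t, x) 0 j * 'D_(e j) f x).
have sD j : schwartz ('D_(e j) f) by exact: schwartz_D.
have d0 : is_derive (t : R^o) 1 (cst 0 : R -> R) (b t).
  apply: (weak_derive oI) => //.
  - by move=> s _; exact: cst_continuous.
  - by move=> s Is; apply: continuous_for_sum => j; exact: (continuous_pairing oI (av j) (sD j) Is).
  - move=> chi sc Kc; have tc : time_cutoff I chi by split.
    have H := ed _ (test_fun_tensor tc sf).
    transitivity (0 : R).
      transitivity (\int[leb1]_(t in I) (cst 0 t : R)); last first.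
        by rewrite Rintegral_cst ?mul0r//; exact: open_measurable.
      by apply: eq_Rintegral => s _; rewrite mulr0.
    apply/esym; rewrite -[RHS]H; congr (- _).
    rewrite -(integral_tested_sum _ av tc sD).
    apply: eq_Rintegral => z _; apply: eq_bigr => j _.
    by rewrite (pd_tensor (Some j)).
by rewrite -/(b t) -(@derive_val _ _ _ _ _ _ _ d0) derive_cst.
Qed.

Lemma tensorD (chi : R -> R) (f g : V -> R) : schwartz f -> schwartz g ->
  tensor chi (fun x => f x + g x) = (fun z => 1 * tensor chi f z + tensor chi g z).
Proof.
move=> sf sg; apply/funext => z; rewrite /tensor mul1r -mulrDr; congr (_ * _).
rewrite /periodize /integral_Rn.
by rewrite -(RintegralD measurableT (integrable_periodize uA z.2 sf) (integrable_periodize uA z.2 sg)).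
Qed.

Lemma pressure_sum (J : Type) (s : seq J) (chi : R -> R) (f : J -> V -> R) : time_cutoff I chi ->
  (forall j, schwartz (f j)) ->
  p (tensor chi (fun x => \sum_(j <- s) f j x)) = \sum_(j <- s) p (tensor chi (f j)).
Proof.
move=> tc sf; have [plin _] := dp.
elim: s => [|j s IH].
  have E : (fun x => \sum_(j <- [::]) f j x) = (fun _ : V => 0 : R).
    by apply/funext => x; rewrite big_nil.
  rewrite E big_nil; have s0 := schwartz0 R n.
  have := tensorD chi s0 s0; rewrite (_ : (fun _ => 0 + 0) = (fun=> 0)); last first.
    by apply/funext => x; rewrite addr0.
  (* Linearity yields [p 0 = p 0 + p 0], hence the empty sum has pressure 0. *)
  move=> H; have := plin 1 _ _ (test_fun_tensor tc s0) (test_fun_tensor tc s0).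
  rewrite -H mul1r => /eqP; rewrite -[X in X == _]addr0 (inj_eq (addrI _)) => /eqP.
  by move=> <-.
rewrite big_cons -IH.
rewrite (_ : (fun x => _) = (fun x => f j x + \sum_(j <- s) f j x)); last first.
  by apply/funext => x; rewrite big_cons.
rewrite (tensorD chi (sf j) (schwartz_sum s sf)) plin ?mul1r//.
- exact: test_fun_tensor.
- by apply: test_fun_tensor => //; exact: schwartz_sum.
Qed.

Lemma admissible_mul i j : admissible A I (M * M) (fun z => v z 0 i * v z 0 j).
Proof.
have [c1 b1 p1] := av i; have [c2 b2 p2] := av j; split.
- by move=> z Iz; exact: continuousM (c1 z Iz) (c2 z Iz).
- by move=> z Iz; rewrite normrM ler_pM// ?b1 ?b2.
- by move=> t x g It lg; rewrite p1// p2.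
Qed.

(** Component [m] of the equation is tested with [chi] times the periodised [K m]. In the sum over
    [m], linearity collects the pressure terms into [p] at the divergence of [K], which is [p] at 0.
    What remains exhibits the quadratic pairings as a weak time derivative. *)
Lemma is_derive_pairing (K : 'I_n -> V -> R) : (forall m, schwartz (K m)) ->
  (forall x, \sum_m 'D_(e m) (K m) x = 0) ->
  forall t, I t ->
  is_derive (t : R^o) 1
    (fun t => \sum_m integral_Rn (fun x => v (t, x) 0 m * K m x))
    (\sum_m \sum_j integral_Rn (fun x => v (t, x) 0 m * v (t, x) 0 j * 'D_(e j) (K m) x)).
Proof.
move=> sK dK t It; have [em _] := ev.
have sD j m : schwartz ('D_(e j) (K m)) by exact: schwartz_D.
apply: (@weak_derive _ I _ (fun t => \sum_m \sum_j integral_Rn (fun x =>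
  v (t, x) 0 m * v (t, x) 0 j * 'D_(e j) (K m) x)) oI) => //.
- by move=> s Is; apply: continuous_for_sum => m; exact: (continuous_pairing oI (av m) (sK m) Is).
- move=> s Is; apply: continuous_for_sum => m; apply: continuous_for_sum => j.
  exact: (continuous_pairing oI (admissible_mul m j) (sD j m) Is).
move=> chi sc Kc; have tc : time_cutoff I chi by split.
have tc1 := time_cutoffD tc.
have mI : measurable (I : set (measurableTypeR R)) by exact: open_measurable.
pose a1 m := \int[leb1]_(t in I) (D1 chi t * integral_Rn (fun x => v (t, x) 0 m * K m x)).
pose a2 m := \int[leb1]_(t in I) (chi t * \sum_j integral_Rn (fun x =>
  v (t, x) 0 m * v (t, x) 0 j * 'D_(e j) (K m) x)).
have E m : - a1 m - a2 m - p (tensor chi ('D_(e m) (K m))) = 0.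
  rewrite -[RHS](em m _ (test_fun_tensor tc (sK m))); congr (- _ - _ - _).
  - rewrite /a1 -(integral_tested uA oI (av m) (smooth_cont tc1.1) (sK m) tc1.2).
    by apply: eq_Rintegral => z _; rewrite (pd_tensor None).
  - rewrite /a2 -(integral_tested_sum _ (admissible_mul m) tc (sD ^~ m)).
    by apply: eq_Rintegral => z _; apply: eq_bigr => j _; rewrite (pd_tensor (Some j)).
  - by congr p; apply/funext => z; rewrite (pd_tensor (Some m)).
have P0 : \sum_m p (tensor chi ('D_(e m) (K m))) = 0.
  rewrite -(pressure_sum _ tc (fun m => sD m m)).
  rewrite (_ : (fun x => _) = (fun=> 0)); last by apply/funext => x; exact: dK.
  have := @pressure_sum 'I_n [::] chi (fun _ _ => 0) tc (fun _ => schwartz0 R n).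
  by rewrite !big_nil.
have : \sum_m (- a1 m - a2 m - p (tensor chi ('D_(e m) (K m)))) = 0.
  by rewrite big1// => m _; exact: E.
rewrite !big_split/= !sumrN P0 subr0 => /eqP.
rewrite subr_eq0 => /eqP S.
transitivity (\sum_m a1 m).
  rewrite -RintegralSum; last 2 first.
  - by [].
  - by move=> m; have := integrable_pairing (av m) tc1 (sK m).
  by apply: eq_Rintegral => s _; rewrite mulr_sumr.
rewrite -[LHS]opprK S; congr (- _).
rewrite -RintegralSum//.
  by apply: eq_Rintegral => s _; rewrite mulr_sumr.
move=> m; rewrite (_ : EFin \o _ = EFin \o (fun t => \sum_j chi t *
   integral_Rn (fun x => v (t, x) 0 m * v (t, x) 0 j * 'D_(e j) (K m) x))); last first.
  by apply/funext => s /=; rewrite mulr_sumr.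
have ij j := integrable_pairing (admissible_mul m j) tc (sD j m).
have := @integrable_sum _ _ _ leb1 (I : set (measurableTypeR R)) mI _ (index_enum 'I_n) xpredT
  (fun j t => (chi t * integral_Rn (fun x =>
     v (t, x) 0 m * v (t, x) 0 j * 'D_(e j) (K m) x))%:E) (fun j _ => ij j).
by apply: eq_integrable => // s _ /=; rewrite sumEFin.
Qed.

End euler.

(** * The commutator formula *)

(** Serves to insert or remove the gradient correction: [a] is a pairing with [psi], the [b i] are
    pairings with one row of the kernel, and the [d i] are pairings with a gradient, which add up to
    0 because div v = 0. *)
Lemma sum_delta (R : zmodType) (I : finType) (a : R) (b d : I -> R) (l : I) :
  \sum_i d i = 0 -> b l = a - d l -> (forall i, i != l -> b i = - d i) ->
  a = \sum_i b i.
Proof.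
move=> d0 bl bN; rewrite (bigD1 l)//= bl (eq_bigr (fun i => - d i))//.
by move: d0; rewrite (bigD1 l)//= sumrN -addrA -opprD => ->; rewrite subr0.
Qed.

Section convolution.
Variables (R : realType) (n : nat).
Local Notation V := 'rV[R]_n.
Local Notation T n := (n.-tuple (measurableTypeR R)).
Local Notation leb n := (lebesgue_tuple R n).
Implicit Types (f w : V -> R).

Lemma conv_bound f (r : R) : decays f -> 0 <= r ->
  exists2 C : R, 0 <= C & forall x y : V, (forall i, `|x 0 i| <= r) ->
    `|f (y - x)| <= C / weight y.
Proof.
move=> df r0; have [C C0 HC] := decays_weight df (addr_ge0 ler01 r0).
exists C => // x y xr; apply: HC => i.
have e0 := enorm_ge0 (y - x).
rewrite -[y 0 i](subrK (x 0 i)); apply: (le_trans (ler_normD _ _)).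
have h1 : `|y 0 i - x 0 i| <= enorm (y - x).
  by have := coord_le_enorm (y - x) i; rewrite !mxE.
apply: (le_trans (lerD h1 (xr i))).
by move: e0; move: (enorm _) => q q0; nra.
Qed.

Lemma schwartz_shift f x : schwartz f -> schwartz (fun y => f (y - x)).
Proof.
move=> sf; apply: schwartz_eq (schwartz_affine (- x) (oner_neq0 R) sf) => y.
by rewrite scale1r.
Qed.

Lemma is_derive_conv w f (M : R) (x u : V) : measR w -> (forall y, `|w y| <= M) ->
  schwartz f ->
  is_derive x u (fun x => integral_Rn (fun y => w y * f (y - x)))
    (- integral_Rn (fun y => w y * 'D_u f (y - x))).
Proof.
move=> mw wM sf.
have M0 : 0 <= M by apply: le_trans (wM 0).
have mwf g : schwartz g -> measR (fun y => w y * g y).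
  by move=> sg; apply: measurable_funM => //; apply: measurable_fun_rV; exact: schwartz_cont.
have iwf g : schwartz g -> intR (fun y => w y * g y).
  move=> sg; have [C C0 HC] := decays_weight (schwartz_decays sg) ler01.
  apply: (@intR_le_weight _ _ _ (M * C)); first exact: mwf.
  move=> y; rewrite normrM -mulrA; apply: ler_pM => //.
  by apply: HC => i; rewrite mul1r (le_trans (coord_le_enorm _ i))// lerDr.
have r0 : 0 <= \sum_i `|u 0 i| + \sum_i `|x 0 i| by rewrite addr_ge0// sumr_ge0.
have [C C0 HC] := conv_bound (schwartz_decays (schwartz_D u sf)) r0.
have -> : - integral_Rn (fun y => w y * 'D_u f (y - x)) =
    integral_Rn (fun y => w y * - 'D_u f (y - x)).
  rewrite -mulN1r /integral_Rn.
  have iD := iwf _ (schwartz_shift x (schwartz_D u sf)).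
  rewrite -(RintegralZl (-1) measurableT iD).
  by apply: eq_Rintegral => y _; rewrite mulN1r mulrN.
apply: (@is_derive_under_integral R _ _ (leb n) setT measurableT V
  (fun x (y : T n) => w (rV_of_tuple y) * f (rV_of_tuple y - x))
  (fun x (y : T n) => w (rV_of_tuple y) * - 'D_u f (rV_of_tuple y - x)) x u
  (fun y => M * C / weight (rV_of_tuple y))).
- by move=> s _; exact: (iwf _ (schwartz_shift _ sf)).
- move=> s y _ _.
  have hL (h : R) : rV_of_tuple y - (h *: u + (s *: u + x)) =
      h *: (-1 *: u) + (rV_of_tuple y - (s *: u + x)).
    by rewrite opprD scaleN1r scalerN addrCA.
  have d1 := @is_derive_affine R V V f (fun x : V => rV_of_tuple y - x) u (-1 *: u) (s *: u + x) hL
    (schwartz_derivable sf).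
  have d2 := is_deriveM (is_derive_cst (w (rV_of_tuple y)) (s *: u + x) u) d1.
  apply: (is_derive_eq d2).
  rewrite scaler0 addr0 derive_scaledir ?mulN1r//.
  by move=> *; exact: schwartz_derivable.
- exact: integrable_weight_cst.
- move=> s y s1 _; rewrite normrM normrN -mulrA; apply: ler_pM => //.
  apply: HC => i; rewrite !mxE; apply: (le_trans (ler_normD _ _)).
  apply: lerD; last by rewrite (bigD1 i)//= lerDl sumr_ge0.
  apply: (@le_trans _ _ `|u 0 i|); last by rewrite (bigD1 i)//= lerDl sumr_ge0.
  by rewrite normrM -[leRHS]mul1r ler_wpM2r// ltW.
Qed.

(** Translation invariance makes the integral of [f (y - x)] over [y] constant in [x]; its
    derivative at 0 is minus the integral in question. *)
Lemma integral_derive0 f u : schwartz f -> integral_Rn ('D_u f) = 0.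
Proof.
move=> sf.
have m1 : measR (fun _ : V => 1 : R) by exact: measurable_cst.
have b1 (y : V) : `|1 : R| <= 1 by rewrite normr1.
have := is_derive_conv (0 : V) u m1 b1 sf => d1.
have E : (fun x => integral_Rn (fun y => 1 * f (y - x))) = cst (integral_Rn f).
  apply/funext => x; rewrite -[RHS](integral_Rn_shift (- x)).
    by apply: eq_Rintegral => y _; rewrite mul1r.
  by apply: measurable_fun_rV; exact: schwartz_cont.
rewrite E in d1.
have := @derive_val _ _ _ _ _ _ _ d1; rewrite derive_cst => /esym/eqP.
rewrite oppr_eq0 => /eqP; apply: etrans.
by apply: eq_Rintegral => y _; rewrite mul1r subr0.
Qed.

Lemma derive_shiftV f x u y : schwartz f ->
  'D_u (fun y => f (y - x)) y = 'D_u f (y - x).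
Proof.
move=> sf.
have hL (h : R) : h *: u + y - x = h *: u + (y - x) by rewrite addrA.
exact: (@derive_val _ _ _ _ _ _ _ 
  (@is_derive_affine R V V f (fun y : V => y - x) u u y hL (schwartz_derivable sf))).
Qed.

Lemma kern_shift psi (G : 'I_n -> V -> R) x l m : (forall i, schwartz (G i)) ->
  kern (fun y => psi (y - x)) (fun i y => G i (y - x)) l m = (fun y => kern psi G l m (y - x)).
Proof. by move=> sG; apply/funext => y; rewrite /kern derive_shiftV. Qed.

End convolution.

(** * Advective derivative of a convolution *)

Section advected.
Variables (R : realType) (n : nat).
Local Notation V := 'rV[R]_n.
Local Notation e j := (delta_mx 0 j : V).
Variables (A : 'M[R]_n) (I : set R).
Hypotheses (uA : A \in unitmx) (oI : open I).
Variables (v : R * V -> V) (p : (R * V -> R) -> R) (M : R).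
Hypotheses (dp : distribution_on A I p) (ev : euler_weak A I v p).
Hypothesis av : forall i, admissible A I M (fun z => v z 0 i).
Variables (psi : V -> R) (G : 'I_n -> V -> R).
Hypotheses (spsi : schwartz psi) (sG : forall i, schwartz (G i)).
Hypothesis divK : forall l x, \sum_m 'D_(e m) (kern psi G l m) x = 0.

Definition avg (l : 'I_n) (z : R * V) : R :=
  integral_Rn (fun h => v (z.1, z.2 + h) 0 l * psi h).

Let psix x y := psi (y - x).
Let Gx x i y := G i (y - x).

Let spsix x : schwartz (psix x). Proof. exact: schwartz_shift. Qed.
Let sGx x i : schwartz (Gx x i). Proof. exact: schwartz_shift. Qed.
Let sK l m x : schwartz (kern (psix x) (Gx x) l m). Proof. exact: schwartz_kern. Qed.

Let divKx l x y : \sum_m 'D_(e m) (kern (psix x) (Gx x) l m) y = 0.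
Proof.
rewrite -[RHS](divK l (y - x)); apply: eq_bigr => m _.
rewrite (kern_shift psi x l m sG); apply: derive_shiftV.
exact: (schwartz_kern m spsi (sG l)).
Qed.

Let mslice t i : I t -> measR (fun y => v (t, y) 0 i).
Proof. exact: (measR_slice oI (av i)). Qed.

Let islice t i f : I t -> schwartz f -> intR (fun y => v (t, y) 0 i * f y).
Proof. exact: (intR_slice oI (av i)). Qed.

Lemma avg_conv l t x : I t -> avg l (t, x) = integral_Rn (fun y => v (t, y) 0 l * psix x y).
Proof.
move=> It; rewrite /avg /= -[RHS](integral_Rn_shift x).
  by apply: eq_Rintegral => y _; rewrite /psix addrK [x + _]addrC.
by apply: measurable_funM; [exact: mslice|apply: measurable_fun_rV; exact: schwartz_cont].
Qed.

(** The gradient of [Gx x l] pairs to 0 with the divergence-free [v (t, _)], so [psi e_l] may be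
    replaced by a divergence-free row, the only kind of field for which the time derivative is
    accessible. *)
Lemma avg_kern l t x : I t ->
  avg l (t, x) = \sum_m integral_Rn (fun y => v (t, y) 0 m * kern (psix x) (Gx x) l m y).
Proof.
move=> It; rewrite avg_conv//.
have sD m : schwartz ('D_(e m) (Gx x l)) by exact: schwartz_D.
apply: (sum_delta (l := l) (div_free_slice uA oI ev av (sGx x l) It)).
  rewrite /= /integral_Rn -(RintegralB measurableT (islice l It (spsix x)) (islice l It (sD l))).
  by apply: eq_Rintegral => y _; rewrite /kern eqxx mul1r mulrBr.
move=> m /negbTE ml.
rewrite /= -mulN1r /integral_Rn -(RintegralZl _ measurableT (islice m It (sD m))).
by apply: eq_Rintegral => y _; rewrite /kern eq_sym ml mul0r sub0r mulN1r mulrN.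
Qed.

Definition flux (l : 'I_n) (t : R) (x : V) : R :=
  \sum_m \sum_j integral_Rn (fun y => v (t, y) 0 m * v (t, y) 0 j *
    'D_(e j) (kern (psix x) (Gx x) l m) y).

Lemma is_derive_avg_time l t x : I t ->
  is_derive ((t, x) : R * V) (1, 0) (avg l) (flux l t x).
Proof.
move=> It.
have d1 := is_derive_pairing uA oI dp ev av (fun m => sK l m x) (divKx l x) It.
have d2 : is_derive (t : R^o) 1 (fun s : R => avg l (s, x)) (flux l t x).
  (* The two functions are known to agree only at times in [I], hence near [t] because [I] is
     open. *)
  apply: near_eq_is_derive d1.
  have : nbhs t I by apply: open_nbhs_nbhs; split.
  by apply: filterS => s Is; rewrite avg_kern.
have E : (fun h : R => h^-1 *: ((avg l \o shift (t, x)) (h *: (1, 0)) - avg l (t, x))) =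
    (fun h : R => h^-1 *: (((fun s : R => avg l (s, x)) \o shift t) (h *: (1 : R^o)) - avg l (t, x))).
  apply/funext => h /=; congr (_ *: (avg l _ - _)).
  by rewrite -[(_, _) + _]/(_, _) scaler0 add0r.
have dd : derivable (fun s : R => avg l (s, x)) (t : R^o) 1 by exact: ex_derive.
apply: DeriveDef; first by rewrite /derivable E.
by rewrite -(@derive_val _ _ _ _ _ _ _ d2) /derive E.
Qed.

Lemma is_derive_avg_space l t x u : I t ->
  is_derive ((t, x) : R * V) (0, u) (avg l)
    (- integral_Rn (fun y => v (t, y) 0 l * 'D_u (psix x) y)).
Proof.
move=> It; have [_ wM _] := av l.
have d1 := is_derive_conv x u (mslice l It) (fun y => wM (t, y) It) spsi.
have E : (fun h : R => h^-1 *: ((avg l \o shift (t, x)) (h *: (0, u)) - avg l (t, x))) =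
    (fun h : R => h^-1 *:
      (((fun x => integral_Rn (fun y => v (t, y) 0 l * psi (y - x))) \o shift x) (h *: u) -
      integral_Rn (fun y => v (t, y) 0 l * psi (y - x)))).
  apply/funext => h /=; rewrite avg_conv//; congr (_ *: (_ - _)).
  by rewrite -[(_, _) + _]/(_, _) scaler0 add0r avg_conv.
have dE : - integral_Rn (fun y => v (t, y) 0 l * 'D_u (psix x) y) =
    - integral_Rn (fun y => v (t, y) 0 l * 'D_u psi (y - x)).
  apply: f_equal; apply: eq_Rintegral => y _.
  exact: (f_equal (fun r => v (t, rV_of_tuple y) 0 l * r) (derive_shiftV x u (rV_of_tuple y) spsi)).
rewrite dE.
apply: DeriveDef; first by rewrite /derivable E; exact: (@ex_derive _ _ _ _ _ _ _ d1).
by rewrite -(@derive_val _ _ _ _ _ _ _ d1) /derive E.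
Qed.

(** The product of increments has four terms. The one quadratic in [v (t, y)] is the flux. The one
    with [v_m(x)] in front vanishes since div v = 0. The one with [v_j(x)] in front reproduces the
    transport term, and the constant one is the integral of a derivative. *)
Lemma advected_avg l t x : I t ->
  flux l t x + \sum_j v (t, x) 0 j * - integral_Rn (fun y => v (t, y) 0 l * 'D_(e j) (psix x) y) =
  \sum_m \sum_j integral_Rn (fun y => (v (t, y) 0 m - v (t, x) 0 m) *
    (v (t, y) 0 j - v (t, x) 0 j) * 'D_(e j) (kern (psix x) (Gx x) l m) y).
Proof.
move=> It.
pose K m := kern (psix x) (Gx x) l m.
have sDK m j : schwartz ('D_(e j) (K m)) by apply: schwartz_D; exact: sK.
have amul i j : admissible A I (M * M) (fun z => v z 0 i * v z 0 j).
  exact: (admissible_mul av i j).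
have iww m j : intR (fun y => v (t, y) 0 m * v (t, y) 0 j * 'D_(e j) (K m) y).
  exact: (intR_slice oI (amul m j) It (sDK m j)).
pose a m j := integral_Rn (fun y => v (t, y) 0 m * v (t, y) 0 j * 'D_(e j) (K m) y).
pose b i m j := integral_Rn (fun y => v (t, y) 0 i * 'D_(e j) (K m) y).
have expand m j : integral_Rn (fun y => (v (t, y) 0 m - v (t, x) 0 m) *
    (v (t, y) 0 j - v (t, x) 0 j) * 'D_(e j) (K m) y) =
    a m j - v (t, x) 0 m * b j m j - v (t, x) 0 j * b m m j.
  set cm := v (t, x) 0 m; set cj := v (t, x) 0 j.
  have i1 := iww m j.
  have i2 : intR (fun y => cm * (v (t, y) 0 j * 'D_(e j) (K m) y)).
    have := integrableZl measurableT cm (islice j It (sDK m j)).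
    by apply: eq_integrable => // y _; rewrite /= EFinM.
  have i3 : intR (fun y => cj * (v (t, y) 0 m * 'D_(e j) (K m) y)).
    have := integrableZl measurableT cj (islice m It (sDK m j)).
    by apply: eq_integrable => // y _; rewrite /= EFinM.
  have i4 : intR (fun y => cm * cj * 'D_(e j) (K m) y).
    have := integrableZl measurableT (cm * cj) (schwartz_intR (sDK m j)).
    by apply: eq_integrable => // y _; rewrite /= EFinM.
  have i12 : intR (fun y => v (t, y) 0 m * v (t, y) 0 j * 'D_(e j) (K m) y -
      cm * (v (t, y) 0 j * 'D_(e j) (K m) y)).
    have := integrableB measurableT i1 i2.
    by apply: eq_integrable => // y _; rewrite /= EFinB.
  have i34 : intR (fun y => cj * (v (t, y) 0 m * 'D_(e j) (K m) y) -
      cm * cj * 'D_(e j) (K m) y).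
    have := integrableB measurableT i3 i4.
    by apply: eq_integrable => // y _; rewrite /= EFinB.
  transitivity (integral_Rn (fun y => (v (t, y) 0 m * v (t, y) 0 j * 'D_(e j) (K m) y -
      cm * (v (t, y) 0 j * 'D_(e j) (K m) y)) -
      (cj * (v (t, y) 0 m * 'D_(e j) (K m) y) - cm * cj * 'D_(e j) (K m) y))).
    by apply: eq_Rintegral => y _; ring.
  rewrite /integral_Rn (RintegralB measurableT i12 i34) (RintegralB measurableT i1 i2).
  rewrite (RintegralB measurableT i3 i4).
  rewrite (RintegralZl _ measurableT (islice j It (sDK m j))).
  rewrite (RintegralZl _ measurableT (islice m It (sDK m j))).
  rewrite (RintegralZl _ measurableT (schwartz_intR (sDK m j))).
  (* The constant term drops out. *)
  have z : integral_Rn ('D_(e j) (K m)) = 0 by apply: integral_derive0; exact: sK.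
  rewrite /integral_Rn in z; rewrite z mulr0 subr0.
  by [].
under [RHS]eq_bigr do under eq_bigr do rewrite expand.
under [RHS]eq_bigr do rewrite !big_split/= !sumrN -mulr_sumr.
rewrite !big_split/= !sumrN.
(* Summed over [j], [v] is paired with the gradient of the fixed entry [K m]. *)
have z1 m : \sum_j b j m j = 0 by exact: (div_free_slice uA oI ev av (sK l m x) It).
have z2 : \sum_m v (t, x) 0 m * \sum_j b j m j = 0.
  by rewrite big1// => m _; rewrite z1 mulr0.
rewrite z2 subr0 [X in _ = _ - X]exchange_big/=.
apply: (f_equal (fun r => flux l t x + r)).
rewrite -sumrN; apply: eq_bigr => j _.
rewrite -mulr_sumr mulrN.
apply: (f_equal (fun r => - (v (t, x) 0 j * r))).
(* The derivative along [e j] of row [l] is the row built from the derivative of [psi] and corrected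
   by the gradient of [Gj]. So the argument that inserted the correction into [avg] now removes
   it. *)
pose Gj := 'D_(e j) (Gx x l).
have sGj : schwartz Gj by exact: schwartz_D.
have sD m : schwartz ('D_(e m) Gj) by apply: schwartz_D; exact: sGj.
have sDpsi : schwartz ('D_(e j) (psix x)) by apply: schwartz_D; exact: spsix.
have KE m y : 'D_(e j) (K m) y = (l == m)%:R * 'D_(e j) (psix x) y - 'D_(e m) Gj y.
  rewrite /K (derive_kern m _ _ (spsix x) (sGx x l)).
  by rewrite (schwartz_derive_comm (e j) (e m) y (sGx x l)).
apply: (sum_delta (l := l) (div_free_slice uA oI ev av sGj It)).
  rewrite /= /b /integral_Rn -(RintegralB measurableT (islice l It sDpsi) (islice l It (sD l))).
  by apply: eq_Rintegral => y _; rewrite KE eqxx mul1r mulrBr.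
move=> m /negbTE ml.
rewrite /= -mulN1r /b /integral_Rn -(RintegralZl _ measurableT (islice m It (sD m))).
by apply: eq_Rintegral => y _; rewrite KE eq_sym ml mul0r sub0r mulN1r mulrN.
Qed.

Lemma derivable_avg l t x o : I t -> derivable (avg l) ((t, x) : R * V) (dir R o).
Proof.
move=> It; case: o => [j|].
  exact: (@ex_derive _ _ _ _ _ _ _ (is_derive_avg_space l x (e j) It)).
exact: (@ex_derive _ _ _ _ _ _ _ (is_derive_avg_time l x It)).
Qed.

Lemma advect_avg l t x : I t ->
  pd None (avg l : _ -> R^o) (t, x) + \sum_j v (t, x) 0 j * pd (Some j) (avg l : _ -> R^o) (t, x) =
  \sum_m \sum_j integral_Rn (fun h => (v (t, x + h) 0 m - v (t, x) 0 m) *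
    (v (t, x + h) 0 j - v (t, x) 0 j) * 'D_(e j) (kern psi G l m) h).
Proof.
move=> It; rewrite /pd (@derive_val _ _ _ _ _ _ _ (is_derive_avg_time l x It)).
transitivity (flux l t x + \sum_j v (t, x) 0 j *
    - integral_Rn (fun y => v (t, y) 0 l * 'D_(e j) (psix x) y)).
  apply: f_equal; apply: eq_bigr => j _.
  exact: (f_equal (fun r => v (t, x) 0 j * r)
    (@derive_val _ _ _ _ _ _ _ (is_derive_avg_space l x (e j) It))).
rewrite (advected_avg l x It); apply: eq_bigr => m _; apply: eq_bigr => j _.
have sDK : schwartz ('D_(e j) (kern psi G l m)).
  by apply: schwartz_D; exact: schwartz_kern spsi (sG l).
have sDx : schwartz ('D_(e j) (kern (psix x) (Gx x) l m)) by apply: schwartz_D; exact: sK.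
have mDx : measR ('D_(e j) (kern (psix x) (Gx x) l m)).
  exact: (measurable_fun_rV (schwartz_cont sDx)).
have mdiff i : measR (fun y => v (t, y) 0 i - v (t, x) 0 i).
  by apply: measurable_funB; [exact: mslice|exact: measurable_cst].
have mF := measurable_funM (measurable_funM (mdiff m) (mdiff j)) mDx.
apply: (etrans (esym (integral_Rn_shift (f := fun y => (v (t, y) 0 m - v (t, x) 0 m) *
  (v (t, y) 0 j - v (t, x) 0 j) * 'D_(e j) (kern (psix x) (Gx x) l m) y) x mF))).
apply: eq_Rintegral => y _ /=; rewrite [rV_of_tuple y + x]addrC.
apply: f_equal; rewrite (kern_shift psi x l m sG).
rewrite (derive_shiftV x (e j) _ (schwartz_kern m spsi (sG l))).
by rewrite [x + _]addrC addrK.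
Qed.

End advected.

(** * The estimate *)

Section bounded.
Variables (R : realType) (n : nat).
Local Notation V := 'rV[R]_n.

(** A nonempty open set of times contains a ball, which has positive measure and cannot lie in the
    exceptional null set. *)
Lemma ae_open_exists (I J : set R) (P : R -> Prop) (t : R) : open J -> J t ->
  {ae @lebesgue_measure R, forall t, I t -> P t} -> J `<=` I -> exists2 s, J s & P s.
Proof.
move=> oJ Jt [N [mN N0 NP]] JI; apply: contrapT => nex.
have /nbhs_ballP[r /= r0 rJ] : nbhs t J by apply: open_nbhs_nbhs; split.
have bN : ball t r `<=` N.
  move=> s /rJ Js; apply: NP => Ps; apply: nex; exists s => //.
  by apply: Ps; exact: JI.
have mb : measurable (ball t r : set (measurableTypeR R)) by exact: measurable_ball.
have h := @subset_measure0 _ _ _ (@lebesgue_measure R) _ _ mb mN bN N0.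
have := lebesgue_measure_ball t (ltW r0).
move=> E; have : (r *+ 2)%:E = 0%E :> \bar R by rewrite -E.
move=> -[] /eqP; rewrite mulrn_eq0 /= => /eqP rz.
by rewrite rz ltxx in r0.
Qed.

(** Continuity turns the almost-everywhere bound into a bound at all times: a violation would
    persist on an open set of times. *)
Lemma Linfty_bounded (I : set R) (alpha : R) (v : R * V -> V) : open I ->
  (forall z, I z.1 -> {for z, continuous v}) -> Linfty_Calpha I alpha v ->
  exists M : R, forall z i, I z.1 -> `|v z 0 i| <= M.
Proof.
move=> oI cv [M aeM]; exists M => -[t x] i /= It.
rewrite leNgt; apply/negP => Mv.
have cvi : {for t, continuous (fun s : R => v (s, x) 0 i)}.
  apply: (@continuous_comp _ _ _ (fun s : R => (s, x)) (fun z => v z 0 i)).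
    move=> B [[B1 B2] /= [B1t B2x] sub]; rewrite /nbhs /=.
    apply: filterS B1t => s B1s; apply: sub; split => //=.
    exact: nbhs_singleton B2x.
  apply: (@continuous_comp _ _ _ v (fun y : V => y 0 i)); first exact: cv.
  exact: coord_continuous.
(* A change smaller than the excess over [M] cannot bring the value down to [M]. *)
have e0 : 0 < `|v (t, x) 0 i| - M by rewrite subr_gt0.
have [d d0 Hd] := continuous_eps cvi e0.
have oJ : open (I `&` ball t d) by apply: openI => //; exact: ball_open.
have Jt : (I `&` ball t d) t by split => //; exact: ballxx.
have [s [Is sd] [sM _]] := ae_open_exists oJ Jt aeM (@subIsetl _ _ _).
have h1 : `|v (s, x) 0 i| <= M by apply: le_trans (sM x); exact: coord_le_enorm.
have h2 : `|v (s, x) 0 i - v (t, x) 0 i| < `|v (t, x) 0 i| - M.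
  by apply: Hd; move: sd; rewrite /ball /= distrC.
have h3 : `|v (t, x) 0 i| <= `|v (s, x) 0 i| + `|v (s, x) 0 i - v (t, x) 0 i|.
  by rewrite -lerBlDl; apply: lerB_dist2 || (rewrite distrC; exact: lerB_dist).
by move: h1 h2 h3; move: `|_ - _| => p1; move: `|v (s, x) 0 i| `|v (t, x) 0 i| => a b; lra.
Qed.

Lemma admissible_coord (A : 'M[R]_n) (I : set R) (alpha : R) (v : R * V -> V) : open I ->
  (forall z, I z.1 -> {for z, continuous v}) -> periodic_on A I v ->
  Linfty_Calpha I alpha v ->
  exists M : R, forall i, admissible A I M (fun z => v z 0 i).
Proof.
move=> oI cv pv Lv; have [M HM] := Linfty_bounded oI cv Lv; exists M => i; split.
- move=> z Iz; apply: (@continuous_comp _ _ _ v (fun y : V => y 0 i)); first exact: cv.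
  exact: coord_continuous.
- by move=> z; exact: HM.
- by move=> t x g It Ag; rewrite pv.
Qed.

End bounded.

(** * Dyadic kernels and scaling *)

Section dyadic.
Variables (R : realType) (n : nat).
Local Notation V := 'rV[R]_n.
Implicit Types (eta f : V -> R).

Lemma eta_le_dilate eta k : eta_le eta k = dilate ((2 : R) ^ k) eta.
Proof. by apply/funext => h; rewrite /eta_le /dilate [n%:Z * k]mulrC -exprz_exp -exprnP. Qed.

Definition annular eta (y : V) : R := eta y - 2^-1 ^+ n * eta (2^-1 *: y).

Lemma schwartz_annular eta : schwartz eta -> schwartz (annular eta).
Proof.
move=> se; have h0 : 0 < 2^-1 :> R by rewrite invr_gt0.
exact: (schwartz_sub se (schwartz_dilate h0 se)).
Qed.

Lemma eta_annular eta k h :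
  eta_le eta k h - eta_le eta (k - 1) h = dilate ((2 : R) ^ k) (annular eta) h.
Proof.
rewrite !eta_le_dilate /dilate /annular expfzDr ?pnatr_eq0// scalerA [2^-1 * _]mulrC.
by rewrite exprMn_comm; [rewrite mulrBr mulrA|exact: mulrC].
Qed.

Lemma norm_integral_le (f g : V -> R) : measR f -> intR g ->
  (forall x, `|f x| <= g x) -> `|integral_Rn f| <= integral_Rn g.
Proof.
move=> mf ig fg.
have jf : intR f.
  apply: (le_integrable measurableT _ _ ig); first exact/measurable_EFinP.
  by move=> y _ /=; rewrite lee_fin (le_trans (fg _))// ler_norm.
apply: (le_trans (le_normr_Rintegral measurableT jf)).
apply: (le_Rintegral measurableT _ ig); last by move=> y _; exact: fg.
by have := integrable_abse jf; apply: eq_integrable.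
Qed.

(** Multiplication by [1 + |y|^2], written with coordinates so that [schwartz_coord] applies. This
    weight replaces [|y|] to the power [2 * alpha] and frees the constant from [alpha]. *)
Definition moment f (y : V) : R := f y + \sum_i y 0 i * (y 0 i * f y).

Lemma momentE f y : moment f y = (1 + enorm y ^+ 2) * f y.
Proof.
rewrite /moment sqr_enorm /dotp mulrDl mul1r mulr_suml; congr (_ + _).
by apply: eq_bigr => i _; rewrite mulrA.
Qed.

Lemma schwartz_moment f : schwartz f -> schwartz (moment f).
Proof.
move=> sf; apply: schwartz_add => //; apply: schwartz_sum => i.
by do 2 apply: schwartz_coord.
Qed.

Lemma powR_le_sqr (r b : R) : 0 <= r -> 0 < b -> b <= 2 -> r `^ b <= 1 + r ^+ 2.
Proof.
move=> r0 b0 b2; have [r1|r1] := leP r 1.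
  apply: (@le_trans _ _ 1); last by rewrite lerDl sqr_ge0.
  have <- : 1 `^ b = 1 :> R by rewrite powR1.
  by apply: ge0_ler_powR; rewrite ?nnegrE// ltW.
apply: (@le_trans _ _ (r ^+ 2)); last by rewrite lerDr.
by rewrite -powR_mulrn//; apply: ler_powR => //; exact: ltW.
Qed.

(** The power of [c] comes from writing [c |h|^(2 alpha)] as [c^(1 - 2 alpha) |c h|^(2 alpha)]. The
    factor in [c h] is at most [1 + |c h|^2], because [2 * alpha < 2], and is absorbed into the
    dilated moment. *)
Lemma dilated_bound (alpha c S a b : R) f h : 0 < alpha < 1 -> 0 < c -> 0 <= S ->
  `|a| <= S * enorm h `^ alpha -> `|b| <= S * enorm h `^ alpha ->
  `|a * b * (c * dilate c f h)| <= S ^+ 2 * c `^ (1 - 2 * alpha) * `|dilate c (moment f) h|.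
Proof.
move=> /andP[a0 a1] c0 S0 ha hb.
have hab : `|a * b| <= S ^+ 2 * enorm h `^ (2 * alpha).
  have -> : enorm h `^ (2 * alpha) = enorm h `^ alpha * enorm h `^ alpha.
    by rewrite mulrC powRrM powR_mulrn ?powR_ge0// expr2.
  by rewrite normrM expr2 mulrACA ler_pM.
have E : c * enorm h `^ (2 * alpha) =
    c `^ (1 - 2 * alpha) * enorm (c *: h) `^ (2 * alpha).
  rewrite enormZ gtr0_norm// powRM ?enorm_ge0 ?ltW// mulrA -powRD ?subrK ?powRr1 ?ltW//.
  by apply/implyP; rewrite gt_eqF.
have P : enorm (c *: h) `^ (2 * alpha) <= 1 + enorm (c *: h) ^+ 2.
  by apply: powR_le_sqr; [exact: enorm_ge0|rewrite mulr_gt0|rewrite -[leRHS]mulr1 ler_pM2l// ltW].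
have c1 : 0 <= c `^ (1 - 2 * alpha) by exact: powR_ge0.
have cn : 0 < c ^+ n by exact: exprn_gt0.
rewrite /dilate momentE !normrM (gtr0_norm c0) (gtr0_norm cn) -normrM.
have q0 : 0 <= 1 + enorm (c *: h) ^+ 2 by rewrite addr_ge0// sqr_ge0.
rewrite (ger0_norm q0); set F := `|f _|.
have F0 : 0 <= F by exact: normr_ge0.
apply: (@le_trans _ _ (S ^+ 2 * enorm h `^ (2 * alpha) * (c * (c ^+ n * F)))).
  apply: ler_wpM2r hab; apply: mulr_ge0; first exact: ltW.
  by apply: mulr_ge0; first exact: ltW.
have -> : S ^+ 2 * enorm h `^ (2 * alpha) * (c * (c ^+ n * F)) =
    S ^+ 2 * (c * enorm h `^ (2 * alpha)) * (c ^+ n * F) by ring.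
rewrite E; set q := 1 + enorm (c *: h) ^+ 2 in q0 P *; set x := enorm _ `^ _; set d := c `^ _.
have -> : S ^+ 2 * d * (c ^+ n * (q * F)) = S ^+ 2 * (d * q) * (c ^+ n * F) by ring.
apply: ler_wpM2r; first by rewrite mulr_ge0// ltW.
by apply: ler_wpM2l; [exact: sqr_ge0|exact: ler_wpM2l].
Qed.

(** Dilation with the factor [c ^+ n] preserves the L^1 norm, so the remaining integral is that of
    the undilated moment. *)
Lemma integral_dilated_bound (alpha c S : R) f (a b : V -> R) : 0 < alpha < 1 -> 0 < c ->
  0 <= S -> schwartz f -> measR a -> measR b ->
  (forall h, `|a h| <= S * enorm h `^ alpha) -> (forall h, `|b h| <= S * enorm h `^ alpha) ->
  `|integral_Rn (fun h => a h * b h * (c * dilate c f h))| <=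
    S ^+ 2 * c `^ (1 - 2 * alpha) * integral_Rn (fun y => `|moment f y|).
Proof.
move=> al c0 S0 sf ma mb ha hb.
have sm := schwartz_moment sf.
have sd := schwartz_dilate c0 sm.
have id : intR (fun h => `|dilate c (moment f) h|).
  by have := integrable_abse (schwartz_intR sd); apply: eq_integrable.
have mm : measR (fun y => `|moment f y|).
  by apply: measurableT_comp => //; apply: measurable_fun_rV; exact: schwartz_cont.
have <- : integral_Rn (fun h => `|dilate c (moment f) h|) = integral_Rn (fun y => `|moment f y|).
  have cn : 0 <= c ^+ n by rewrite exprn_ge0// ltW.
  have im : intR (fun h : V => `|moment f (c *: h)|).
    have := integrable_abse (schwartz_intR (schwartz_affine 0 (lt0r_neq0 c0) sm)).
    by apply: eq_integrable => // y _ /=; rewrite addr0.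
  rewrite -(integral_Rn_scale c0 mm) ?[in RHS]/integral_Rn => [|x]; last exact: normr_ge0.
  rewrite -(RintegralZl _ measurableT im).
  by apply: eq_Rintegral => y _; rewrite /dilate normrM (ger0_norm cn).
set r := S ^+ 2 * _.
have <- : integral_Rn (fun h => r * `|dilate c (moment f) h|) =
    r * integral_Rn (fun h => `|dilate c (moment f) h|).
  exact: (RintegralZl _ measurableT id).
apply: norm_integral_le.
- apply: measurable_funM; first exact: measurable_funM.
  apply: measurable_funM; first exact: measurable_cst.
  exact: (measurable_fun_rV (schwartz_cont (schwartz_dilate c0 sf))).
- have := integrableZl measurableT r id.
  by apply: eq_integrable => // y _ /=; rewrite EFinM.
- by move=> h; exact: dilated_bound.
Qed.

End dyadic.

(** * The advective derivative of P_k v *)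

Section projection.
Variables (R : realType) (n : nat).
Local Notation V := 'rV[R]_n.
Local Notation e j := (delta_mx 0 j : V).
Variables (eta : V -> R) (A : 'M[R]_n) (I : set R).
Variables (v : R * V -> V) (p : (R * V -> R) -> R) (M : R) (k : int).
Hypotheses (heta : LP_cutoff eta) (uA : A \in unitmx) (oI : open I).
Hypotheses (dp : distribution_on A I p) (ev : euler_weak A I v p).
Hypothesis av : forall i, admissible A I M (fun z => v z 0 i).

Let psi := annular eta.
Let G := coordmul (scale_avg n.-1 eta).
Let c : R := 2 ^ k.
Let psik := dilate c psi.
Let Gk i x := c^-1 * dilate c (G i) x.

Let c0 : 0 < c. Proof. exact: exprz_gt0. Qed.
Let seta : schwartz eta. Proof. by case: heta. Qed.
Let spsi : schwartz psi. Proof. exact: schwartz_annular. Qed.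
Let sG i : schwartz (G i).
Proof. by apply: schwartz_coord; exact: schwartz_scale_avg. Qed.
Let spsik : schwartz psik. Proof. exact: schwartz_dilate. Qed.
Let sGk i : schwartz (Gk i).
Proof. apply: schwartz_scale; exact: (schwartz_dilate c0 (sG i)). Qed.
Let sK l m : schwartz (kern psi G l m).
Proof. exact: (schwartz_kern m spsi (sG l)). Qed.

Let kernkE l m : kern psik Gk l m = dilate c (kern psi G l m).
Proof. exact: (kern_dilate psi l m c0 sG). Qed.

Let divKk l x : \sum_m 'D_(e m) (kern psik Gk l m) x = 0.
Proof.
have radial : forall x y, enorm x = enorm y -> eta x = eta y by case: heta.
have d0 := @kern_div_free R n eta psi l (c *: x) seta radial (fun=> erefl).
transitivity (c * c ^+ n * \sum_m 'D_(e m) (kern psi G l m) (c *: x)); last first.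
  by rewrite [X in _ * X]d0 mulr0.
rewrite mulr_sumr; apply: eq_bigr => m _.
by rewrite kernkE (derive_dilate c (e m) x (sK l m)) /dilate mulrA.
Qed.

Lemma intR_conv t x i f : I t -> schwartz f -> intR (fun h => v (t, x + h) 0 i * f h).
Proof.
move=> It sf; have := intR_shift x (intR_slice oI (av i) It (schwartz_shift x sf)).
by apply: eq_integrable => // y _ /=; rewrite addrK addrC.
Qed.

Lemma LP_avg l z : I z.1 -> LP eta k v z 0 l = avg v psik l z.
Proof.
case: z => t x /= It; rewrite /LP /LP_le !mxE /avg /=.
have s1 : schwartz (eta_le eta k).
  by rewrite eta_le_dilate; apply: schwartz_dilate => //; exact: exprz_gt0.
have s2 : schwartz (eta_le eta (k - 1)).
  by rewrite eta_le_dilate; apply: schwartz_dilate => //; exact: exprz_gt0.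
rewrite /integral_Rn -(RintegralB measurableT (intR_conv x l It s1) (intR_conv x l It s2)).
by apply: eq_Rintegral => y _; rewrite -mulrBr eta_annular.
Qed.

Lemma is_derive_LP l z o : I z.1 ->
  is_derive z (dir R o) (fun z => LP eta k v z 0 l) (pd o (avg v psik l : _ -> R^o) z).
Proof.
case: z => t x Iz.
have d := @derivable_avg R n A I uA oI v p M dp ev av psik Gk spsik sGk divKk l t x o Iz.
have : \forall z \near (t, x), I z.1.
  by apply: open_nbhs_nbhs; split => //; exact: open_slab.
move=> nI; apply: near_eq_is_derive (derivableP d).
by apply: filterS nI => z Jz; rewrite LP_avg.
Qed.

Lemma derivable_LP z o : I z.1 -> derivable (LP eta k v) z (dir R o).
Proof.
move=> Iz; apply/derivable_mxP => i l; rewrite ord1.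
exact: (@ex_derive _ _ _ _ _ _ _ (is_derive_LP l o Iz)).
Qed.

Lemma advect_LP t x l : I t ->
  advect v (LP eta k v) (t, x) 0 l =
  \sum_m \sum_j integral_Rn (fun h => (v (t, x + h) 0 m - v (t, x) 0 m) *
    (v (t, x + h) 0 j - v (t, x) 0 j) * (c * dilate c ('D_(e j) (kern psi G l m)) h)).
Proof.
move=> It.
have D o : pd o (LP eta k v) (t, x) 0 l = pd o (avg v psik l : _ -> R^o) (t, x).
  rewrite /pd derive_mx; last exact: derivable_LP.
  by rewrite mxE; exact: (@derive_val _ _ _ _ _ _ _ (@is_derive_LP l (t, x) o It)).
rewrite /advect mxE summxE D.
rewrite (eq_bigr (fun j => v (t, x) 0 j * pd (Some j) (avg v psik l : _ -> R^o) (t, x))).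
  rewrite (@advect_avg R n A I uA oI v p M dp ev av psik Gk spsik sGk divKk l t x It).
  apply: eq_bigr => m _; apply: eq_bigr => j _; apply: eq_Rintegral => y _.
  by rewrite kernkE (derive_dilate c (e j) _ (sK l m)).
by move=> j _; rewrite mxE D.
Qed.

Lemma advect_LP_bound (alpha S : R) t x : 0 < alpha < 1 -> 0 <= S -> I t ->
  (forall i h, `|v (t, x + h) 0 i - v (t, x) 0 i| <= S * enorm h `^ alpha) ->
  enorm (advect v (LP eta k v) (t, x)) <= S ^+ 2 * c `^ (1 - 2 * alpha) *
    \sum_l \sum_m \sum_j integral_Rn (fun y => `|moment ('D_(e j) (kern psi G l m)) y|).
Proof.
move=> al S0 It Sv; apply: (le_trans (enorm_le_sum _)).
rewrite mulr_sumr; apply: ler_sum => l _; rewrite advect_LP//.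
rewrite mulr_sumr; apply: (le_trans (ler_norm_sum _ _ _)); apply: ler_sum => m _.
rewrite mulr_sumr; apply: (le_trans (ler_norm_sum _ _ _)); apply: ler_sum => j _.
have mdiff i : measR (fun h => v (t, x + h) 0 i - v (t, x) 0 i).
  apply: measurable_funB; last exact: measurable_cst.
  have := measR_aff 1 x (measR_slice oI (av i) It); apply: eq_measurable_fun => y _.
  by rewrite scale1r addrC.
have sD : schwartz ('D_(e j) (kern psi G l m)) by apply: schwartz_D; exact: sK.
exact: (integral_dilated_bound al c0 S0 sD (mdiff m) (mdiff j) (Sv m) (Sv j)).
Qed.

End projection.

Lemma coord_holder (R : realType) (n : nat) (I : set R) (alpha S : R)
    (v : R * 'rV[R]_n -> 'rV[R]_n) t x h i : 0 < alpha ->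
  (holder_seminorm I alpha v <= S%:E)%E -> I t ->
  `|v (t, x + h) 0 i - v (t, x) 0 i| <= S * enorm h `^ alpha.
Proof.
move=> a0 HS It; have [->|h0] := eqVneq h 0.
  (* The seminorm ranges over nonzero [h] only. At [h = 0] both sides vanish; 0 to the power [alpha]
     is 0 because [alpha] is nonzero. *)
  have -> : enorm (0 : 'rV[R]_n) = 0.
    by rewrite /enorm /dotp big1 ?sqrtr0// => j _; rewrite mxE mul0r.
  by rewrite addr0 subrr normr0 powR0 ?mulr0// gt_eqF.
have e0 : 0 < enorm h.
  rewrite lt_neqAle enorm_ge0 andbT eq_sym; apply: contra_neq h0 => eh.
  by apply/rowP => j; rewrite mxE; apply/eqP; rewrite -normr_le0 -eh; exact: coord_le_enorm.
rewrite -ler_pdivrMr ?powR_gt0//; apply: (@le_trans _ _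
    (enorm (v (t, x + h) - v (t, x)) / enorm h `^ alpha)).
  rewrite ler_pM2r ?invr_gt0 ?powR_gt0//.
  by have := coord_le_enorm (v (t, x + h) - v (t, x)) i; rewrite !mxE.
rewrite -lee_fin; apply: le_trans HS; apply: ereal_sup_ubound.
by exists t, x, h.
Qed.

Unset Implicit Arguments.

(** Derivability is part of the conclusion because a directional derivative that does not exist
    still has a default value, for which the bound alone would be meaningless. *)
Theorem lemma1p1 (R : realType) (n : nat) (hn : (2 <= n)%N)
    (eta : 'rV[R]_n -> R) (heta : LP_cutoff eta) :
  exists C : R,
    forall (A : 'M[R]_n) (I : set R) (alpha : R)
           (v : R * 'rV[R]_n -> 'rV[R]_n) (p : (R * 'rV[R]_n -> R) -> R),
      A \in unitmx ->
      open I -> is_interval I -> I !=set0 ->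
      0 < alpha < 1 ->
      periodic_on A I v ->
      (forall z, I z.1 -> {for z, continuous v}) ->
      distribution_on A I p ->
      euler_weak A I v p ->
      Linfty_Calpha I alpha v ->
      forall k : int,
        (forall z o, I z.1 -> derivable (LP eta k v) z (dir R o)) /\
        (C0_norm I (advect v (LP eta k v)) <=
           (C * 2 `^ ((1 - 2 * alpha) * k%:~R))%:E *
             holder_seminorm I alpha v ^+ 2)%E.
Proof.
(* Weighted L^1 norms of the derivatives of the kernel at scale 1; only [n] and [eta] enter. *)
pose C0 := \sum_l \sum_m \sum_j integral_Rn (fun y => `|moment ('D_(delta_mx 0 j)
  (kern (annular eta) (coordmul (scale_avg n.-1 eta)) l m)) y|).
have C00 : 0 <= C0.
  do 3 (apply: sumr_ge0 => ? _); apply: Rintegral_ge0 => y _; exact: normr_ge0.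
(* Adding 1 makes the factor strictly positive, so that the right-hand side is [+oo] when the
   seminorm is. *)
exists (C0 + 1) => A I alpha v p uA oI _ [t0 It0] al pv cv dp ev Lv k.
have [M av] := admissible_coord oI cv pv Lv.
split=> [z o Iz|]; first exact: (@derivable_LP R n eta A I v p M k heta uA oI dp ev av z o Iz).
have a0 : 0 < alpha by case/andP: al.
set P := 2 `^ _.
have P0 : 0 < P by exact: powR_gt0.
have CP : 0 < (C0 + 1) * P by rewrite mulr_gt0// ltr_wpDl.
(* The supremum of an empty set would be [-oo]; a time in [I] and a nonzero vector, available since
   [n] is positive, exclude this. *)
have S0 : (0 <= holder_seminorm I alpha v)%E.
  pose h : 'rV[R]_n := delta_mx 0 (Ordinal (ltnW hn)).
  have h0 : h != 0.
    apply/eqP => /rowP /(_ (Ordinal (ltnW hn))); rewrite !mxE !eqxx => /eqP.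
    by rewrite oner_eq0.
  apply: (@le_trans _ _ ((enorm (v (t0, 0 + h) - v (t0, 0)) / enorm h `^ alpha)%:E)).
    by rewrite lee_fin divr_ge0 ?enorm_ge0// powR_ge0.
  by apply: ereal_sup_ubound; exists t0, 0, h.
case ES : (holder_seminorm I alpha v) S0 => [S||] // S0; last first.
  rewrite expe2 mulyy gt0_muley ?lte_fin//; exact: leey.
apply: ub_ereal_sup => _ [[t x] /= It <-].
rewrite -!EFinM lee_fin -expr2.
have Sv i h : `|v (t, x + h) 0 i - v (t, x) 0 i| <= S * enorm h `^ alpha.
  by apply: (coord_holder (I := I)) => //; rewrite ES.
rewrite lee_fin in S0.
apply: (le_trans (advect_LP_bound k heta uA oI dp ev av al S0 It Sv)).
have -> : ((2 : R) ^ k) `^ (1 - 2 * alpha) = P.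
  by rewrite -powR_intmul// -powRrM mulrC.
rewrite -/C0; have -> : S ^+ 2 * P * C0 = C0 * P * S ^+ 2 by ring.
apply: ler_wpM2r; first exact: sqr_ge0.
by apply: ler_wpM2r; [exact: ltW|rewrite lerDl].
Qed.
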